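(* The sums $$p_3+p_7+p_7,\quad p_4+p_5+p_5,\quad p_4+p_4+p_8,\quad p_4+p_8+p_8,\quad p_4+p_4+p_{10},\quad p_5+p_5+p_{10}$$ are universal over $\mathbb{Z}$ but not universal over $\mathbb{N}$.
   Context: $\mathbb{N}=\{0,1,2,\ldots\}$. For an integer $m\ge 3$ and $x\in\mathbb{Z}$, $p_m(x)=\frac{(m-2)x^2-(m-4)x}{2}$. For integers $i,j,k\ge 3$, the sum $p_i+p_j+p_k$ is called universal over $\mathbb{Z}$ (respectively, over $\mathbb{N}$) if every $n\in\mathbb{N}$ can be written as $n=p_i(x)+p_j(y)+p_k(z)$ with $x,y,z\in\mathbb{Z}$ (respectively, with $x,y,z\in\mathbb{N}$). *)

(* Defs.v *)
From mathcomp Require Import all_boot all_order all_algebra.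
From mathcomp Require Import ring.
Set Implicit Arguments.
Unset Strict Implicit.
Unset Printing Implicit Defensive.
Import GRing.Theory.
Local Open Scope ring_scope.

(* The numerator is always even, so the Euclidean quotient is the exact half:
   see polygonal_double. Subtraction is in int, not truncated; only m >= 3 is
   meaningful. *)
Definition polygonal (m : nat) (x : int) : int :=
  (((m%:Z - 2) * x ^+ 2 - (m%:Z - 4) * x) %/ 2)%Z.

Definition universal_Z (i j k : nat) : Prop :=
  forall n : nat, exists x y z : int,
    n%:Z = polygonal i x + polygonal j y + polygonal k z.

Definition universal_N (i j k : nat) : Prop :=
  forall n : nat, exists x y z : nat,
    n%:Z = polygonal i x%:Z + polygonal j y%:Z + polygonal k z%:Z.

Lemma polygonal_double (m : nat) (x : int) :
  polygonal m x * 2 = (m%:Z - 2) * x ^+ 2 - (m%:Z - 4) * x.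
Proof.
rewrite /polygonal; apply: divzK.
have -> : (m%:Z - 2) * x ^+ 2 - (m%:Z - 4) * x
  = m%:Z * (x * (x - 1)) + (2 * x - x ^+ 2) * 2 by ring.
have even_xx1 : (2 %| x * (x - 1))%Z.
  rewrite (divz_eq x 2).
  have := modz_ge0 x (isT : (2 : int) != 0).
  have := ltz_pmod x (isT : 0 < (2 : int)).
  case: (modz x 2) => [[|[|r]]|r] // _ _.
  - by rewrite addr0 -mulrA dvdz_mull // dvdz_mulr.
  - by rewrite addrK dvdz_mull // dvdz_mull.
by rewrite rpredD // dvdz_mull.
Qed.

(* Main.v *)
Require Import Defs.
From mathcomp Require Import all_boot all_order all_algebra.
From mathcomp Require Import cyclic finfield.
From mathcomp Require Import zify ring lra.
From mathcomp Require Import reals exp Rstruct.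
Set Implicit Arguments.
Unset Strict Implicit.
Unset Printing Implicit Defensive.
Import Order.TTheory GRing.Theory Num.Theory.
Local Open Scope ring_scope.

(* Completing squares turns the six sums into ternary quadratic forms: the sums of
   three squares and the forms x^2 + y^2 + 3 z^2, x^2 + y^2 + 5 z^2 (which
   represents N when 5 N is a sum of three squares) and x^2 + 16 y^2 + 16 z^2, with
   congruence conditions that hold automatically or after a change of variables.

   To represent N by x^2 + y^2 + d z^2 over the rationals, choose a prime q = 1 mod 4
   with prescribed Legendre symbols (q/p) at the primes p dividing N, in such a way
   that the conic k q u^2 + d z^2 = N t^2 satisfies the local conditions of Legendre's
   theorem, where k q is a sum of two squares. The Davenport-Cassels argument then
   makes the representation integral; for d = 3 it is applied to the larger lattice
   x^2 + u^2 + u v + v^2.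

   Since only quadratic symbols of q are prescribed, such a q is obtained from real
   characters alone: L(1, chi) <> 0 by the Lambert series argument, and
   Mertens' estimate for \sum chi(n) Lambda(n) / n, with all sums finite.

   For x^2 + 16 y^2 + 16 z^2 = 16 n + 9, an integral conjugation by a quaternion of
   prime norm p = 3 mod 8 exchanges the two classes of representations of 16 n + 9 as
   w^2 + (2 a)^2 + (2 b)^2 according to the parity of a and b. *)

(** * Real characters and L(1, chi) *)

(** For x^2 + y^2 + 3 z^2 the descent cannot be run directly: rounding to an integral point may
    leave 1/4 + 1/4 + 3/4 > 1. In the lattice of x^2 + u^2 + u v + v^2 rounding leaves at most 1,
    and breaking ties in opposite directions for u and v makes this strict. Nothing is lost, because
    u^2 + u v + v^2 always has the form y^2 + 3 z^2. A number 16 n + 9 may have representations of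
    both classes, as 41 = 5^2 + 4^2 + 0^2 = 1^2 + 6^2 + 2^2, so three squares alone do not suffice.
    The conjugation requires -N to be a square modulo p = 3 mod 8, that is (N/p) = -1, which
    excludes square N; but then N = m^2 + 0^2 + 0^2 is already in the wanted class. Without limits,
    L(1, chi) <> 0 reads: some partial sum, up to k, exceeds M / (k + 1) in absolute value, which is
    the bound for the tail after k. *)

Lemma big_divisors_pfactor (V : nmodType) (p k m : nat) (F : nat -> V) :
  prime p -> (0 < m)%N -> ~~ (p %| m)%N ->
  \sum_(d <- divisors (p ^ k * m)) F d =
  \sum_(0 <= i < k.+1) \sum_(d <- divisors m) F (p ^ i * d)%N.
Proof.
move=> p_pr m_gt0 pNm; have p_gt0 := prime_gt0 p_pr.
have pm_gt0 : (0 < p ^ k * m)%N by rewrite muln_gt0 expn_gt0 p_gt0.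
have cop i d : (d %| m)%N -> coprime (p ^ i) d.
  move=> dm; apply: coprimeXl; rewrite prime_coprime //.
  by apply: contra pNm => /dvdn_trans; apply.
rewrite -big_allpairs_dep; apply: perm_big; apply: uniq_perm.
- exact: divisors_uniq.
- apply: (@allpairs_uniq _ _ _ (fun i d => p ^ i * d)%N).
  + exact: iota_uniq.
  + exact: divisors_uniq.
  move=> u v /allpairsPdep[i1 [d1 [_ d1m ->]]].
  move=> /allpairsPdep[j1 [e1 [_ e1m ->]]] /= eq_ie.
  rewrite -dvdn_divisors // in d1m; rewrite -dvdn_divisors // in e1m.
  have eq_ij : i1 = j1.
    have /(congr1 (logn p)) := eq_ie.
    have d1gt0 := dvdn_gt0 m_gt0 d1m; have e1gt0 := dvdn_gt0 m_gt0 e1m.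
    rewrite !lognM ?expn_gt0 ?p_gt0 // !pfactorK //.
    have l0 x : (x %| m)%N -> logn p x = 0%N.
      by move=> /(cop 1%N); rewrite expn1 => /logn_coprime.
    by rewrite !l0 // !addn0.
  move: eq_ie; rewrite eq_ij => /eqP; rewrite eqn_pmul2l ?expn_gt0 ?p_gt0 //.
  by move=> /eqP->.
move=> d; rewrite -dvdn_divisors //; apply/idP/allpairsPdep => [dpm|].
  have d_gt0 := dvdn_gt0 pm_gt0 dpm.
  exists (logn p d), (d`_p^')%N; split => /=.
  - rewrite mem_index_iota /= ltnS.
    have := dvdn_leq_log p pm_gt0 dpm.
    rewrite lognM ?expn_gt0 ?p_gt0 // pfactorK //.
    by rewrite (@logn_coprime p m) ?addn0 // prime_coprime.
  - rewrite -dvdn_divisors // -(@Gauss_dvdr _ (p ^ k)%N).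
      by apply: dvdn_trans dpm; exact: dvdn_part.
    apply: coprimeXr; rewrite coprime_sym prime_coprime //.
    apply/negP => pd; have := part_pnat p^' d.
    by move/pnatP => /(_ (part_gt0 _ _) p p_pr pd); rewrite inE /= inE eqxx.
  - by rewrite -p_part partnC.
move=> [i [e [ik em ->]]].
move: ik em; rewrite mem_index_iota /= ltnS -dvdn_divisors // => ik em.
by apply: dvdn_mul => //; exact: dvdn_exp2l.
Qed.

(* Both sides run over the pairs (d, e) with d * e <= X. *)
Lemma big_divisors_exchange (V : nmodType) (X : nat) (F : nat -> nat -> V) :
  \sum_(1 <= n < X.+1) \sum_(d <- divisors n) F d (n %/ d)%N =
  \sum_(1 <= d < X.+1) \sum_(1 <= e < (X %/ d).+1) F d e.
Proof.
elim: X => [|X IH]; first by rewrite !big_nil.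
have divE n : (0 < n)%N -> \sum_(d <- divisors n) F d (n %/ d)%N =
    \sum_(1 <= d < n.+1) (if (d %| n)%N then F d (n %/ d)%N else 0).
  move=> n_gt0; rewrite -big_mkcond /= -[RHS]big_filter; apply: perm_big.
  apply: uniq_perm; first exact: divisors_uniq.
    by rewrite filter_uniq // iota_uniq.
  move=> d; rewrite mem_filter mem_index_iota -dvdn_divisors //.
  case dn: (d %| n)%N => //=.
  by rewrite (dvdn_gt0 n_gt0 dn) ltnS dvdn_leq.
rewrite big_nat_recr //= IH divE //.
have -> : \sum_(1 <= d < X.+1) \sum_(1 <= e < (X %/ d).+1) F d e =
    \sum_(1 <= d < X.+2) \sum_(1 <= e < (X %/ d).+1) F d e.
  by rewrite [RHS]big_nat_recr //= divn_small // big_nil addr0.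
rewrite -big_split /=; apply: eq_big_nat => d /andP[d_gt0 _].
rewrite divnS //; case: (d %| X.+1)%N; last by rewrite addr0.
by rewrite add1n [RHS]big_nat_recr.
Qed.

(** * Inequalities for geometric sums *)

Lemma bernoulli (R : realFieldType) (t : R) n : 0 <= t <= 1 ->
  1 - n%:R * (1 - t) <= t ^+ n.
Proof.
move=> /andP[t0 t1]; elim: n => [|n IH]; first by rewrite expr0 mul0r subr0.
rewrite exprS -natr1.
have : t * (1 - n%:R * (1 - t)) <= t * t ^+ n by exact: ler_wpM2l.
suff : 0 <= n%:R * (1 - t) * (1 - t) by lra.
by rewrite !mulr_ge0 ?ler0n // subr_ge0.
Qed.

Lemma geom_sum_bound (R : realFieldType) (t : R) n : 0 <= t <= 1 ->
  2 * n%:R - n%:R * (n%:R - 1) * (1 - t) <= 2 * \sum_(0 <= i < n) t ^+ i.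
Proof.
move=> t01; elim: n => [|n IH]; first by rewrite big_nil; lra.
rewrite big_nat_recr //= -natr1; have := bernoulli n t01; lra.
Qed.

(** This is what makes the weights in [lambert_bound] decrease. By induction: the right side grows
    by t^n (1 + t) s, with s the sum of n + 1 terms, and [geom_sum_bound] bounds s from below. *)
Lemma geom_sum_mul_bound (R : realFieldType) (t : R) n : 0 <= t <= 1 ->
  n%:R * n.+1%:R * t ^+ n <=
  (\sum_(0 <= i < n) t ^+ i) * (\sum_(0 <= i < n.+1) t ^+ i).
Proof.
move=> t01; have /andP[t0 t1] := t01.
elim: n => [|n IH]; first by rewrite big_nil !mul0r.
set a := \sum_(0 <= i < n) t ^+ i in IH.
have aE : \sum_(0 <= i < n.+1) t ^+ i = a + t ^+ n by rewrite big_nat_recr.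
have bE : \sum_(0 <= i < n.+2) t ^+ i = a + t ^+ n + t ^+ n.+1.
  by rewrite big_nat_recr //= aE.
have := geom_sum_bound n.+1 t01.
rewrite bE; move: IH; rewrite aE; set s := a + t ^+ n => IH hs.
rewrite -[n.+2%:R]natr1; rewrite -natr1 in IH hs *.
have n0 : 0 <= n%:R :> R by rewrite ler0n.
have tn0 : 0 <= t ^+ n by exact: exprn_ge0.
rewrite exprS.
have -> : s * (s + t * t ^+ n) = a * s + t ^+ n * ((1 + t) * s).
  by rewrite /s; ring.
suff : 0 <= t ^+ n * ((n%:R + 1) * n%:R + (1 + t) * s - (n%:R + 1) * (n%:R + 2) * t).
  by nra.
apply: mulr_ge0 => //.
have h2 : (1 + t) * (2 * (n%:R + 1) - (n%:R + 1) * (n%:R + 1 - 1) * (1 - t))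
    <= (1 + t) * (2 * s) by apply: ler_wpM2l => //; lra.
have h3 : 0 <= (n%:R + 1) * (1 - t) by apply: mulr_ge0; lra.
have h4 : 0 <= n%:R * ((n%:R + 1) * (1 - t)) * (1 - t).
  by rewrite !mulr_ge0 // ?subr_ge0 //; lra.
nra.
Qed.

(** Values at n not coprime to M may be nonzero, so characters of different conductors can share one
    modulus M. *)
Definition real_char (R : realFieldType) (M : nat) (chi : nat -> R) :=
  [/\ (0 < M)%N, forall m n, chi (m * n)%N = chi m * chi n,
      forall n, chi (n + M)%N = chi n, chi 1%N = 1
    & forall n, [|| chi n == 0, chi n == 1 | chi n == -1]].

(** * Partial sums of L(1, chi) *)

Section Character.
Variables (R : realFieldType) (M : nat) (chi : nat -> R).
Hypothesis chiP : real_char M chi.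

Let M_gt0 : (0 < M)%N. Proof. by case: chiP. Qed.
Let chiM m n : chi (m * n)%N = chi m * chi n. Proof. by case: chiP. Qed.
Let chiD n : chi (n + M)%N = chi n. Proof. by case: chiP. Qed.
Let chi1 : chi 1%N = 1. Proof. by case: chiP. Qed.
Let chiV n : [|| chi n == 0, chi n == 1 | chi n == -1]. Proof. by case: chiP. Qed.

Lemma real_char_norm n : `|chi n| <= 1.
Proof. by case/or3P: (chiV n) => /eqP ->; rewrite ?normr0 ?normrN ?normr1. Qed.

Lemma real_charX n k : chi (n ^ k)%N = chi n ^+ k.
Proof. by elim: k => [|k IH]; rewrite ?expn0 // expnS exprS chiM IH. Qed.

Lemma real_char_mod n : chi (n %% M)%N = chi n.
Proof.
rewrite {2}(divn_eq n M); elim: (n %/ M)%N => [|k IH]; first by rewrite mul0n.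
by rewrite mulSn -addnA addnC chiD.
Qed.

Definition divisor_sum (n : nat) : R := \sum_(d <- divisors n) chi d.

(** Split off p^k: the factor 1 + chi p + ... + (chi p)^k is 1, or k + 1, or 1 or 0 according to the
    parity of k. In a square all exponents are even, so every factor is at least 1. *)
Lemma divisor_sum_ge n : (0 < n)%N ->
  (0 <= divisor_sum n) /\ (forall a, n = (a ^ 2)%N -> 1 <= divisor_sum n).
Proof.
elim/ltn_ind: n => n IH n_gt0.
have [n_le1|n_gt1] := leqP n 1.
  have -> : n = 1%N by lia.
  by rewrite /divisor_sum big_seq1 chi1.
set p := pdiv n; have p_pr : prime p by exact: pdiv_prime.
have [k [m [pNm nE]]] : exists k m, ~~ (p %| m)%N /\ n = (p ^ k * m)%N.
  have [m pm nE] := pfactor_coprime p_pr n_gt0.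
  exists (logn p n), m; rewrite mulnC -nE; split => //.
  by rewrite -prime_coprime.
have p_gt1 := prime_gt1 p_pr.
have m_gt0 : (0 < m)%N by move: n_gt0; rewrite nE muln_gt0 => /andP[].
have k_gt0 : (0 < k)%N.
  have : (p %| n)%N by exact: pdiv_dvd.
  by rewrite nE; case: k {nE} => //; rewrite mul1n (negbTE pNm).
have m_lt : (m < n)%N.
  by rewrite nE -{1}[m]mul1n ltn_pmul2r // -(expn0 p) ltn_exp2l.
have sumE : divisor_sum n = (\sum_(0 <= i < k.+1) chi p ^+ i) * divisor_sum m.
  rewrite /divisor_sum nE big_divisors_pfactor // mulr_suml.
  apply: eq_bigr => i _; rewrite mulr_sumr; apply: eq_bigr => d _.
  by rewrite chiM real_charX.
have [IH0 IH1] := IH m m_lt m_gt0.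
have geom : (0 <= \sum_(0 <= i < k.+1) chi p ^+ i) /\
    (~~ odd k -> 1 <= \sum_(0 <= i < k.+1) chi p ^+ i).
  case/or3P: (chiV p) => /eqP ->.
  - rewrite big_nat_recl // big1 ?addr0 ?expr0 //.
    by move=> i _; rewrite expr0n.
  - rewrite (eq_bigr (fun=> 1)); last by move=> i _; rewrite expr1n.
    by rewrite big_const_nat subn0 iter_addr addr0 ler0n ler1n.
  have -> : \sum_(0 <= i < k.+1) (-1 : R) ^+ i = (~~ odd k)%:R.
    elim: k {nE k_gt0 sumE} => [|k IHk]; first by rewrite big_nat1.
    rewrite big_nat_recr //= IHk -signr_odd /=.
    by case: (odd k) => /=; rewrite ?expr0 ?expr1 ?addr0 ?add0r ?subrr.
  by rewrite ler0n; split => // ->.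
rewrite sumE; split=> [|a na]; first by apply: mulr_ge0 => //; case: geom.
have a_gt0 : (0 < a)%N by case: a na nE n_gt0 => // ->.
have kE : k = (logn p a).*2.
  have /(congr1 (logn p)) := nE.
  rewrite lognM ?expn_gt0 ?(ltnW p_gt1) // pfactorK // na lognX -muln2 mulnC.
  by rewrite (@logn_coprime p m) ?addn0 // prime_coprime.
have mE : m = ((a %/ p ^ logn p a) ^ 2)%N.
  have p0 : (0 < p ^ k)%N by rewrite expn_gt0 (ltnW p_gt1).
  apply/eqP; rewrite -(eqn_pmul2l p0) -nE na kE -muln2 expnM -expnMn.
  by rewrite [(_ * (_ %/ _))%N]mulnC divnK // pfactor_dvdnn.
have g1 : 1 <= \sum_(0 <= i < k.+1) chi p ^+ i.
  by case: geom => _; apply; rewrite kE odd_double.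
by rewrite -[1]mulr1; apply: ler_pM => //; exact: IH1 mE.
Qed.

Hypothesis chi_nontrivial : exists2 a, coprime a M & chi a = -1.

Lemma real_char_period_sum m : \sum_(m <= n < m + M) chi n = 0.
Proof.
have shift : \sum_(m <= n < m + M) chi n = \sum_(0 <= n < M) chi n.
  elim: m => [|m IH] //; rewrite -IH.
  have [/eqP M1|M1] := boolP (M == 1)%N.
    by rewrite M1 !addn1 !big_nat1; have := chiD m; rewrite M1 addn1.
  rewrite addSn big_nat_recr /=; last by lia.
  rewrite chiD [RHS]big_ltn; last by lia.
  by rewrite addrC.
rewrite shift; have [a aM chia] := chi_nontrivial.
suff : \sum_(0 <= n < M) chi n = - \sum_(0 <= n < M) chi n by lra.
rewrite !big_mkord.
(* Multiplication by a permutes the residues modulo M and changes the sign of chi. *)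
pose h (i : 'I_M) : 'I_M := Ordinal (ltn_pmod (a * i) M_gt0).
have h_inj : injective h.
  move=> i j /(congr1 val) /= /eqP; apply: contraTeq => ij.
  wlog lt_ij : i j ij / (j < i)%N.
    move=> W; have [ji|ij1|/val_inj ji] := ltngtP j i; first exact: W.
      by rewrite eq_sym; apply: W; rewrite 1?eq_sym.
    by rewrite ji eqxx in ij.
  rewrite eqn_mod_dvd ?leq_mul2l ?(ltnW lt_ij) ?orbT // -mulnBr.
  rewrite Gauss_dvdr 1?coprime_sym //; apply/negP => /dvdn_leq.
  by rewrite subn_gt0 lt_ij => /(_ isT); have := ltn_ord i; lia.
rewrite [LHS](reindex_inj h_inj) /= -sumrN; apply: eq_bigr => i _.
by rewrite real_char_mod chiM chia mulN1r.
Qed.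

Lemma real_char_interval_sum m k : `|\sum_(m <= n < k) chi n| <= M%:R.
Proof.
have [n] := ubnP (k - m)%N; elim: n m => // n IH m lt_n.
have [km|mk] := leqP (m + M) k.
  rewrite (big_cat_nat (n := m + M)) ?leq_addr //=.
  by rewrite real_char_period_sum add0r IH //; lia.
apply: (le_trans (ler_norm_sum _ _ _)).
apply: (@le_trans _ _ (\sum_(m <= n < k) (1 : R))).
  by apply: ler_sum => i _; exact: real_char_norm.
by rewrite big_const_nat iter_addr addr0 ler_nat; lia.
Qed.

(** Summation by parts: the interval sums of chi are at most M in absolute value, and the decrements
    of f together with its last value telescope to f m. *)
Lemma abel_bound (f : nat -> R) m k :
  (forall n, (m <= n)%N -> f n.+1 <= f n) -> (forall n, (m <= n)%N -> 0 <= f n) ->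
  `|\sum_(m <= n < k) chi n * f n| <= M%:R * f m.
Proof.
move=> f_decr f_ge0; have [km|mk] := leqP k m.
  by rewrite big_geq // normr0 mulr_ge0 ?ler0n ?f_ge0.
pose S j := \sum_(m <= n < j) chi n.
have abel : \sum_(m <= n < k) chi n * f n =
    \sum_(m <= n < k) (f n - f n.+1) * S n.+1 + f k * S k.
  have {mk} := ltnW mk => /subnKC <-.
  elim: (k - m)%N => [|j IH]; first by rewrite addn0 /S !big_geq // mulr0 addr0.
  rewrite addnS big_nat_recr ?leq_addr //= IH [in RHS]big_nat_recr ?leq_addr //=.
  have -> : S (m + j).+1 = S (m + j)%N + chi (m + j)%N.
    by rewrite /S big_nat_recr ?leq_addr.
  by ring.
rewrite abel; apply: (le_trans (ler_normD _ _)).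
have -> : M%:R * f m = \sum_(m <= n < k) (f n - f n.+1) * M%:R + f k * M%:R.
  have {abel mk} := ltnW mk => /telescope_sumr tel.
  rewrite -mulr_suml; have := tel _ f.
  under eq_bigr do rewrite -opprB.
  by rewrite sumrN => /eqP; rewrite eqr_oppLR => /eqP ->; ring.
apply: lerD; last first.
  rewrite normrM (ger0_norm (f_ge0 _ (ltnW mk))).
  by apply: ler_wpM2l; [exact/f_ge0/ltnW | exact: real_char_interval_sum].
apply: (le_trans (ler_norm_sum _ _ _)); rewrite !big_nat.
apply: ler_sum => i /andP[mi _]; rewrite normrM ger0_norm; last first.
  by rewrite subr_ge0 f_decr.
by apply: ler_wpM2l; [rewrite subr_ge0 f_decr | exact: real_char_interval_sum].
Qed.

Definition char_harmonic (k : nat) : R := \sum_(1 <= n < k.+1) chi n / n%:R.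

Lemma char_harmonic_cauchy j k : (j <= k)%N ->
  `|char_harmonic k - char_harmonic j| <= M%:R / j.+1%:R.
Proof.
move=> jk; rewrite /char_harmonic (big_cat_nat (n := j.+1)) //=.
rewrite addrAC subrr add0r; apply: (abel_bound (f := fun n => n%:R^-1)) => n jn.
  rewrite lef_pV2 ?posrE ?ltr0n ?ler_nat //; lia.
by rewrite invr_ge0 ler0n.
Qed.

(* Were L(1, chi) zero, the Lambert series \sum chi(n) t^n / (1 - t^n), whose
   coefficients are the divisor sums, would stay bounded as t -> 1: compare it
   termwise with chi(n) / (n (1 - t)); the differences have decreasing weights. *)
Lemma lambert_bound (t : R) k : 0 < t < 1 ->
  `|\sum_(1 <= n < k.+1) chi n * (t ^+ n / (1 - t ^+ n))| <=
  M%:R + `|char_harmonic k| / (1 - t).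
Proof.
move=> /andP[t0 t1].
have tn_lt1 n : (0 < n)%N -> t ^+ n < 1.
  by move=> n0; rewrite expr_lt1 // ltW.
pose s n := \sum_(0 <= i < n) t ^+ i.
have sE n : 1 - t ^+ n = (1 - t) * s n.
  by rewrite /s big_mkord -opprB subrX1 -mulNr opprB.
have s_gt0 n : (0 < n)%N -> 0 < s n.
  by move=> n0; have := tn_lt1 n n0; rewrite -subr_gt0 sE pmulr_rgt0 ?subr_gt0.
pose f n := (n%:R * (1 - t))^-1 - t ^+ n / (1 - t ^+ n).
have f_decr n : (1 <= n)%N -> f n.+1 <= f n.
  move=> n0; have nn0 : 0 < n%:R :> R by rewrite ltr0n.
  have s0 := s_gt0 _ n0; have s10 := s_gt0 n.+1 isT.
  have t01 : 0 <= t <= 1 by rewrite !ltW.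
  have := geom_sum_mul_bound n t01; rewrite -/(s n) -/(s n.+1) => h.
  rewrite /f !sE -subr_ge0.
  have -> : (n%:R * (1 - t))^-1 - t ^+ n / ((1 - t) * s n) -
      ((n.+1%:R * (1 - t))^-1 - t ^+ n.+1 / ((1 - t) * s n.+1)) =
      (s n * s n.+1 - n%:R * n.+1%:R * t ^+ n) /
      ((1 - t) * n%:R * n.+1%:R * s n * s n.+1).
    have e1 : t ^+ n = 1 - (1 - t) * s n by rewrite -sE; ring.
    have e2 : s n.+1 = 1 + t * s n.
      have : (1 - t) * s n.+1 = (1 - t) * (1 + t * s n).
        by rewrite -sE exprS e1; ring.
      by apply: mulfI; rewrite subr_eq0 gt_eqF.
    rewrite exprS e1; move: s10; rewrite e2 -natr1 => s10.
    by field; rewrite ?natr1 ?pnatr_eq0 -?lt0n ?n0 ?(gt_eqF s0) ?(gt_eqF s10) ?subr_eq0 ?(gt_eqF t1).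
  apply: divr_ge0; first by rewrite subr_ge0.
  by rewrite !mulr_ge0 ?ler0n ?(ltW s0) ?(ltW s10) // subr_ge0 ltW.
have f_ge0 n : (1 <= n)%N -> 0 <= f n.
  move=> n0; rewrite /f sE.
  have nn0 : 0 < n%:R :> R by rewrite ltr0n.
  have s0 := s_gt0 _ n0.
  have -> : (n%:R * (1 - t))^-1 - t ^+ n / ((1 - t) * s n) =
      (s n - n%:R * t ^+ n) / ((1 - t) * n%:R * s n).
    by field; rewrite (gt_eqF s0) (gt_eqF nn0) subr_eq0 (gt_eqF t1).
  apply: divr_ge0; last by rewrite !mulr_ge0 ?ler0n ?(ltW s0) // subr_ge0 ltW.
  rewrite subr_ge0 mulr_natl -[X in _ *+ X]subn0 -sumr_const_nat /s !big_mkord.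
  apply: ler_sum => i _.
  by apply: ler_wiXn2l; [exact: ltW | exact: ltW | exact: ltnW].
have -> : \sum_(1 <= n < k.+1) chi n * (t ^+ n / (1 - t ^+ n)) =
    char_harmonic k / (1 - t) - \sum_(1 <= n < k.+1) chi n * f n.
  rewrite /char_harmonic mulr_suml -sumrB; apply: eq_big_nat => n _.
  by rewrite /f invfM; ring.
apply: (le_trans (ler_normB _ _)); rewrite addrC; apply: lerD.
  have := @abel_bound f 1 k.+1 f_decr f_ge0.
  suff -> : f 1%N = 1 by rewrite mulr1.
  by rewrite /f mul1r expr1; field; rewrite subr_eq0 gt_eqF.
rewrite normrM ler_wpM2l // ger0_norm // invr_ge0 subr_ge0 ltW //.
Qed.

(** Expanded in powers of t, the series has the nonnegative coefficients [divisor_sum n], at least 1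
    at squares; the squares of 1, ..., A contribute at least t^(A^2) each. Truncation costs at most
    t^k / (1 - t) per term. *)
Lemma lambert_lower_bound (t : R) A k : 0 < t < 1 -> (A ^ 2 <= k)%N ->
  A%:R * t ^+ (A ^ 2) - k%:R * (t ^+ k / (1 - t)) <=
  \sum_(1 <= n < k.+1) chi n * (t ^+ n / (1 - t ^+ n)).
Proof.
move=> t01 Ak; have /andP[t0 t1] := t01.
have tn_lt1 n : (0 < n)%N -> t ^+ n < 1.
  by move=> n0; rewrite expr_lt1 // ltW.
(* The geometric series of t^n is cut at n e <= k, so that [big_divisors_exchange] applies to
   exactly the remaining pairs (n, e). *)
pose tail n := (t ^+ n) ^+ (k %/ n).+1 / (1 - t ^+ n).
have split_term n : (0 < n)%N -> t ^+ n / (1 - t ^+ n) =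
    \sum_(1 <= e < (k %/ n).+1) t ^+ (n * e) + tail n.
  move=> n0; have d0 : 1 - t ^+ n != 0 by rewrite subr_eq0 gt_eqF ?tn_lt1.
  rewrite /tail; elim: (k %/ n)%N => [|j IH]; first by rewrite big_nil add0r expr1.
  rewrite big_nat_recr //= IH -addrA; congr (_ + _).
  by rewrite exprM [_ ^+ j.+2]exprS; field.
have tail_bound n : (0 < n)%N -> 0 <= tail n <= t ^+ k / (1 - t).
  move=> n0; have d0 : 0 < 1 - t ^+ n by rewrite subr_gt0 tn_lt1.
  apply/andP; split.
    by rewrite /tail divr_ge0 ?(ltW d0) // !exprn_ge0 // ltW.
  rewrite /tail -exprM ler_pM ?invr_ge0 ?exprn_ge0 ?(ltW t0) ?(ltW d0) //.
    apply: ler_wiXn2l; rewrite ?(ltW t0) ?(ltW t1) //.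
    by rewrite ltnW // mulnC ltn_ceil.
  rewrite lef_pV2 ?posrE ?subr_gt0 ?tn_lt1 // lerB //.
  by rewrite -[X in _ <= X]expr1; apply: ler_wiXn2l; rewrite ?(ltW t0) ?(ltW t1).
have -> : \sum_(1 <= n < k.+1) chi n * (t ^+ n / (1 - t ^+ n)) =
    \sum_(1 <= n < k.+1) divisor_sum n * t ^+ n + \sum_(1 <= n < k.+1) chi n * tail n.
  have -> : \sum_(1 <= n < k.+1) divisor_sum n * t ^+ n =
      \sum_(1 <= n < k.+1) \sum_(d <- divisors n) chi d * t ^+ (d * (n %/ d)).
    apply: eq_big_nat => n /andP[n0 _]; rewrite mulr_suml.
    rewrite !big_seq; apply: eq_bigr => d; rewrite -dvdn_divisors // => dn.
    by rewrite mulnC divnK.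
  rewrite (big_divisors_exchange k (fun d e => chi d * t ^+ (d * e))) -big_split.
  apply: eq_big_nat => n /andP[n0 _] /=.
  by rewrite split_term // mulrDr mulr_sumr.
apply: lerD.
  have sq : \sum_(1 <= a < A.+1) t ^+ (a ^ 2) <= \sum_(1 <= n < k.+1) divisor_sum n * t ^+ n.
    elim: A k {split_term tail_bound tail} Ak => [|A IH] k Ak.
      rewrite big_nil !big_nat; apply: sumr_ge0 => n /andP[n0 _].
      by apply: mulr_ge0; [case: (divisor_sum_ge n0) | rewrite exprn_ge0 // ltW].
    have AA : (A ^ 2 < A.+1 ^ 2)%N by rewrite ltn_exp2r.
    rewrite [X in _ <= X](big_cat_nat (n := (A ^ 2).+1%N)) //=; last by rewrite ltnS (leq_trans _ Ak) // ltnW.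
    rewrite big_nat_recr //=; apply: lerD; first exact: IH.
    rewrite [X in _ <= X](big_cat_nat (n := (A.+1 ^ 2)%N)) //=; last exact: leqW.
    rewrite [X in _ <= _ + X]big_ltn //.
    have nn n : (A ^ 2 < n)%N -> 0 <= divisor_sum n * t ^+ n.
      move=> n0; have {}n0 : (0 < n)%N by lia.
      by apply: mulr_ge0; [case: (divisor_sum_ge n0) | rewrite exprn_ge0 // ltW].
    have h1 : 0 <= \sum_((A ^ 2).+1 <= n < A.+1 ^ 2) divisor_sum n * t ^+ n.
      by rewrite big_nat; apply: sumr_ge0 => n /andP[n0 _]; exact: nn.
    have h2 : 0 <= \sum_((A.+1 ^ 2).+1 <= n < k.+1) divisor_sum n * t ^+ n.
      by rewrite big_nat; apply: sumr_ge0 => n /andP[n0 _]; apply: nn; lia.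
    have : t ^+ (A.+1 ^ 2) <= divisor_sum (A.+1 ^ 2) * t ^+ (A.+1 ^ 2).
      rewrite -[X in X <= _]mul1r ler_wpM2r ?exprn_ge0 ?(ltW t0) //.
      have [_] := divisor_sum_ge (n := (A.+1 ^ 2)%N) isT; exact.
    lra.
  apply: le_trans sq.
  rewrite mulr_natl -[X in _ *+ X](@subn1 A.+1) -sumr_const_nat !big_nat.
  apply: ler_sum => a /andP[_ aA]; apply: ler_wiXn2l; rewrite ?(ltW t0) ?(ltW t1) //.
  by rewrite leq_exp2r.
rewrite lerNl -sumrN mulr_natl -[X in _ *+ X](@subn1 k.+1) -sumr_const_nat !big_nat.
apply: ler_sum => n /andP[n0 _]; have /andP[h0 h1] := tail_bound n n0.
apply: le_trans h1; apply: le_trans (ler_norm _) _.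
by rewrite normrN normrM (ger0_norm h0) ler_piMl // real_char_norm.
Qed.

(** A finite form of L(1, chi) <> 0: by [char_harmonic_cauchy] all later partial sums lie within M /
    k.+1 of this one. *)
Lemma char_harmonic_away : exists k : nat, M%:R / k.+1%:R < `|char_harmonic k|.
Proof.
(* With t = 1 - 1/h and h = 2 A^2, t^(A^2) >= 1/2, so the main term of the lower bound is at least A
   / 2 = 2 M, against M in the upper bound. The size of j keeps the errors M h / j and 2 h^3 / j
   below or at 1/8 in total. *)
pose A := (4 * M)%N; pose h := (2 * A ^ 2)%N; pose j := (8 * (h * M + 2 * h ^ 3))%N.
have A_gt0 : (0 < A)%N by rewrite /A; lia.
have h_gt0 : (1 < h)%N by rewrite /h; nia.
have j_gt0 : (0 < j)%N by rewrite /j; nia.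
pose t : R := 1 - h%:R^-1.
have hR : 0 < h%:R :> R by rewrite ltr0n ltnW.
have t0 : 0 < t by rewrite /t subr_gt0 invf_lt1 // ltr1n.
have t1 : t < 1 by rewrite /t gtrBl invr_gt0.
have t01 : 0 < t < 1 by rewrite t0.
exists (2 * j)%N; set k := (2 * j)%N; rewrite ltNge; apply/negP => hk.
have oneBt : 1 - t = h%:R^-1 by rewrite /t; ring.
have tA : 2^-1 <= t ^+ (A ^ 2).
  apply: le_trans (bernoulli _ _); last by rewrite !ltW.
  rewrite oneBt.
  have -> : (A ^ 2)%:R / h%:R = 2^-1 :> R.
    rewrite /h natrM; field; rewrite pnatr_eq0 -lt0n.
    exact: A_gt0.
  lra.
(* Polynomial decay suffices: (1 + j/h) t^j <= 1, hence j t^j <= h, and k = 2 j allows squaring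
   this. *)
have tk : j%:R * j%:R * t ^+ k <= h%:R * h%:R.
  have tj : j%:R * t ^+ j <= h%:R.
    suff : (1 + j%:R / h%:R) * t ^+ j <= 1.
      have : 0 <= t ^+ j by rewrite exprn_ge0 // ltW.
      rewrite mulrDl mul1r => a0 a1.
      have : j%:R / h%:R * t ^+ j <= 1 by lra.
      by rewrite mulrAC ler_pdivrMr // mul1r.
    elim: (j) => [|i IH]; first by rewrite mul0r addr0 expr0 mulr1.
    apply: le_trans IH; rewrite exprS mulrA ler_wpM2r ?exprn_ge0 ?(ltW t0) //.
    rewrite -natr1 /t.
    have : 0 <= h%:R^-1 :> R by rewrite invr_ge0 ltW.
    have : 0 <= i%:R :> R by rewrite ler0n.
    move: (h%:R^-1) (i%:R) => x y y0 x0; nra.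
  rewrite /k mul2n -addnn exprD.
  have -> : j%:R * j%:R * (t ^+ j * t ^+ j) = (j%:R * t ^+ j) * (j%:R * t ^+ j) by ring.
  by apply: ler_pM => //; rewrite mulr_ge0 ?ler0n // exprn_ge0 // ltW.
have Ak : (A ^ 2 <= k)%N by rewrite /k /j /h; nia.
have low := lambert_lower_bound t01 Ak.
have up := lambert_bound k t01.
have {}low := le_trans low (le_trans (ler_norm _) up).
move: low; rewrite !oneBt invrK => low.
have jR : 0 < j%:R :> R by rewrite ltr0n.
have b1 : A%:R * 2^-1 <= A%:R * t ^+ (A ^ 2) by apply: ler_wpM2l => //; rewrite ler0n.
have b2 : k%:R * (t ^+ k * h%:R) <= 2 * h%:R * h%:R * h%:R / j%:R.
  rewrite ler_pdivlMr // /k natrM -/k.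
  have -> : 2 * j%:R * (t ^+ k * h%:R) * j%:R = 2 * h%:R * (j%:R * j%:R * t ^+ k) by ring.
  have -> : 2 * h%:R * h%:R * h%:R = 2 * h%:R * (h%:R * h%:R) :> R by ring.
  by rewrite ler_wpM2l // mulr_ge0 // ltW.
have b3 : `|char_harmonic k| * h%:R <= M%:R * h%:R / j%:R.
  rewrite [X in _ <= X]mulrAC ler_wpM2r ?(ltW hR) //.
  apply: le_trans hk _; rewrite ler_wpM2l ?ler0n // lef_pV2 ?posrE ?ltr0n //.
  by rewrite ler_nat /k leqW // leq_pmull.
have b4 : 2 * h%:R * h%:R * h%:R / j%:R + M%:R * h%:R / j%:R <= 8^-1 :> R.
  rewrite -mulrDl ler_pdivrMr // /j !(natrM, natrD, natrX).
  by lra.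
have AE : A%:R = 4 * M%:R :> R by rewrite /A natrM.
have : 1 <= M%:R :> R by rewrite ler1n.
lra.
Qed.

Lemma char_harmonic_bounded_away :
  exists c : R, exists2 K : nat, 0 < c & forall k, (K <= k)%N -> c <= `|char_harmonic k|.
Proof.
have [K HK] := char_harmonic_away.
exists (`|char_harmonic K| - M%:R / K.+1%:R), K => [|k Kk]; first by rewrite subr_gt0.
have := char_harmonic_cauchy Kk; have := lerB_dist (char_harmonic K) (char_harmonic k).
rewrite distrC => h1 h2; rewrite lerBlDr -lerBlDl; exact: le_trans h1 h2.
Qed.

End Character.

(** * Primes with prescribed values of real characters *)

Section PrimesWithCharacters.
Variable R : realType.

Lemma ln_ratio_le (x : nat) : (0 < x)%N ->
  ln x.+1%:R - ln x%:R <= x%:R^-1 :> R.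
Proof.
move=> x0; have xR : 0 < x%:R :> R by rewrite ltr0n.
have -> : x.+1%:R = x%:R * (1 + x%:R^-1) :> R.
  by rewrite mulrDr mulr1 divff ?gt_eqF // -natr1.
have x1 : 0 < 1 + x%:R^-1 :> R by rewrite addr_gt0 // invr_gt0.
rewrite lnM ?posrE // addrAC subrr add0r; apply: le_ln1Dx.
by rewrite (lt_trans (ltrN10 _)) // invr_gt0.
Qed.

Lemma ln2_ge : 2^-1 <= ln 2 :> R.
Proof.
have : ln (1 + - 2^-1) <= - 2^-1 :> R by apply: le_ln1Dx; lra.
have -> : 1 + - 2^-1 = 2^-1 :> R by field.
by rewrite lnV ?posrE // lerNl opprK.
Qed.

Lemma ln2_le : ln 2 <= 1 :> R.
Proof.
have -> : 2 = 1 + 1 :> R by ring.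
by apply: le_ln1Dx; lra.
Qed.

Lemma ln_nat_ge0 (n : nat) : 0 <= ln n%:R :> R.
Proof. by case: n => [|n]; [rewrite ln0 | rewrite ln_ge0 // ler1n]. Qed.

Lemma ln_nat_homo (m n : nat) : (0 < m)%N -> (m <= n)%N -> ln m%:R <= ln n%:R :> R.
Proof. by move=> m0 mn; rewrite ler_ln ?posrE ?ltr0n ?ler_nat //; lia. Qed.

Lemma ln_nat_le (n : nat) : ln n%:R <= n%:R :> R.
Proof.
case: n => [|n]; first by rewrite ln0.
by apply/ltW/ln_sublinear; rewrite ltr0n.
Qed.

(** * Chebyshev and Mertens estimates *)

Definition mangoldt (n : nat) : R := if primes n is [:: p] then ln p%:R else 0.

Lemma mangoldt_ge0 n : 0 <= mangoldt n.
Proof. by rewrite /mangoldt; case: (primes n) => [|p [|q s]] //; exact: ln_nat_ge0. Qed.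

Lemma mangoldtP n : mangoldt n != 0 ->
  exists p k, [/\ prime p, (0 < k)%N & n = (p ^ k)%N].
Proof.
rewrite /mangoldt; case E: (primes n) => [|p [|q s]]; rewrite ?eqxx // => _.
have : p \in primes n by rewrite E mem_head.
rewrite mem_primes => /and3P[p_pr n0 pn].
exists p, (logn p n); split=> //; first by rewrite logn_gt0 mem_primes p_pr n0.
rewrite -p_part part_pnat_id //; apply/pnatP => // r r_pr rn.
have : r \in primes n by rewrite mem_primes r_pr n0.
by rewrite E !inE.
Qed.

Lemma mangoldt_pfactor p k : prime p -> (0 < k)%N -> mangoldt (p ^ k) = ln p%:R.
Proof. by move=> p_pr k0; rewrite /mangoldt primesX // primes_prime. Qed.

Lemma mangoldt_le n : mangoldt n <= ln n%:R.
Proof.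
have [->|/mangoldtP[p [k [p_pr k0 ->]]]] := eqVneq (mangoldt n) 0.
  exact: ln_nat_ge0.
rewrite mangoldt_pfactor // ln_nat_homo ?prime_gt0 //.
by rewrite -{1}[p]expn1 leq_exp2l // prime_gt1.
Qed.

Lemma mangoldt_sqr m : mangoldt (m ^ 2) = mangoldt m.
Proof. by rewrite /mangoldt primesX. Qed.

Lemma mangoldt_sum n : (0 < n)%N -> \sum_(d <- divisors n) mangoldt d = ln n%:R.
Proof.
elim/ltn_ind: n => n IH n_gt0.
have [n_le1|n_gt1] := leqP n 1.
  have -> : n = 1%N by lia.
  by rewrite big_seq1 ln1.
set p := pdiv n; have p_pr : prime p by exact: pdiv_prime.
have [m pm nE] := pfactor_coprime p_pr n_gt0.
have k_gt0 : (0 < logn p n)%N by rewrite logn_gt0 mem_primes p_pr n_gt0 pdiv_dvd.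
move: (logn p n) k_gt0 nE => k k_gt0; rewrite mulnC => nE.
have pNm : ~~ (p %| m)%N by rewrite -prime_coprime.
have m_gt0 : (0 < m)%N by move: n_gt0; rewrite nE muln_gt0 => /andP[].
have pR : 0 < p%:R :> R by rewrite ltr0n prime_gt0.
have m_lt : (m < n)%N.
  by rewrite nE -{1}[m]mul1n ltn_pmul2r // -(expn0 p) ltn_exp2l // prime_gt1.
(* The divisors prime to p give ln m by induction; for each exponent i.+1 of p only the cofactor 1
   leaves a prime power, which contributes ln p. *)
rewrite nE big_divisors_pfactor // big_nat_recl //.
rewrite (eq_bigr mangoldt); last by move=> d _; rewrite expn0 mul1n.
have -> : ln (p ^ k * m)%:R = ln m%:R + ln p%:R *+ k :> R.
  by rewrite natrM lnM ?posrE ?ltr0n ?expn_gt0 ?(prime_gt0 p_pr) // natrX lnXn // addrC.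
rewrite IH //.
congr (_ + _); rewrite -[X in _ *+ X]subn0 -sumr_const_nat.
apply: eq_bigr => i _; rewrite (bigD1_seq 1%N) ?divisors_uniq //=; last first.
  by rewrite -dvdn_divisors.
rewrite muln1 mangoldt_pfactor // big_seq_cond big1 ?addr0 // => d.
rewrite -dvdn_divisors // => /andP[dm d1].
have d_gt0 := dvdn_gt0 m_gt0 dm.
apply/eqP; apply: contraT => /mangoldtP[q [j [q_pr _ qE]]].
have only r : prime r -> (r %| p ^ i.+1 * d)%N -> r = q.
  by move=> r_pr; rewrite qE Euclid_dvdX // => /andP[rq _]; apply/eqP; rewrite -dvdn_prime2.
have pq : p = q by apply: only => //; rewrite dvdn_mulr // dvdn_exp.
have d_gt1 : (1 < d)%N by move: d1 d_gt0; case: (d) => [|[|]].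
have : pdiv d = q by apply: only; rewrite ?pdiv_prime // dvdn_mull // pdiv_dvd.
by rewrite -pq => pE; move: pNm; rewrite -pE (dvdn_trans _ dm) // pdiv_dvd.
Qed.

Lemma sum_ln_mangoldt X : \sum_(1 <= n < X.+1) ln n%:R =
  \sum_(1 <= d < X.+1) mangoldt d * (X %/ d)%:R :> R.
Proof.
rewrite -(eq_big_nat _ _ (F1 := fun n => \sum_(d <- divisors n) mangoldt d)); last first.
  by move=> n /andP[n0 _]; rewrite mangoldt_sum.
rewrite (big_divisors_exchange X (fun d _ => mangoldt d)).
by apply: eq_bigr => d _; rewrite sumr_const_nat subn1 /= mulr_natr.
Qed.

Definition chebyshev_psi (n : nat) : R := \sum_(1 <= d < n.+1) mangoldt d.

(** The left side is the logarithm of n! / (n./2)!^2. Passing from 2 m to 2 m + 2 adds at most 2 ln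
    2 <= 2; an odd n has the further term ln n <= n - 1. *)
Lemma sum_ln_half n :
  \sum_(1 <= i < n.+1) ln i%:R - 2 * \sum_(1 <= i < n./2.+1) ln i%:R <= 2 * n%:R :> R.
Proof.
pose T k : R := \sum_(1 <= i < k.+1) ln i%:R.
have TS k : T k.+1 = T k + ln k.+1%:R by rewrite /T big_nat_recr.
have even m : T m.*2 - 2 * T m <= 2 * m%:R.
  elim: m => [|m IH]; first by rewrite /T !big_nil; lra.
  rewrite doubleS !TS.
  have h1 : ln m.*2.+1%:R <= ln m.*2.+2%:R :> R by exact: ln_nat_homo.
  have h2 : ln m.*2.+2%:R = ln 2 + ln m.+1%:R :> R.
    by rewrite -doubleS -mul2n natrM lnM ?posrE ?ltr0n.
  have := ln2_le; rewrite -natr1; lra.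
rewrite -/(T n) -/(T n./2).
rewrite -{1 3}[n]odd_double_half; case: (odd n); last first.
  rewrite add0n; have := even n./2; rewrite -muln2 natrM.
  have : 0 <= n./2%:R :> R by rewrite ler0n.
  lra.
rewrite add1n TS; have := even n./2.
have : ln n./2.*2.+1%:R <= (n./2.*2)%:R :> R.
  rewrite -natr1 addrC; apply: le_ln1Dx.
  by rewrite (lt_le_trans (ltrN10 _)) // ler0n.
rewrite -natr1 -muln2 natrM.
have : 0 <= n./2%:R :> R by rewrite ler0n.
lra.
Qed.

(** By [sum_ln_mangoldt] the quantity in [sum_ln_half] is the sum of Lambda(d) (n %/ d - 2 (n./2 %/
    d)), whose coefficients are nonnegative, and at least 1 for n./2 < d <= n. This bounds psi(n) -
    psi(n./2). *)
Lemma chebyshev_psi_le n : chebyshev_psi n <= 4 * n%:R.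
Proof.
elim/ltn_ind: n => n IH.
have [->|n0] := posnP n; first by rewrite /chebyshev_psi big_nil mulr0.
have half_lt : (n./2 < n)%N by rewrite ltn_half_double -addnn; lia.
suff main : chebyshev_psi n - chebyshev_psi n./2 <= 2 * n%:R.
  have := IH _ half_lt.
  have : 2 * n./2%:R <= n%:R :> R by rewrite -natrM ler_nat mul2n -{2}[n]odd_double_half leq_addl.
  lra.
apply: le_trans (sum_ln_half n); rewrite (sum_ln_mangoldt n) (sum_ln_mangoldt n./2).
have -> : \sum_(1 <= d < n./2.+1) mangoldt d * (n./2 %/ d)%:R =
    \sum_(1 <= d < n.+1) mangoldt d * (n./2 %/ d)%:R.
  rewrite [RHS](big_cat_nat (n := n./2.+1)) //=; last exact: ltnW.
  rewrite [X in _ + X]big_nat [X in _ + X]big1 ?addr0 // => d /andP[hd _].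
  by rewrite divn_small // mulr0.
have -> : chebyshev_psi n - chebyshev_psi n./2 = \sum_(n./2.+1 <= d < n.+1) mangoldt d.
  rewrite /chebyshev_psi (@big_cat_nat _ _ _ n./2.+1 1 n.+1) //=; last exact: ltnW.
  by rewrite addrAC subrr add0r.
rewrite mulr_sumr -sumrB [X in _ <= X](big_cat_nat (n := n./2.+1)) //=; last exact: ltnW.
rewrite -[X in X <= _]add0r; apply: lerD.
  rewrite big_nat; apply: sumr_ge0 => d /andP[d0 _].
  have -> : mangoldt d * (n %/ d)%:R - 2 * (mangoldt d * (n./2 %/ d)%:R) =
    mangoldt d * ((n %/ d)%:R - (2 * (n./2 %/ d))%:R) by rewrite natrM; ring.
  rewrite mulr_ge0 ?mangoldt_ge0 // subr_ge0 ler_nat leq_divRL // -mulnA.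
  by rewrite mul2n -{2}[n]odd_double_half (leq_trans _ (leq_addl _ _)) // leq_double leq_trunc_div.
rewrite !big_nat; apply: ler_sum => d /andP[hd dn].
rewrite [(n./2 %/ d)%N]divn_small // mulr0 mulr0 subr0.
rewrite -[X in X <= _]mulr1 ler_wpM2l ?mangoldt_ge0 // ler1n divn_gt0 //; lia.
Qed.

(** Stirling's bound ln X! >= X ln X - X, combined with X %/ d <= X / d in [sum_ln_mangoldt]. *)
Lemma mertens_lower X : (0 < X)%N ->
  ln X%:R - 1 <= \sum_(1 <= d < X.+1) mangoldt d / d%:R :> R.
Proof.
move=> X0; have XR : 0 < X%:R :> R by rewrite ltr0n.
have T_ge : X%:R * ln X%:R - X%:R <= \sum_(1 <= n < X.+1) ln n%:R :> R.
  elim: X X0 XR => // [[|X]] IH _ _; first by rewrite big_nat1 ln1; lra.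
  rewrite big_nat_recr //=; apply: le_trans (lerD (IH _ _) (lexx _)) => //.
  have := @ln_ratio_le X.+1 isT; rewrite -[X.+2%:R]natr1.
  have x0 : 0 < X.+1%:R :> R by rewrite ltr0n.
  rewrite -(ler_pM2l x0) divff ?gt_eqF // => h; lra.
rewrite -(ler_pM2l XR) mulrBr mulr1; apply: (le_trans T_ge).
rewrite sum_ln_mangoldt mulr_sumr !big_nat; apply: ler_sum => d /andP[d0 _].
rewrite mulrCA ler_wpM2l ?mangoldt_ge0 // ler_pdivlMr ?ltr0n // -natrM ler_nat.
exact: leq_trunc_div.
Qed.

Lemma mertens_unbounded (B : R) :
  exists X, B <= \sum_(1 <= d < X.+1) mangoldt d / d%:R.
Proof.
have [k hk] : exists k : nat, 2 * (B + 1) <= k%:R.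
  exists (Num.bound `|2 * (B + 1)|); apply: le_trans (ler_norm _) _.
  by apply/ltW/archi_boundP.
exists (2 ^ k)%N; apply: le_trans (mertens_lower _); last by rewrite expn_gt0.
rewrite natrX lnXn // -[ln 2 *+ k]mulr_natr.
have : 2^-1 * k%:R <= ln 2 * k%:R :> R by rewrite ler_wpM2r ?ler0n // ln2_ge.
lra.
Qed.

Lemma ler_sum_cover (I : eqType) (s : seq I) (h : I -> nat) (P : pred nat)
    (f : nat -> R) (X : nat) :
  (forall n, 0 <= f n) ->
  (forall n, (0 < n)%N -> (n <= X)%N -> P n -> exists2 i, i \in s & n = h i) ->
  \sum_(1 <= n < X.+1 | P n) f n <= \sum_(i <- s) f (h i).
Proof.
move=> f_ge0 cover.
apply: (@le_trans _ _ (\sum_(1 <= n < X.+1) \sum_(i <- s) (if n == h i then f n else 0))).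
  rewrite big_mkcond /= !big_nat; apply: ler_sum => n /andP[n0 nX].
  have sum_ge0 (t : seq I) : 0 <= \sum_(i <- t) (if n == h i then f n else 0).
    by apply: sumr_ge0 => i _; case: ifP.
  case: ifP => // /(cover _ n0 nX)[i is_ nE].
  by rewrite (big_rem i) //= -nE eqxx lerDl.
rewrite exchange_big /=; apply: ler_sum => i _.
have [hi|hi] := boolP (h i \in index_iota 1 X.+1); last first.
  rewrite big_seq big1 // => n ns; case: eqP => // nE.
  by rewrite -nE ns in hi.
rewrite (bigD1_seq (h i)) ?iota_uniq //= eqxx big1 ?addr0 // => n.
by move/negbTE ->.
Qed.

(** An even power of a prime says nothing about the sign of a character at the prime; such powers
    contribute no more than the convergent sum of ln m / m^2. *)
Lemma mangoldt_squares_bounded X :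
  \sum_(1 <= n < X.+1 | [exists m : 'I_n.+1, n == (m ^ 2)%N]) mangoldt n / n%:R <= 2.
Proof.
pose f n := mangoldt n / n%:R.
have f_ge0 n : 0 <= f n by rewrite divr_ge0 ?mangoldt_ge0.
apply: (@le_trans _ _ (\sum_(1 <= m < X.+1) f (m ^ 2)%N)).
  apply: ler_sum_cover => // n n0 nX /existsP[m /eqP nm]; exists (val m) => //.
  rewrite mem_index_iota (leq_trans (ltn_ord m)) // andbT.
  by move: n0; rewrite {1}nm expn_gt0 orbF.
(* - (ln x + 1) / x is a primitive of ln x / x^2; the constant 2 leaves room for the discrete
   telescoping, and g 1 = 2 is the final bound. *)
pose g n : R := (ln n%:R + 2) / n%:R.
apply: (@le_trans _ _ (2 - g X.+1 + g X.+1)); last by lra.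
suff tele : \sum_(1 <= m < X.+1) f (m ^ 2)%N <= 2 - g X.+1 + g X.+1 - g X.
  by apply: (le_trans tele); rewrite lerBlDr lerDl divr_ge0 // addr_ge0 // ln_nat_ge0.
rewrite subrK; elim: X => [|X IH]; first by rewrite big_nil /g invr0 mulr0 subr0.
have [->|X0] := posnP X.
  by rewrite big_nat1 /f mangoldt_sqr /mangoldt /= mul0r /g ln1 add0r divr1 subrr.
rewrite big_nat_recr //=; apply: le_trans (lerD IH (lexx _)) _.
suff : f (X.+1 ^ 2)%N <= g X - g X.+1 by lra.
apply: (@le_trans _ _ (ln X.+1%:R / (X.+1 ^ 2)%:R)).
  by rewrite /f ler_wpM2r ?invr_ge0 // mangoldt_sqr mangoldt_le.
have XR : 0 < X%:R :> R by rewrite ltr0n.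
have X1R : 1 <= X%:R :> R by rewrite ler1n.
have := ln_ratio_le X0; have := ln_nat_ge0 X.+1; rewrite /g natrX -natr1.
move: (ln (X%:R + 1)) (ln X%:R) => b a; move: (X%:R) XR X1R => x x0 x1 b0 hab.
have hab2 : b - x^-1 <= a by lra.
apply: (@le_trans _ _ ((b - x^-1 + 2) / x - (b + 2) / (x + 1))); last first.
  by rewrite lerB // ler_wpM2r ?lerD2r // invr_ge0 ltW.
rewrite -subr_ge0.
have -> : (b - x^-1 + 2) / x - (b + 2) / (x + 1) - b / (x + 1) ^+ 2 =
  (b * x + (x - 1) * (x + 1)) / (x ^+ 2 * (x + 1) ^+ 2).
  by field; rewrite (gt_eqF x0) gt_eqF //; lra.
by rewrite divr_ge0 ?mulr_ge0 ?exprn_ge0 ?addr_ge0 ?mulr_ge0 //; lra.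
Qed.

(** Only powers of the primes p dividing M occur, and the geometric series of ln p / p^j, j >= 1, is
    at most ln p. *)
Lemma mangoldt_noncoprime_bounded M X : (0 < M)%N ->
  \sum_(1 <= n < X.+1 | (mangoldt n != 0) && ~~ coprime n M) mangoldt n / n%:R <=
  \sum_(p <- primes M) ln p%:R.
Proof.
move=> M0; pose f n := mangoldt n / n%:R.
apply: (@le_trans _ _ (\sum_(x <- [seq (p, j) | p <- primes M, j <- index_iota 1 X.+1])
    f (x.1 ^ x.2)%N)).
  apply: ler_sum_cover => [n|n n0 nX]; first by rewrite divr_ge0 ?mangoldt_ge0.
  case/andP=> /mangoldtP[p [j [p_pr j0 nE]]] nM; exists (p, j) => //.
  apply/allpairsPdep; exists p, j; split => //.
    rewrite mem_primes p_pr M0 /=; move: nM.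
    by rewrite nE coprime_pexpl // prime_coprime // negbK.
  rewrite mem_index_iota j0 (leq_trans _ (_ : n < X.+1)%N) //.
  by rewrite ltnS nE ltnW // ltn_expl // prime_gt1.
rewrite big_allpairs_dep /= big_seq [X in _ <= X]big_seq; apply: ler_sum => p.
rewrite mem_primes => /andP[p_pr _].
have p2 : 2 <= p%:R :> R by rewrite (ler_nat _ 2 p) prime_gt1.
have p0 : 0 < p%:R :> R by lra.
rewrite (eq_big_nat _ _ (F2 := fun j => ln p%:R * (p%:R ^+ j)^-1)); last first.
  by move=> j /andP[j0 _]; rewrite /f mangoldt_pfactor // natrX.
rewrite -mulr_sumr ler_piMr ?ln_nat_ge0 //.
suff : \sum_(1 <= j < X.+1) (p%:R ^+ j)^-1 <= 1 - (p%:R ^+ X)^-1 :> R.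
  by move=> /le_trans; apply; rewrite gerBl invr_ge0 exprn_ge0 // ltW.
elim: X => [|X IH]; first by rewrite big_nil expr0 invr1 subrr.
rewrite big_nat_recr //=; apply: le_trans (lerD IH (lexx _)) _.
have pX0 : 0 < p%:R ^+ X :> R by rewrite exprn_gt0.
have -> : (p%:R ^+ X)^-1 = p%:R * (p%:R ^+ X.+1)^-1 :> R.
  by rewrite exprS invfM mulrA divff ?mul1r // gt_eqF.
have : 0 < (p%:R ^+ X.+1)^-1 :> R by rewrite invr_gt0 exprn_gt0.
by nra.
Qed.

(** * Boundedness of the sums of chi(n) Lambda(n) / n *)

Section OneCharacter.
Variables (M : nat) (chi : nat -> R).
Hypothesis chiP : real_char M chi.
Hypothesis chi_nontrivial : exists2 a, coprime a M & chi a = -1.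

Lemma char_log_sum_bounded X :
  `|\sum_(1 <= n < X.+1) chi n * (ln n%:R / n%:R)| <= 4 + M%:R.
Proof.
have f_le1 n : 0 <= (ln n%:R / n%:R : R) <= 1.
  apply/andP; split; first by rewrite divr_ge0 ?ln_nat_ge0.
  have [->|n0] := posnP n; first by rewrite invr0 mulr0.
  by rewrite ler_pdivrMr ?ltr0n // mul1r ln_nat_le.
have small k : `|\sum_(1 <= n < k) chi n * (ln n%:R / n%:R)| <= k.-1%:R.
  apply: (le_trans (ler_norm_sum _ _ _)).
  rewrite -subn1 -[(k - 1)%:R]sumr_const_nat; apply: ler_sum => i _.
  have /andP[h0 h1] := f_le1 i.
  by rewrite normrM (ger0_norm h0) mulr_ile1 // (real_char_norm chiP).
have [X3|X4] := leqP X 3.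
  apply: (le_trans (small _)) => /=.
  have : X%:R <= 3 :> R by rewrite (ler_nat _ X 3).
  have : 0 <= M%:R :> R by rewrite ler0n.
  lra.
(* [abel_bound] wants decreasing weights: ln n / n decreases as soon as ln n >= 1, and ln 4 = 2 ln 2
   >= 1 follows from [ln2_ge]. The earlier terms are at most 1 each. *)
rewrite (big_cat_nat (n := 4%N)) //=; last exact: leqW.
apply: le_trans (ler_normD _ _) _; apply: lerD.
  by apply: le_trans (small _) _; rewrite ler_nat.
have := @abel_bound _ _ _ chiP chi_nontrivial (fun n => ln n%:R / n%:R) 4 X.+1.
move=> /(_ _ _)/le_trans; apply.
- move=> n n4; have n0 : (0 < n)%N by lia.
  have nR : 0 < n%:R :> R by rewrite ltr0n.
  have h1 := ln_ratio_le n0.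
  have h2 : 1 <= ln n%:R :> R.
    apply: le_trans (ln_nat_homo _ n4) => //.
    have -> : 4%:R = 2 ^+ 2 :> R by rewrite -natrX.
    by rewrite lnXn // mulr2n; have := ln2_ge; lra.
  rewrite ler_pdivrMr ?ltr0n // mulrAC ler_pdivlMr // -natr1.
  have : n%:R * (ln n.+1%:R - ln n%:R) <= 1 :> R.
    by apply: le_trans (ler_wpM2l (ltW nR) h1) _; rewrite divff // lt0r_neq0.
  rewrite -natr1; lra.
- by move=> n _; case/andP: (f_le1 n).
by rewrite ler_piMr ?ler0n //; case/andP: (f_le1 4).
Qed.

(** As ln is the divisor sum of Lambda, the bounded sum of chi(n) ln n / n is the sum of chi(d)
    Lambda(d) / d times H(X %/ d), with H = [char_harmonic chi]. Replacing H(X %/ d) by H(X) costs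
    at most Lambda(d) M / X for each d, hence 4 M in all by Chebyshev; it remains to divide by
    |H(X)| >= c. *)
Lemma char_mangoldt_bounded :
  exists C, forall X, `|\sum_(1 <= d < X.+1) chi d * mangoldt d / d%:R| <= C.
Proof.
have [c [K c0 hK]] := char_harmonic_bounded_away chiP chi_nontrivial.
have [_ chiM _ _ _] := chiP.
exists ((4 + M%:R + 4 * M%:R) / c + \sum_(1 <= d < K.+1) mangoldt d / d%:R) => X.
have term_norm d : `|chi d * mangoldt d / d%:R| <= mangoldt d / d%:R.
  rewrite !normrM normfV normr_nat (ger0_norm (mangoldt_ge0 d)) -mulrA.
  by rewrite ler_piMl ?(real_char_norm chiP) // divr_ge0 ?mangoldt_ge0.
have term_ge0 d : 0 <= mangoldt d / d%:R by rewrite divr_ge0 ?mangoldt_ge0.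
have Mc0 : 0 <= (4 + M%:R + 4 * M%:R) / c.
  by rewrite divr_ge0 ?(ltW c0) // !addr_ge0 // mulr_ge0.
have [KX|XK] := leqP K X; last first.
  apply: (le_trans (ler_norm_sum _ _ _)); rewrite -[X in X <= _]add0r; apply: lerD => //.
  rewrite [X in _ <= X](big_cat_nat (n := X.+1)) //=; last exact: ltnW.
  apply: (@le_trans _ _ (\sum_(1 <= d < X.+1) mangoldt d / d%:R)).
    by apply: ler_sum => d _.
  by rewrite lerDl sumr_ge0.
have X0R : (0 < X)%N \/ X = 0%N by case: (X); [right|left].
case: X0R => [X0|->]; last by rewrite big_nil normr0 addr_ge0 // sumr_ge0.
have XR : 0 < X%:R :> R by rewrite ltr0n.
rewrite -[X in X <= _]addr0; apply: lerD; last by rewrite sumr_ge0.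
set S := \sum_(1 <= d < X.+1) _; rewrite ler_pdivlMr //.
apply: (@le_trans _ _ (`|S * char_harmonic chi X|)).
  by rewrite normrM ler_wpM2l // hK.
have logE : \sum_(1 <= n < X.+1) chi n * (ln n%:R / n%:R) =
    \sum_(1 <= d < X.+1) chi d * mangoldt d / d%:R * char_harmonic chi (X %/ d).
  transitivity (\sum_(1 <= n < X.+1) \sum_(d <- divisors n)
      (chi d * mangoldt d / d%:R) * (chi (n %/ d)%N / (n %/ d)%:R)).
    apply: eq_big_nat => n /andP[n0 _].
    rewrite -mangoldt_sum // mulr_suml mulr_sumr big_seq [RHS]big_seq.
    apply: eq_bigr => d; rewrite -dvdn_divisors // => dn.
    have d0 := dvdn_gt0 n0 dn.
    rewrite -{1 2}(divnK dn) chiM natrM invfM; ring.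
  rewrite (big_divisors_exchange X
    (fun d e => (chi d * mangoldt d / d%:R) * (chi e / e%:R))).
  by apply: eq_bigr => d _; rewrite /char_harmonic mulr_sumr.
have -> : S * char_harmonic chi X =
    \sum_(1 <= n < X.+1) chi n * (ln n%:R / n%:R) +
    \sum_(1 <= d < X.+1) chi d * mangoldt d / d%:R *
      (char_harmonic chi X - char_harmonic chi (X %/ d)).
  rewrite logE -big_split mulr_suml; apply: eq_bigr => d _ /=; ring.
apply: le_trans (ler_normD _ _) _; apply: lerD; first exact: char_log_sum_bounded.
apply: (le_trans (ler_norm_sum _ _ _)).
apply: (@le_trans _ _ (\sum_(1 <= d < X.+1) mangoldt d * (M%:R / X%:R))).
  rewrite !big_nat; apply: ler_sum => d /andP[d0 dX].
  have dR : 0 < d%:R :> R by rewrite ltr0n.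
  rewrite normrM; apply: le_trans (ler_pM _ _ (term_norm d)
    (char_harmonic_cauchy chiP chi_nontrivial (leq_div X d))) _ => //.
  rewrite -!mulrA ler_wpM2l ?mangoldt_ge0 // mulrCA ler_wpM2l //.
  rewrite -invfM lef_pV2 ?posrE ?mulr_gt0 ?ltr0n // -natrM ler_nat mulnC.
  by rewrite ltnW // ltn_ceil.
rewrite -mulr_suml -/(chebyshev_psi X) mulrA ler_pdivrMr // mulrAC.
by rewrite ler_wpM2r // chebyshev_psi_le.
Qed.

End OneCharacter.

(** * Prescribing several characters at once *)

Section ManyCharacters.
Variables (M : nat) (chi : nat -> nat -> R) (eps : nat -> R).

(** Where all the characters are nonzero, this is 2^k if chi i n = eps i for every i < k, and 0
    otherwise. *)
Let weight k n := \prod_(i < k) (1 + eps i * chi i n).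

(** Expanding the last factor twists psi by chi k, so the induction is over all psi. The common
    point a keeps every twist nontrivial. *)
Lemma char_weight_bounded k (psi : nat -> R) :
  (forall i, (i < k)%N -> real_char M (chi i)) -> real_char M psi ->
  (exists a, [/\ coprime a M, psi a = -1 & forall i, (i < k)%N -> chi i a = 1]) ->
  exists C, forall X,
    `|\sum_(1 <= n < X.+1) psi n * mangoldt n / n%:R * weight k n| <= C.
Proof.
elim: k psi => [|k IH] psi chiP psiP [a [aM psia chia]].
  have [|C hC] := char_mangoldt_bounded psiP; first by exists a.
  exists C => X; under eq_bigr do rewrite /weight big_ord0 mulr1; exact: hC.
have [|C1 h1] := IH psi (fun i ik => chiP i (ltnW ik)) psiP.
  by exists a; split => // i ik; apply: chia; exact: ltnW.
have chikP := chiP k (ltnSn k).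
have [||C2 h2] := IH (fun n => psi n * chi k n) (fun i ik => chiP i (ltnW ik)).
- case: psiP chikP => M0 m1 p1 o1 v1 [_ m2 p2 o2 v2]; split => //.
  + by move=> m n; rewrite m1 m2; ring.
  + by move=> n; rewrite p1 p2.
  + by rewrite o1 o2 mulr1.
  move=> n; case/or3P: (v1 n) => /eqP ->; case/or3P: (v2 n) => /eqP ->;
    by rewrite ?mulr0 ?mul0r ?mulr1 ?mulrN1 ?opprK ?eqxx ?orbT.
- exists a; split => //; first by rewrite psia chia // mulr1.
  by move=> i ik; apply: chia; exact: ltnW.
exists (C1 + `|eps k| * C2) => X.
have -> : \sum_(1 <= n < X.+1) psi n * mangoldt n / n%:R * weight k.+1 n =
  \sum_(1 <= n < X.+1) psi n * mangoldt n / n%:R * weight k n +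
  eps k * \sum_(1 <= n < X.+1) psi n * chi k n * mangoldt n / n%:R * weight k n.
  rewrite mulr_sumr -big_split; apply: eq_bigr => n _ /=.
  by rewrite /weight big_ord_recr /=; ring.
apply: le_trans (ler_normD _ _) _; apply: lerD => //.
by rewrite normrM ler_wpM2l.
Qed.

(** The constant term of the expanded weight gives Mertens' divergent sum. Each new factor adds a
    bounded sum, since the witness for chi k takes the value 1 at all earlier characters. *)
Lemma char_weight_unbounded k :
  (forall i, (i < k)%N -> real_char M (chi i)) ->
  (forall i, (i < k)%N ->
    exists a, [/\ coprime a M, chi i a = -1 & forall j, (j < i)%N -> chi j a = 1]) ->
  forall B : R, exists X, B <= \sum_(1 <= n < X.+1) mangoldt n / n%:R * weight k n.
Proof.
elim: k => [|k IH] chiP chi_indep B.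
  have [X hX] := mertens_unbounded B; exists X.
  by under eq_bigr do rewrite /weight big_ord0 mulr1.
have [C hC] := char_weight_bounded (fun i ik => chiP i (ltnW ik))
  (chiP k (ltnSn k)) (chi_indep k (ltnSn k)).
have [X hX] := IH (fun i ik => chiP i (ltnW ik)) (fun i ik => chi_indep i (ltnW ik))
  (B + `|eps k| * C).
exists X.
have -> : \sum_(1 <= n < X.+1) mangoldt n / n%:R * weight k.+1 n =
  \sum_(1 <= n < X.+1) mangoldt n / n%:R * weight k n +
  eps k * \sum_(1 <= n < X.+1) chi k n * mangoldt n / n%:R * weight k n.
  rewrite mulr_sumr -big_split; apply: eq_bigr => n _ /=.
  by rewrite /weight big_ord_recr /=; ring.
set T := \sum_(1 <= n < X.+1) chi k n * _ / _ * _.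
have : - (`|eps k| * C) <= eps k * T.
  rewrite lerNl; apply: le_trans (ler_norm _) _.
  by rewrite normrN normrM ler_wpM2l //; exact: hC.
lra.
Qed.

(** Squares and powers of primes dividing M contribute boundedly to an unbounded sum. So some p^j
    with j odd, coprime to M, has nonzero weight, and a real character agrees at p^j and p. *)
Theorem prime_with_characters k :
  (forall i, (i < k)%N -> real_char M (chi i)) ->
  (forall i, (i < k)%N -> (eps i == 1) || (eps i == -1)) ->
  (forall i, (i < k)%N ->
    exists a, [/\ coprime a M, chi i a = -1 & forall j, (j < i)%N -> chi j a = 1]) ->
  exists2 p, prime p & forall i, (i < k)%N -> chi i p = eps i.
Proof.
move=> chiP epsP chi_indep.
(* Positivity of M comes from a character; for k = 0 any prime will do. *)
have M0 : (0 < M)%N \/ k = 0%N by case: k chiP {epsP chi_indep} => [|k] chiP; [right | left; case: (chiP 0%N)].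
case: M0 => [M0|->]; last by exists 2.
have [X hX] := char_weight_unbounded chiP chi_indep
  (2 ^+ k * (2 + \sum_(p <- primes M) ln p%:R) + 1).
have w_bound n : 0 <= weight k n <= 2 ^+ k.
  rewrite /weight; apply/andP; split.
    apply: prodr_ge0 => i _; have [_ _ _ _ v] := chiP i (ltn_ord i).
    by case/orP: (epsP i (ltn_ord i)) => /eqP ->; case/or3P: (v n) => /eqP ->; lra.
  have -> : 2 ^+ k = \prod_(i < k) (2 : R) by rewrite prodr_const card_ord.
  apply: ler_prod => i _; have [_ _ _ _ v] := chiP i (ltn_ord i).
  by case/orP: (epsP i (ltn_ord i)) => /eqP ->; case/or3P: (v n) => /eqP ->; lra.
pose square n := [exists m : 'I_n.+1, n == (m ^ 2)%N].
case: (boolP (has (fun n => [&& mangoldt n != 0, weight k n != 0, coprime n M & ~~ square n])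
  (index_iota 1 X.+1))) => [/hasP[n _ /and4P[n1 n2 nM n3]]|/hasPn nogood]; last first.
  suff : \sum_(1 <= n < X.+1) mangoldt n / n%:R * weight k n <=
    2 ^+ k * (2 + \sum_(p <- primes M) ln p%:R) by lra.
  apply: (@le_trans _ _ (2 ^+ k *
      (\sum_(1 <= n < X.+1 | square n) mangoldt n / n%:R +
       \sum_(1 <= n < X.+1 | (mangoldt n != 0) && ~~ coprime n M) mangoldt n / n%:R))).
    rewrite [X in _ * (X + _)]big_mkcond [X in _ * (_ + X)]big_mkcond.
    rewrite -big_split mulr_sumr /=.
    rewrite big_seq [X in _ <= X]big_seq; apply: ler_sum => n /nogood.
    rewrite !negb_and !negbK.
    have [w0 wk] := andP (w_bound n).
    have t0 : 0 <= mangoldt n / n%:R by rewrite divr_ge0 ?mangoldt_ge0.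
    have s0 b : 0 <= (if b then mangoldt n / n%:R else 0) by case: b.
    case/or4P => [/eqP ->|/eqP ->|nM|->].
    - by rewrite !mul0r !if_same addr0 mulr0.
    - by rewrite mulr0 mulr_ge0 ?exprn_ge0 ?addr_ge0.
    - have [->|m0] := eqVneq (mangoldt n) 0.
        by rewrite !mul0r !if_same addr0 mulr0.
      by rewrite nM mulrC ler_pM // lerDr.
    by rewrite mulrC ler_pM // lerDl.
  rewrite ler_wpM2l ?exprn_ge0 // lerD ?mangoldt_squares_bounded //.
  exact: mangoldt_noncoprime_bounded.
have [p [j [p_pr j0 nE]]] := mangoldtP n1.
have j_odd : odd j.
  apply: contraNT n3 => j_even; apply/existsP.
  have lt : (p ^ j./2 < n.+1)%N.
    by rewrite ltnS nE leq_exp2l ?prime_gt1 // -{2}[j]odd_double_half -addnn; lia.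
  exists (Ordinal lt); rewrite /= nE -expnM muln2.
  by rewrite -{1}[j]odd_double_half (negbTE j_even).
exists p => // i ik; have chiiP := chiP i ik; have [_ _ _ one v] := chiiP.
have chij : chi i n = chi i p.
  rewrite nE (real_charX chiiP) -[j]odd_double_half j_odd exprS -mul2n exprM.
  case/or3P: (v p) => /eqP ->; first by rewrite mul0r.
    by rewrite !expr1n mulr1.
  by rewrite sqrrN !expr1n mulr1.
(* By Euler's theorem a power of n is 1 modulo M, so a power of chi i n is 1. *)
have chi_neq0 : chi i n != 0.
  have /(congr1 (chi i)) := Euler_exp_totient nM.
  rewrite !(real_char_mod chiiP) one (real_charX chiiP) => h.
  apply/eqP => c0; move: h; rewrite c0 expr0n eqn0Ngt totient_gt0 M0 /= => /eqP.
  by rewrite eq_sym oner_eq0.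
have : 1 + eps i * chi i n != 0.
  by move: n2; rewrite /weight (bigD1 (Ordinal ik)) //= mulf_eq0 negb_or => /andP[].
move: chi_neq0; rewrite chij.
by case/orP: (epsP i ik) => /eqP ->; case/or3P: (v p) => /eqP ->;
  rewrite ?eqxx ?mul1r ?mulN1r ?subrr ?opprK ?eqxx.
Qed.
End ManyCharacters.
End PrimesWithCharacters.

(** * Quadratic reciprocity *)

Lemma finField_prim_root (F : finFieldType) n :
  (n %| #|F|.-1)%N -> exists z : F, n.-primitive_root z.
Proof.
move=> nF; have F_gt1 := finNzRing_gt1 F.
have F1_gt0 : (0 < #|F|.-1)%N by rewrite -ltnS prednK // ltnW.
have /hasP[z _ zP] : has (#|F|.-1).-primitive_root [seq x <- enum F | x != 0].
  apply: has_prim_root => //.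
  - apply/allP => x; rewrite mem_filter => /andP[x0 _]; rewrite unity_rootE.
    apply/eqP/(mulfI x0); rewrite mulr1 -exprS prednK ?expf_card //.
    exact: ltnW.
  - by rewrite filter_uniq ?enum_uniq.
  have := count_predC (pred1 0) (enum F).
  by rewrite count_uniq_mem ?enum_uniq // mem_enum -cardE add1n size_filter => <-.
by exists (z ^+ (#|F|.-1 %/ n)); apply: dvdn_prim_root.
Qed.

(** With Euler's criterion as definition, multiplicativity is that of powers; [legendre_square]
    recovers actual square roots. *)
Definition legendre (p : nat) (a : int) : int :=
  if a%:~R == 0 :> 'F_p then 0 else if a%:~R ^+ (p.-1)./2 == 1 :> 'F_p then 1 else -1.

Lemma intr_pchar (R : nzRingType) (p : nat) (a : int) :
  p \in [pchar R] -> (a%:~R == 0 :> R) = (p %| `|a|)%N.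
Proof.
move=> pR; rewrite (dvdn_pcharf pR); case: a => n //=.
by rewrite NegzE mulrNz oppr_eq0.
Qed.

Lemma oner_neqN1 (R : nzRingType) (p : nat) :
  prime p -> odd p -> p \in [pchar R] -> (1 : R) != -1.
Proof.
move=> p_pr p_odd pR; rewrite -subr_eq0 opprK -[1 + 1]/(2%:R) -(dvdn_pcharf pR).
by rewrite dvdn_prime2 //; apply: contraTneq p_odd => ->.
Qed.

(** * The Legendre symbol at an odd prime *)

Section OddPrime.
Variable p : nat.
Hypotheses (p_pr : prime p) (p_odd : odd p).

Let h := (p.-1)./2.
Let pE : p = h.*2.+1.
Proof.
have := prime_gt1 p_pr; rewrite /h; case: p p_odd => [|n] //= /negbTE n_even _.
by rewrite -{1}[n]odd_double_half n_even.
Qed.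

Let p1E : p.-1 = h.*2. Proof. by rewrite [in LHS]pE. Qed.

Let h_gt0 : (0 < h)%N. Proof. by have := prime_gt1 p_pr; rewrite pE; case: h. Qed.

Lemma Fp_intr_eq0 (a : int) : (a%:~R == 0 :> 'F_p) = (p %| `|a|)%N.
Proof. exact: intr_pchar (pchar_Fp p_pr). Qed.

Lemma Fp_val_intr (x : 'F_p) : ((x : nat)%:Z)%:~R = x.
Proof. by rewrite -pmulrn natr_Zp. Qed.

Lemma Fp_oner_neqN1 : (1 : 'F_p) != -1.
Proof. exact: oner_neqN1 p_odd (pchar_Fp p_pr). Qed.

Lemma Fp_euler (x : 'F_p) : x != 0 -> (x ^+ h == 1) || (x ^+ h == -1).
Proof.
move=> x0; rewrite -eqf_sqr expr1n -exprM muln2; apply/eqP/(mulfI x0).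
by rewrite mulr1 -exprS -pE; have := expf_card x; rewrite card_Fp.
Qed.

Lemma legendre_expE (a : int) : a%:~R ^+ h = (legendre p a)%:~R :> 'F_p.
Proof.
rewrite /legendre; case: eqVneq => [->|a0].
  by rewrite expr0n eqn0Ngt h_gt0 //=.
by have := Fp_euler a0; rewrite -/h; case: eqP => [->|_ /eqP ->].
Qed.

Lemma legendre_values a : [\/ legendre p a = 0, legendre p a = 1 | legendre p a = -1].
Proof.
by rewrite /legendre; do 2?[case: ifP => _]; [constructor 1|constructor 2|constructor 3].
Qed.

(** Identities between symbols are proved in a field of odd characteristic and lifted back to [int]
    by this. *)
Lemma sign_intr_inj (F : fieldType) (x y : int) : (1 : F) != -1 ->
  [\/ x = 0, x = 1 | x = -1] -> [\/ y = 0, y = 1 | y = -1] ->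
  x%:~R = y%:~R :> F -> x = y.
Proof.
move=> n1; case=> ->; case=> -> //= /eqP;
  rewrite ?mulrN1z ?mulr1z ?mulr0z ?oner_eq0 ?oppr_eq0 ?oner_eq0 //
  1?eq_sym ?oner_eq0 ?oppr_eq0 ?oner_eq0 ?(negbTE n1) //.
by rewrite eq_sym (negbTE n1).
Qed.

Lemma legendre_eq a b :
  a%:~R = b%:~R :> 'F_p -> legendre p a = legendre p b.
Proof. by rewrite /legendre => ->. Qed.

Lemma legendreM a b : legendre p (a * b) = legendre p a * legendre p b.
Proof.
apply: (@sign_intr_inj 'F_p); first exact: Fp_oner_neqN1.
- exact: legendre_values.
- case: (legendre_values a) => ->; case: (legendre_values b) => ->;
  by [constructor 1|constructor 2|constructor 3].
by rewrite intrM -!legendre_expE intrM exprMn.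
Qed.

Lemma legendre1 : legendre p 1 = 1.
Proof. by rewrite /legendre oner_eq0 expr1n eqxx. Qed.

Lemma legendre_eq0 a : (legendre p a == 0) = (p %| `|a|)%N.
Proof. by rewrite -Fp_intr_eq0 /legendre; case: ifP => // _; case: ifP. Qed.

Lemma legendre_sqr a : legendre p (a ^+ 2) = (~~ (p %| `|a|)%N)%:R.
Proof.
rewrite expr2 legendreM -legendre_eq0.
by case: (legendre_values a) => ->.
Qed.

Lemma legendre_prod (I : Type) (s : seq I) (F : I -> int) :
  legendre p (\prod_(i <- s) F i) = \prod_(i <- s) legendre p (F i).
Proof. exact: (big_morph _ legendreM legendre1). Qed.

Lemma legendre_nonresidue : exists2 n : nat, legendre p n%:Z = -1 & coprime n p.
Proof.
have [g gP] : exists g : 'F_p, (p.-1).-primitive_root g.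
  by apply: finField_prim_root; rewrite card_Fp.
have g0 : g != 0.
  apply/eqP => g0; have := prim_expr_order gP.
  by rewrite g0 expr0n pE /= double_eq0 eqn0Ngt h_gt0 => /eqP; rewrite eq_sym oner_eq0.
have gE : ((g : nat)%:Z)%:~R = g by rewrite -pmulrn natr_Zp.
have leg : legendre p (g : nat)%:Z = -1.
  rewrite /legendre gE (negbTE g0) -(prim_order_dvd gP) -/h.
  rewrite gtnNdvd // pE /= -addnn -[X in (X < _)%N]addn0 ltn_add2l //.
exists (g : nat) => //.
by rewrite coprime_sym prime_coprime // -[X in (_ %| X)%N]absz_nat -legendre_eq0 leg.
Qed.

Lemma legendre_square a : legendre p a = 1 -> exists x : nat, (p %| `|x%:Z ^+ 2 - a|)%N.
Proof.
have [g gP] : exists g : 'F_p, (p.-1).-primitive_root g.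
  by apply: finField_prim_root; rewrite card_Fp.
move=> leg1; have a0 : a%:~R != 0 :> 'F_p.
  by rewrite Fp_intr_eq0 -legendre_eq0 leg1.
have ah : a%:~R ^+ h = 1 :> 'F_p by rewrite legendre_expE leg1.
have ap : a%:~R ^+ p.-1 = 1 :> 'F_p by rewrite p1E -muln2 exprM ah expr1n.
have [[i /= _] aE] := prim_rootP gP ap.
(* With a = g^i, a^h = 1 makes p - 1 = 2 h divide i h, so i is even. *)
move: ah; rewrite aE /= -exprM => /eqP; rewrite -(prim_order_dvd gP).
rewrite p1E -mul2n dvdn_pmul2r // dvdn2 => i_even.
have iE : i = i./2.*2 by rewrite -{1}(odd_double_half i) (negbTE i_even).
exists (g ^+ i./2 : 'F_p); rewrite -Fp_intr_eq0 // rmorphB rmorphXn /= aE.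
by rewrite -pmulrn natr_Zp -exprM muln2 -iE subrr.
Qed.

Lemma legendreN1 : legendre p (-1) = (-1) ^+ h.
Proof.
apply: (@sign_intr_inj 'F_p); first exact: Fp_oner_neqN1.
- exact: legendre_values.
- by rewrite -signr_odd; case: (odd h); [constructor 3|constructor 2].
by rewrite -legendre_expE rmorphXn.
Qed.

Lemma legendre_sum : \sum_(x : 'F_p) legendre p (x : nat)%:Z = 0.
Proof.
have [n leg_n n_p] := legendre_nonresidue.
have n0 : n%:R != 0 :> 'F_p.
  by rewrite -(dvdn_pcharf (pchar_Fp p_pr)) -prime_coprime // coprime_sym.
set S := \sum_x _; suff : S = - S by lia.
rewrite /S [LHS](reindex_inj (mulfI n0)) -sumrN; apply: eq_bigr => x _.
rewrite -mulN1r -leg_n -legendreM; apply: legendre_eq.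
by rewrite Fp_val_intr rmorphM /= Fp_val_intr -pmulrn.
Qed.

End OddPrime.

(** * Quadratic reciprocity and the symbol of 2 *)

Section Reciprocity.
Variables p q : nat.
Hypotheses (p_pr : prime p) (p_odd : odd p) (q_pr : prime q) (q_odd : odd q).
Hypothesis p_neq_q : p != q.

Lemma legendre_intr (L : fieldType) (a : int) : q \in [pchar L] ->
  a%:~R ^+ (q.-1)./2 = (legendre q a)%:~R :> L.
Proof.
move=> qL; have /eqP := legendre_expE q_pr q_odd a.
rewrite -rmorphXn /= -subr_eq0 -rmorphB Fp_intr_eq0 // -(intr_pchar _ qL) => /eqP h.
by apply/eqP; rewrite -subr_eq0 -rmorphXn -rmorphB /= h.
Qed.

(* Gauss sums in a finite field of characteristic q containing the p-th roots
   of unity: raising to the q-th power is the Frobenius. *)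
Theorem quadratic_reciprocity :
  legendre q (legendre p (-1) * p%:Z) = legendre p q%:Z.
Proof.
have q0 : (0 < p.-1)%N by have := prime_gt1 p_pr; case: (p) => [|[|]].
(* By Fermat p divides q^(p-1) - 1, so the field with q^(p-1) elements contains the p-th roots of
   unity. *)
have [L qL cardL] := pPrimePowerField q_pr q0.
have cop : coprime q p.
  by rewrite prime_coprime // dvdn_prime2 // eq_sym.
have [z zP] : exists z : L, p.-primitive_root z.
  apply: finField_prim_root; rewrite cardL -subn1 -eqn_mod_dvd ?expn_gt0 ?prime_gt0 //.
  by rewrite -totient_prime // Euler_exp_totient.
have z1 : z != 1.
  by apply/eqP => z1; have := prim_order_dvd zP 1; rewrite z1 expr1 eqxx dvdn1; have := prime_gt1 p_pr; case: (p) => [|[|]].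
pose e (x : 'F_p) : L := z ^+ x.
have eE n : e n%:R = z ^+ n.
  by rewrite /e val_Fp_nat // (prim_expr_mod zP).
have e0 : e 0 = 1 by rewrite /e expr0.
have eD x y : e (x + y) = e x * e y.
  by rewrite -[x in LHS]natr_Zp -[y in LHS]natr_Zp -natrD eE exprD.
pose X (x : 'F_p) : int := legendre p (x : nat)%:Z.
have XE (a : int) : legendre p a = X a%:~R.
  by apply: legendre_eq; rewrite Fp_val_intr.
have XM x y : X (x * y) = X x * X y.
  by rewrite /X -legendreM //; apply: legendre_eq; rewrite Fp_val_intr rmorphM /= !Fp_val_intr.
have X0 : X 0 = 0 by apply/eqP; rewrite legendre_eq0.
have X1 x : x != 0 -> X x * X x = 1.
  move=> x0; rewrite -XM -expr2 /X.
  have -> : legendre p ((x ^+ 2 : 'F_p) : nat)%:Z = legendre p ((x : nat)%:Z ^+ 2).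
    by apply: legendre_eq; rewrite Fp_val_intr rmorphXn /= Fp_val_intr.
  by rewrite legendre_sqr // -Fp_intr_eq0 // Fp_val_intr x0.
have sum_e : \sum_(x : 'F_p) e x = 0.
  apply/eqP; have : (e 1 - 1) * \sum_(x : 'F_p) e x = 0.
    rewrite mulrBl mul1r mulr_sumr [X in _ - X](reindex_inj (addrI (1 : 'F_p))).
    by rewrite -sumrB big1 // => x _; rewrite eD subrr.
  have -> : e 1 = z by have := eE 1%N; rewrite expr1.
  by move/eqP; rewrite mulf_eq0 subr_eq0 (negbTE z1).
have sum_eM d : \sum_(x : 'F_p) e (d * x) = if d == 0 then p%:R else 0.
  case: eqVneq => [->|d0].
    rewrite (eq_bigr (fun=> 1)); last by move=> x _; rewrite mul0r e0.
    by rewrite sumr_const card_Fp.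
  by rewrite -[RHS]sum_e [RHS](reindex_inj (mulfI d0)).
pose G : L := \sum_(x : 'F_p) (X x)%:~R * e x.
have G2 : G ^+ 2 = (legendre p (-1) * p%:Z)%:~R.
  rewrite expr2 {1}/G mulr_suml.
  (* Substituting x y for y turns X x * X (x y) into X y. The terms with x = 0 vanish on the left,
     so the inner sum over x will be that of [sum_eM] minus its term 1 at x = 0. *)
  transitivity (\sum_(x : 'F_p) \sum_(y : 'F_p) (X y)%:~R * (if x == 0 then 0 else e ((1 + y) * x))).
    apply: eq_bigr => x _; rewrite /G mulr_sumr.
    case: (eqVneq x 0) => [->|x0].
      by rewrite X0 !big1 // => y _; rewrite ?mul0r ?mulr0.
    rewrite (reindex_inj (mulfI x0)); apply: eq_bigr => y _ /=.
    have -> : (X x)%:~R * e x * ((X (x * y))%:~R * e (x * y)) =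
      (X x * X (x * y))%:~R * (e x * e (x * y)) :> L by rewrite rmorphM /=; ring.
    by rewrite -eD XM mulrA X1 // mul1r mulrDl mul1r [y * x]mulrC.
  rewrite exchange_big /=.
  transitivity (\sum_(y : 'F_p) ((X y)%:~R * (if y == -1 then p%:R else 0) - (X y)%:~R) : L).
    apply: eq_bigr => y _; rewrite -mulr_sumr -[X in _ - X]mulr1 -mulrBr.
    congr (_ * _); rewrite -[y == -1]subr_eq0 opprK [y + 1]addrC -sum_eM.
    rewrite [in RHS](bigD1 0) //= mulr0 e0 addrAC subrr add0r.
    by rewrite (bigD1 0) //= add0r; apply: eq_bigr => x /negbTE ->.
  rewrite sumrB -[X in _ - X]rmorph_sum /= legendre_sum // subr0.
  rewrite (bigD1 (-1)) //= eqxx big1 ?addr0; last by move=> y /negbTE ->; rewrite mulr0.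
  by rewrite rmorphM /= XE rmorphN1.
(* Frobenius fixes the integers X x and sends e x to e (q x). *)
have Gq : G ^+ q = (legendre p q%:Z)%:~R * G.
  rewrite -(pFrobenius_autE qL) rmorph_sum /= /G mulr_sumr.
  have q0F : q%:R != 0 :> 'F_p.
    by rewrite -(dvdn_pcharf (pchar_Fp p_pr)) dvdn_prime2.
  rewrite [RHS](reindex_inj (mulfI q0F)); apply: eq_bigr => x _ /=.
  rewrite rmorphM /= pFrobenius_aut_int pFrobenius_autE mulrA -rmorphM /= XE.
  rewrite [X (q%:R * x)]XM mulrA -[q%:Z%:~R]/(q%:R) X1 // mul1r; congr (_ * _).
  by rewrite -[x in RHS]natr_Zp -natrM eE mulnC exprM.
have G0 : G != 0.
  have : G ^+ 2 != 0.
    rewrite G2 (intr_pchar _ qL) abszM Euclid_dvdM // negb_or.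
    rewrite -[X in _ && X]prime_coprime // cop andbT.
    have : legendre p (-1) != 0 by rewrite legendre_eq0 //= dvdn1; have := prime_gt1 p_pr; case: (p) => [|[|]].
    have := legendre_values p (-1).
    by case=> -> // _; rewrite dvdn1; have := prime_gt1 q_pr; case: (q) => [|[|]].
  by rewrite expf_eq0.
apply: (@sign_intr_inj L); first exact: oner_neqN1 q_odd qL.
- exact: legendre_values.
- exact: legendre_values.
(* G^q is G times (G^2)^((q-1)/2), and the latter factor is the symbol by Euler's criterion; compare
   with [Gq] and cancel G. *)
rewrite -legendre_intr // -G2 -exprM mul2n.
have -> : (q.-1)./2.*2 = q.-1.
  by rewrite -{2}[q.-1]odd_double_half; have := prime_gt0 q_pr; case: (q) q_odd => //= n /negbTE ->.
by apply: (mulIf G0); rewrite -exprSr prednK ?prime_gt0.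
Qed.

(* With w a primitive 8-th root of unity, w + w^-1 is a square root of 2. *)
Theorem legendre2 :
  legendre q 2 = if (q %% 8 == 1)%N || (q %% 8 == 7)%N then 1 else -1.
Proof.
(* 8 divides q^2 - 1 for odd q, so q^2 elements suffice for the 8-th roots of unity. *)
have [L qL cardL] := @pPrimePowerField q 2 q_pr isT.
have qmod : (q %% 8 \in [:: 1; 3; 5; 7])%N.
  have : odd (q %% 8) by rewrite odd_mod.
  have : (q %% 8 < 8)%N by rewrite ltn_mod.
  by case: (q %% 8)%N => [|[|[|[|[|[|[|[|]]]]]]]].
have [w wP] : exists w : L, 8.-primitive_root w.
  apply: finField_prim_root; rewrite cardL -subn1 -eqn_mod_dvd ?expn_gt0 ?prime_gt0 //.
  rewrite -modnXm; move: qmod; rewrite !inE.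
  by case/or4P => /eqP ->.
have w8 := prim_expr_order wP.
have w4 : w ^+ 4 = -1.
  have : (w ^+ 4) ^+ 2 == 1 by rewrite -exprM w8.
  rewrite sqrf_eq1 => /orP[|/eqP //].
  by rewrite -(prim_order_dvd wP).
pose t := w + w ^+ 7.
have t2 : t ^+ 2 = 2.
  have -> : t ^+ 2 = w ^+ 2 + (w ^+ 8) *+ 2 + w ^+ 8 * w ^+ 4 * w ^+ 2 by rewrite /t; ring.
  by rewrite w8 w4; ring.
have tq : t ^+ q = (if (q %% 8 == 1)%N || (q %% 8 == 7)%N then 1 else -1)%:~R * t.
  have -> : t ^+ q = w ^+ (q %% 8) + w ^+ ((q %% 8) * 7).
    rewrite -(pFrobenius_autE qL) rmorphD rmorphXn /= pFrobenius_autE /=.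
    by rewrite (prim_expr_mod wP) exprM (prim_expr_mod wP).
  have E3 : w ^+ 3 + w ^+ (3 * 7) = w ^+ 4 * w ^+ 7 + w ^+ 8 * w ^+ 8 * w ^+ 4 * w + w ^+ 3 * (1 - w ^+ 8) by ring.
  have E5 : w ^+ 5 + w ^+ (5 * 7) = w ^+ 4 * w + w ^+ 8 * w ^+ 8 * w ^+ 8 * w ^+ 4 * w ^+ 7 by ring.
  move: qmod; rewrite !inE => /or4P[] /eqP -> /=.
  - by rewrite mul1r.
  - by rewrite E3 w8 w4 /t; ring.
  - by rewrite E5 w8 w4 /t; ring.
  have -> : w ^+ 7 + w ^+ (7 * 7) = w ^+ 7 + w ^+ 8 ^+ 6 * w by rewrite /=; ring.
  by rewrite w8 /t; ring.
have t0 : t != 0.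
  have : t ^+ 2 != 0 by rewrite t2 -[2]/((1 + 1)) addr_eq0 (oner_neqN1 q_pr).
  by rewrite expf_eq0.
apply: (@sign_intr_inj L); first exact: oner_neqN1 q_odd qL.
- exact: legendre_values.
- by case: ifP => _; [constructor 2|constructor 3].
rewrite -legendre_intr // -[2%:~R]/(2%:R) -t2 -exprM mul2n.
have -> : (q.-1)./2.*2 = q.-1.
  by rewrite -{2}[q.-1]odd_double_half; have := prime_gt0 q_pr; case: (q) q_odd => //= n /negbTE ->.
by apply: (mulIf t0); rewrite -exprSr prednK ?prime_gt0.
Qed.

End Reciprocity.

(** * Primes with prescribed Legendre symbols *)

Lemma coprime_prodl (s : seq nat) (n : nat) :
  coprime (\prod_(i <- s) i) n = all (fun i => coprime i n) s.
Proof.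
elim: s => [|i s IH]; first by rewrite big_nil coprime1n.
by rewrite big_cons coprimeMl IH.
Qed.

Lemma chinese_seq (m : nat) (ps : seq nat) (f : nat -> nat) (r : nat) :
  uniq ps -> all prime ps -> (forall p, p \in ps -> coprime m p) ->
  exists2 a, a = r %[mod m] & forall p, p \in ps -> a = f p %[mod p].
Proof.
elim: ps => [|p s IH] /=; first by exists r.
move=> /andP[ps s_uniq] /andP[p_pr s_pr] mp.
have [|a am as_] := IH s_uniq s_pr.
  by move=> p' p's; apply: mp; rewrite inE p's orbT.
pose m' := (m * \prod_(i <- s) i)%N.
have cop : coprime m' p.
  rewrite coprimeMl mp ?mem_head //= coprime_prodl.
  apply/allP => i is_; have i_pr := allP s_pr _ is_.
  rewrite prime_coprime // dvdn_prime2 //.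
  by apply: contraNneq ps => <-.
have bm d : (d %| m')%N -> chinese m' p a (f p) = a %[mod d].
  by move=> dm; rewrite -[LHS](modn_dvdm _ dm) chinese_modl // modn_dvdm.
exists (chinese m' p a (f p)); first by rewrite bm ?dvdn_mulr.
move=> p'; rewrite inE => /orP[/eqP ->|p's]; first by rewrite chinese_modr.
by rewrite bm ?as_ // dvdn_mull // (big_rem p') //= dvdn_mulr.
Qed.

(** [chi4] and [chi8] are the symbols (-1/n) and (2/n); together they determine an odd n modulo
    8. *)
Definition chi4 (n : nat) : int :=
  if (n %% 4 == 1)%N then 1 else if (n %% 4 == 3)%N then -1 else 0.

Definition chi8 (n : nat) : int :=
  if (n %% 8 == 1)%N || (n %% 8 == 7)%N then 1 else
  if (n %% 8 == 3)%N || (n %% 8 == 5)%N then -1 else 0.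

Lemma chi4M m n : chi4 (m * n) = chi4 m * chi4 n.
Proof.
rewrite /chi4 -modnMm.
have := ltn_pmod m (isT : (0 < 4)%N); have := ltn_pmod n (isT : (0 < 4)%N).
by case: (n %% 4)%N => [|[|[|[|]]]] //; case: (m %% 4)%N => [|[|[|[|]]]].
Qed.

Lemma chi8M m n : chi8 (m * n) = chi8 m * chi8 n.
Proof.
rewrite /chi8 -modnMm.
have := ltn_pmod m (isT : (0 < 8)%N); have := ltn_pmod n (isT : (0 < 8)%N).
by case: (n %% 8)%N => [|[|[|[|[|[|[|[|]]]]]]]] //; case: (m %% 8)%N => [|[|[|[|[|[|[|[|]]]]]]]].
Qed.

Lemma modn_add_dvd d n M : (d %| M)%N -> ((n + M) %% d = n %% d)%N.
Proof. by move=> /eqP dM; rewrite -modnDmr dM addn0. Qed.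

Section IntCharacter.
Variable R : realFieldType.

Lemma real_char_intr (M : nat) (chi : nat -> int) : (0 < M)%N ->
  (forall m n, chi (m * n)%N = chi m * chi n) -> (forall n, chi (n + M)%N = chi n) ->
  chi 1%N = 1 -> (forall n, [\/ chi n = 0, chi n = 1 | chi n = -1]) ->
  real_char M (fun n => (chi n)%:~R : R).
Proof.
move=> M0 chiM chiD chi1 chiV; split => //.
- by move=> m n; rewrite chiM intrM.
- by move=> n; rewrite chiD.
- by rewrite chi1.
by move=> n; case: (chiV n) => ->; rewrite ?eqxx ?orbT.
Qed.

Lemma chi4_char M : (0 < M)%N -> (4 %| M)%N -> real_char M (fun n => (chi4 n)%:~R : R).
Proof.
move=> M0 M4; apply: real_char_intr => //.
- exact: chi4M.
- by move=> n; rewrite /chi4 modn_add_dvd.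
by move=> n; rewrite /chi4; do 2?[case: ifP => _]; [constructor 2|constructor 3|constructor 1].
Qed.

Lemma chi8_char M : (0 < M)%N -> (8 %| M)%N -> real_char M (fun n => (chi8 n)%:~R : R).
Proof.
move=> M0 M8; apply: real_char_intr => //.
- exact: chi8M.
- by move=> n; rewrite /chi8 modn_add_dvd.
by move=> n; rewrite /chi8; do 2?[case: ifP => _]; [constructor 2|constructor 3|constructor 1].
Qed.

Lemma legendre_char M p : prime p -> odd p -> (0 < M)%N -> (p %| M)%N ->
  real_char M (fun n => (legendre p n%:Z)%:~R : R).
Proof.
move=> p_pr p_odd M0 pM; apply: real_char_intr => //.
- by move=> m n; rewrite PoszM legendreM.
- move=> n; apply: legendre_eq; rewrite PoszD rmorphD /= -[(M%:Z)%:~R]pmulrn.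
  by move: pM; rewrite (dvdn_pcharf (pchar_Fp p_pr)) => /eqP ->; rewrite addr0.
- exact: legendre1.
by move=> n; exact: legendre_values.
Qed.

End IntCharacter.

Lemma legendre_modn p (a b : nat) : prime p -> a = b %[mod p] ->
  legendre p a%:Z = legendre p b%:Z.
Proof.
move=> p_pr ab; apply: legendre_eq; rewrite -!pmulrn.
by rewrite -(Fp_nat_mod p_pr a) ab Fp_nat_mod.
Qed.

(** The characters are [chi4], [chi8] and the symbols at ps, in this order, with modulus 8 times the
    product of ps. Their independence comes from the Chinese remainder theorem: take 3 mod 8 for
    [chi4], 5 mod 8 for [chi8], a nonresidue mod p for the symbol at p, and 1 at the other
    moduli. *)
Theorem prime_with_legendre (ps : seq nat) (eps : nat -> int) (r : nat) :
  uniq ps -> all (fun p => prime p && odd p) ps ->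
  (forall p, p \in ps -> eps p = 1 \/ eps p = -1) ->
  r \in [:: 1; 3; 5; 7]%N ->
  exists q, [/\ prime q, (q %% 8 = r)%N & forall p, p \in ps -> legendre p q%:Z = eps p].
Proof.
move=> ps_uniq ps_odd epsP r_odd; pose R := Rdefinitions.R.
have ps_pr : all prime ps by apply: sub_all ps_odd => p /andP[].
have ps_8 p : p \in ps -> coprime 8 p.
  move=> /(allP ps_odd)/andP[p_pr p_odd]; rewrite (coprimeXl 3 (m := 2)) //.
  by rewrite coprime2n.
pose M := (8 * \prod_(p <- ps) p)%N.
have M0 : (0 < M)%N.
  rewrite muln_gt0 /= big_seq prodn_cond_gt0 // => p /(allP ps_pr); exact: prime_gt0.
have M8 : (8 %| M)%N by rewrite dvdn_mulr.
have pM p : p \in ps -> (p %| M)%N.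
  by move=> pps; rewrite dvdn_mull // (big_rem p) //= dvdn_mulr.
have copM a : odd a -> (forall p, p \in ps -> coprime a p) -> coprime a M.
  move=> a_odd a_ps; rewrite coprimeMr (coprimeXr 3 (n := 2)) ?coprimen2 //=.
  by rewrite coprime_sym coprime_prodl; apply/allP => p pps; rewrite coprime_sym a_ps.
have odd8 (a b : nat) : a = b %[mod 8] -> odd a = odd b.
  by move=> ab; rewrite (divn_eq a 8) (divn_eq b 8) ab !oddD !oddM !andbF.
pose chi (i n : nat) : R := (match i with 0 => chi4 n | 1 => chi8 n
  | j.+2 => legendre (nth 3 ps j) n%:Z end)%:~R.
pose e (i : nat) : R := (match i with 0 => chi4 r | 1 => chi8 r
  | j.+2 => eps (nth 3 ps j) end)%:~R.
have nth_ps j : (j.+2 < (size ps).+2)%N -> nth 3 ps j \in ps by move=> hj; rewrite mem_nth.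
have chiP i : (i < (size ps).+2)%N -> real_char M (chi i).
  case: i => [_|[_|j hj]]; first by apply: chi4_char => //; exact: dvdn_trans M8.
    exact: chi8_char.
  have /nth_ps hps := hj; have /andP[p_pr p_odd] := allP ps_odd _ hps.
  by apply: legendre_char => //; exact: pM.
have eP i : (i < (size ps).+2)%N -> (e i == 1) || (e i == -1).
  rewrite /e; case: i => [_|[_|j hj]].
  - by move: r_odd; rewrite !inE => /or4P[] /eqP ->; rewrite ?eqxx ?orbT.
  - by move: r_odd; rewrite !inE => /or4P[] /eqP ->; rewrite ?eqxx ?orbT.
  by case: (epsP _ (nth_ps _ hj)) => ->; rewrite ?eqxx ?orbT.
have [|q q_pr qP] := prime_with_characters chiP eP.
  move=> i hi.
  have basic a : odd a -> (forall p, p \in ps -> a = 1 %[mod p]) -> coprime a M.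
    move=> a_odd ap; apply: copM => // p pps.
    by rewrite -coprime_modl ap // coprime_modl coprime1n.
  case: i hi => [|[|j]] hi.
  - have [a a8 ap] := chinese_seq (fun=> 1%N) 3 ps_uniq ps_pr ps_8.
    exists a; split => //; first by apply: basic => //; rewrite (odd8 _ _ a8).
    by rewrite /chi /chi4 -(modn_dvdm a (isT : (4 %| 8)%N)) a8.
  - have [a a8 ap] := chinese_seq (fun=> 1%N) 5 ps_uniq ps_pr ps_8.
    exists a; split => //; first by apply: basic => //; rewrite (odd8 _ _ a8).
      by rewrite /chi /chi8 a8.
    by case=> // _; rewrite /chi /chi4 -(modn_dvdm a (isT : (4 %| 8)%N)) a8.
  have hps := nth_ps _ hi; set p := nth 3 ps j in hps.
  have /andP[p_pr p_odd] := allP ps_odd _ hps.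
  have [n leg_n np] := legendre_nonresidue p_pr p_odd.
  have [a a8 ap] := chinese_seq (fun p' => if p' == p then n else 1%N) 1 ps_uniq ps_pr ps_8.
  have a1 p' : p' \in ps -> p' != p -> legendre p' a%:Z = 1.
    move=> p's /negbTE p'p; have /andP[p'_pr p'_odd] := allP ps_odd _ p's.
    by have := ap _ p's; rewrite p'p => /(legendre_modn p'_pr) ->; exact: legendre1.
  exists a; split.
  - apply: copM => [|p' p's]; first by rewrite (odd8 _ _ a8).
    rewrite -coprime_modl ap // coprime_modl; case: eqP => [->//|_].
    exact: coprime1n.
  - rewrite /chi -/p; have := ap _ hps; rewrite eqxx => /(legendre_modn p_pr) ->.
    by rewrite leg_n.
  case=> [_|[_|k]]; first by rewrite /chi /chi4 -(modn_dvdm a (isT : (4 %| 8)%N)) a8.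
    by rewrite /chi /chi8 a8.
  rewrite !ltnS => kj; rewrite /chi a1 //.
    by apply: nth_ps; rewrite !ltnS (ltn_trans kj).
  by rewrite /p nth_uniq ?(ltn_trans kj) // ltn_eqF.
exists q; split => //.
- have := qP 0%N isT; have := qP 1%N isT.
  rewrite /chi /e => /intr_inj h8 /intr_inj h4.
  move: r_odd h8 h4; rewrite /chi8 /chi4 -(modn_dvdm q (isT : (4 %| 8)%N)) !inE.
  have := ltn_pmod q (isT : (0 < 8)%N).
  by case: (q %% 8)%N => [|[|[|[|[|[|[|[|]]]]]]]] // _ /or4P[] /eqP ->.
move=> p pps; have := qP (index p ps).+2; rewrite !ltnS index_mem => /(_ pps).
by rewrite /chi /e nth_index // => /intr_inj.
Qed.

(** * Conics and the Davenport-Cassels descent *)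

Lemma pigeonhole (S T : finType) (f : S -> T) :
  (#|T| < #|S|)%N -> exists x, exists2 y, x != y & f x = f y.
Proof.
move=> TS; apply/injectivePn; apply: contraL TS => /injectiveP f_inj.
by rewrite -leqNgt (leq_card f f_inj).
Qed.

Lemma nat_sqrt_exists n : exists k, (k ^ 2 <= n < k.+1 ^ 2)%N.
Proof.
elim: n => [|n [k /andP[h1 h2]]]; first by exists 0%N.
have [h3|h3] := ltnP n.+1 (k.+1 ^ 2); first by exists k; rewrite h3 (leq_trans h1).
by exists k.+1; rewrite h3 (leq_ltn_trans h2) // ltn_exp2r.
Qed.

Lemma inord_modz_eq (n : nat) (x y : int) :
  inord `|(x %% n.+1)%Z|%N = inord `|(y %% n.+1)%Z|%N :> 'I_n.+1 ->
  (n.+1%:Z %| x - y)%Z.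
Proof.
have lt z : (`|(z %% n.+1)%Z| < n.+1)%N.
  by rewrite -ltz_nat gez0_abs ?modz_ge0 // ltz_pmod.
move/(congr1 val); rewrite /= !inordK // => /(congr1 Posz).
by rewrite !gez0_abs ?modz_ge0 // => /eqP; rewrite eqz_mod_dvd.
Qed.

Lemma sqr_ord_diff (X n : nat) (i j : 'I_X.+1) : (X ^ 2 <= n)%N ->
  (i%:Z - j%:Z) ^+ 2 <= n%:Z.
Proof.
move=> Xn; have := ltn_ord i; have := ltn_ord j; rewrite !ltnS => jX iX.
apply: (@le_trans _ _ (X%:Z ^+ 2)); last by rewrite -rmorphXn lez_nat.
nia.
Qed.

Lemma ord_subz_eq0 (n : nat) (i j : 'I_n) : i%:Z - j%:Z = 0 -> i = j.
Proof. by move=> /eqP; rewrite subr_eq0 eqz_nat => /eqP/val_inj. Qed.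

(* When the left-hand side equals a b c, writing a x^2 + b y^2 = c (z^2 + a b) and
   multiplying by z^2 + a b, the norm of z + sqrt(- a b), gives a solution. *)
Lemma conic_of_multiple (a b c x y z k : int) :
  0 < a -> 0 < b -> 0 < c ->
  x ^+ 2 <= b * c -> y ^+ 2 <= a * c -> z ^+ 2 <= a * b ->
  ~ [/\ x = 0, y = 0 & z = 0] -> z ^+ 2 <> a * b -> y ^+ 2 <> a * c ->
  a * x ^+ 2 + b * y ^+ 2 - c * z ^+ 2 = k * (a * b * c) ->
  exists x y z : int, z != 0 /\ a * x ^+ 2 + b * y ^+ 2 = c * z ^+ 2.
Proof.
move=> a0 b0 c0 hx hy hz nz z_neq y_neq hk.
have A0 : 0 < a * b * c by rewrite !mulr_gt0.
have hx1 : a * x ^+ 2 <= a * b * c by rewrite -mulrA ler_pM2l.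
have hy1 : b * y ^+ 2 < a * b * c.
  by rewrite [a * b]mulrC -mulrA ltr_pM2l // lt_neqAle hy andbT; apply/eqP.
have hz1 : c * z ^+ 2 < a * b * c.
  by rewrite [_ * c]mulrC ltr_pM2l // lt_neqAle hz andbT; apply/eqP.
have x0 : 0 <= a * x ^+ 2 by rewrite mulr_ge0 ?sqr_ge0 ?ltW.
have y0 : 0 <= b * y ^+ 2 by rewrite mulr_ge0 ?sqr_ge0 ?ltW.
have z0 : 0 <= c * z ^+ 2 by rewrite mulr_ge0 ?sqr_ge0 ?ltW.
have k_lt2 : k < 2 by rewrite -(ltr_pM2r A0); lia.
have k_gtN1 : -1 < k by rewrite -(ltr_pM2r A0); lia.
have [k0|k1] : k = 0 \/ k = 1 by lia.
  exists x, y, z; split; last by move: hk; rewrite k0; lia.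
  apply/eqP => zz; apply: nz; move: hk; rewrite k0 zz => hk.
  have : a * x ^+ 2 = 0 by lia.
  have : b * y ^+ 2 = 0 by lia.
  move=> /eqP; rewrite mulf_eq0 (gt_eqF b0) sqrf_eq0 => /eqP yy.
  by move=> /eqP; rewrite mulf_eq0 (gt_eqF a0) sqrf_eq0 => /eqP xx.
exists (x * z + b * y), (y * z - a * x), (z ^+ 2 + a * b); split.
  by rewrite gt_eqF // ltr_wpDl ?sqr_ge0 // mulr_gt0.
have E : a * x ^+ 2 + b * y ^+ 2 = c * (z ^+ 2 + a * b) by rewrite k1 in hk; lia.
transitivity ((a * x ^+ 2 + b * y ^+ 2) * (z ^+ 2 + a * b)); first by ring.
by rewrite E; ring.
Qed.

(* The three congruences make a x^2 + b y^2 - c z^2 divisible by a b c, while the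
   box keeps it in [-abc, 2abc]. *)
Theorem legendre_conic (a b c : nat) (r s t : int) :
  (0 < a)%N -> (0 < b)%N -> (0 < c)%N ->
  coprime a b -> coprime a c -> coprime b c ->
  (a%:Z %| r ^+ 2 - b%:Z * c%:Z)%Z -> (b%:Z %| s ^+ 2 - a%:Z * c%:Z)%Z ->
  (c%:Z %| t ^+ 2 + a%:Z * b%:Z)%Z ->
  (forall k, (k ^ 2)%N <> (a * b)%N) -> (forall k, (k ^ 2)%N <> (a * c)%N) ->
  exists x y z : int, z != 0 /\ a%:Z * x ^+ 2 + b%:Z * y ^+ 2 = c%:Z * z ^+ 2.
Proof.
move=> a0 b0 c0 ab ac bc hr hs ht ab_nsq ac_nsq.
have [X /andP[X1 X2]] := nat_sqrt_exists (b * c).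
have [Y /andP[Y1 Y2]] := nat_sqrt_exists (a * c).
have [Z /andP[Z1 Z2]] := nat_sqrt_exists (a * b).
case: a a0 ab ac hr hs ht ab_nsq ac_nsq Y1 Y2 Z1 Z2 => // a' _.
case: b b0 bc X1 X2 => // b' _ bc; case: c c0 bc => // c' _ bc.
set a := a'.+1; set b := b'.+1; set c := c'.+1 => X1 X2.
move=> ab ac hr hs ht ab_nsq ac_nsq Y1 Y2 Z1 Z2.
(* Differences within a fibre satisfy b y = r z mod a, a x = s z mod b and a x = t y mod c, and then
   the form vanishes modulo a, b and c. *)
pose f (v : 'I_X.+1 * 'I_Y.+1 * 'I_Z.+1) : 'I_a * 'I_b * 'I_c :=
  let: (x, y, z) := v in
  (inord `|((b%:Z * y%:Z - r * z%:Z) %% a)%Z|%N,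
   inord `|((a%:Z * x%:Z - s * z%:Z) %% b)%Z|%N,
   inord `|((a%:Z * x%:Z - t * y%:Z) %% c)%Z|%N).
have [|[[x1 y1] z1] [[[x2 y2] z2] neq]] := @pigeonhole _ _ f.
  (* The box has more than a b c points, seen on squares: the three sides squared exceed b c, a c
     and a b. *)
  rewrite !card_prod !card_ord -(ltn_sqr (a * b * c)) !expnMn.
  have -> : (a ^ 2 * b ^ 2 * c ^ 2 = (b * c) * (a * c) * (a * b))%N by ring.
  have h1 : ((b * c) * (a * c) < X.+1 ^ 2 * Y.+1 ^ 2)%N by apply: ltn_mul.
  by apply: ltn_mul.
case=> /inord_modz_eq hA /inord_modz_eq hB /inord_modz_eq hC.
set x := x1%:Z - x2%:Z; set y := y1%:Z - y2%:Z; set z := z1%:Z - z2%:Z.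
have {}hA : (a%:Z %| b%:Z * y - r * z)%Z.
  by move: hA; congr (_ %| _)%Z; rewrite /y /z; ring.
have {}hB : (b%:Z %| a%:Z * x - s * z)%Z.
  by move: hB; congr (_ %| _)%Z; rewrite /x /z; ring.
have {}hC : (c%:Z %| a%:Z * x - t * y)%Z.
  by move: hC; congr (_ %| _)%Z; rewrite /x /y; ring.
have nz : ~ [/\ x = 0, y = 0 & z = 0].
  case=> hx hy hz; move: neq; rewrite /eq_op /= /eq_op /=.
  rewrite (ord_subz_eq0 hx) eqxx.
  rewrite (ord_subz_eq0 hy) eqxx.
  by rewrite (ord_subz_eq0 hz) eqxx.
have xX : x ^+ 2 <= (b * c)%:Z by exact: sqr_ord_diff.
have yY : y ^+ 2 <= (a * c)%:Z by exact: sqr_ord_diff.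
have zZ : z ^+ 2 <= (a * b)%:Z by exact: sqr_ord_diff.
pose Q := a%:Z * x ^+ 2 + b%:Z * y ^+ 2 - c%:Z * z ^+ 2.
have Qa : (a%:Z %| Q)%Z.
  have : (a%:Z %| b%:Z * Q)%Z.
    have -> : b%:Z * Q = a%:Z * (b%:Z * x ^+ 2) + (b%:Z * y - r * z) * (b%:Z * y + r * z)
      + (r ^+ 2 - b%:Z * c%:Z) * z ^+ 2 by rewrite /Q; ring.
    by rewrite !rpredD ?dvdz_mulr.
  by rewrite Gauss_dvdzr.
have Qb : (b%:Z %| Q)%Z.
  have : (b%:Z %| a%:Z * Q)%Z.
    have -> : a%:Z * Q = b%:Z * (a%:Z * y ^+ 2) + (a%:Z * x - s * z) * (a%:Z * x + s * z)
      + (s ^+ 2 - a%:Z * c%:Z) * z ^+ 2 by rewrite /Q; ring.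
    by rewrite !rpredD ?dvdz_mulr.
  by rewrite Gauss_dvdzr // coprimezE coprime_sym.
have Qc : (c%:Z %| Q)%Z.
  have : (c%:Z %| a%:Z * Q)%Z.
    have -> : a%:Z * Q = c%:Z * (- a%:Z * z ^+ 2) + (a%:Z * x - t * y) * (a%:Z * x + t * y)
      + (t ^+ 2 + a%:Z * b%:Z) * y ^+ 2 by rewrite /Q; ring.
    by rewrite !rpredD ?dvdz_mulr.
  by rewrite Gauss_dvdzr // coprimezE coprime_sym.
have /dvdzP[k Qk] : ((a * b * c)%:Z %| Q)%Z.
  rewrite !PoszM Gauss_dvdz; last by rewrite coprimezE /= coprimeMl ac bc.
  by rewrite Gauss_dvdz ?Qa ?Qb ?Qc.
apply: (conic_of_multiple (x := x) (y := y) (z := z) (k := k)) => //.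
- by move=> zE; apply: (ab_nsq `|z|%N); apply/eqP; rewrite -eqz_nat PoszM -zE -abszX gez0_abs ?sqr_ge0.
- by move=> yE; apply: (ac_nsq `|y|%N); apply/eqP; rewrite -eqz_nat PoszM -yE -abszX gez0_abs ?sqr_ge0.
Qed.

Lemma sqrt_mod_squarefree (ps : seq nat) (m : int) :
  uniq ps -> all prime ps ->
  (forall p, p \in ps -> exists x : nat, (p%:Z %| x%:Z ^+ 2 - m)%Z) ->
  exists x : nat, ((\prod_(p <- ps) p)%:Z %| x%:Z ^+ 2 - m)%Z.
Proof.
elim: ps => [|p s IH] /=; first by exists 0%N; rewrite big_nil dvd1z.
move=> /andP[pNs s_uniq] /andP[p_pr s_pr] hm.
have [|x hx] := IH s_uniq s_pr; first by move=> p' p's; apply: hm; rewrite inE p's orbT.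
have [y hy] := hm p (mem_head _ _).
have cop : coprime p (\prod_(i <- s) i).
  rewrite coprime_sym coprime_prodl; apply/allP => i is_.
  have i_pr := allP s_pr _ is_; rewrite prime_coprime // dvdn_prime2 //.
  by apply: contraNneq pNs => <-.
exists (chinese p (\prod_(i <- s) i) y x).
rewrite big_cons PoszM Gauss_dvdz // -!eqz_mod_dvd in hx hy *.
have sq d u v : (u = v %[mod d])%N -> (u%:Z ^+ 2 = v%:Z ^+ 2 %[mod d])%Z.
  by move=> uv; rewrite !expr2 -!PoszM !modz_nat -modnMm uv modnMm.
apply/andP; split; apply/eqP.
  by rewrite (sq _ _ y) ?chinese_modl //; apply/eqP.
by rewrite (sq _ _ x) ?chinese_modr //; apply/eqP.
Qed.

Lemma small_multiple (A B q k : int) : 0 <= A -> 0 <= B -> A < q -> B < q ->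
  A + B = k * q -> ~ (A = 0 /\ B = 0) -> k = 1.
Proof.
move=> A0 B0 Aq Bq kq nz; have q0 : 0 < q by exact: le_lt_trans Aq.
have : k < 2 by rewrite -(ltr_pM2r q0); lia.
suff : 0 < k by lia.
rewrite -(ltr_pM2r q0) mul0r -kq lt_neqAle addr_ge0 // andbT.
by apply/eqP => AB; apply: nz; lia.
Qed.

(** Thue's argument: with r^2 = -1 mod q, two points of a box with more than q points share x - r y
    modulo q; their difference makes x^2 + y^2 a multiple of q strictly between 0 and 2 q. *)
Theorem two_squares (q : nat) : prime q -> (q %% 4 = 1)%N ->
  exists x y : int, x ^+ 2 + y ^+ 2 = q%:Z.
Proof.
move=> q_pr q4; have q_gt0 := prime_gt0 q_pr.
have q_odd : odd q by rewrite (divn_eq q 4) q4 oddD oddM andbF.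
have legN1 : legendre q (-1) = 1.
  rewrite legendreN1 // -signr_odd.
  have -> : (q.-1)./2 = ((q %/ 4) * 2)%N.
    by rewrite {1}(divn_eq q 4) q4 addn1 /= (_ : 4 = 2 * 2)%N // mulnA muln2 doubleK.
  by rewrite oddM andbF.
have [r hr] := legendre_square q_pr q_odd legN1.
have {}hr : (q%:Z %| r%:Z ^+ 2 - -1)%Z by rewrite dvdzE.
have q_nsq k : (k ^ 2)%N <> q.
  move=> kq; have : logn q (k ^ 2) = 1%N by rewrite kq -{2}[q]expn1 pfactorK.
  by rewrite lognX; lia.
have [X /andP[X1 X2]] := nat_sqrt_exists q.
case: q q_pr q_gt0 q4 q_odd legN1 hr q_nsq X1 X2 => // q' q_pr _ q4 q_odd _ hr q_nsq X1 X2.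
set q := q'.+1 in q_pr q4 q_odd hr q_nsq X1 X2 *.
pose f (v : 'I_X.+1 * 'I_X.+1) : 'I_q :=
  inord `|((v.1%:Z - r%:Z * v.2%:Z) %% q)%Z|%N.
have [|[x1 y1] [[x2 y2] neq]] := @pigeonhole _ _ f.
  by rewrite card_prod !card_ord.
move/inord_modz_eq => /=; set x := x1%:Z - x2%:Z; set y := y1%:Z - y2%:Z => hxy.
have {}hxy : (q%:Z %| x - r%:Z * y)%Z.
  by move: hxy; congr (_ %| _)%Z; rewrite /x /y; ring.
have nz : ~ (x = 0 /\ y = 0).
  case=> hx hy; move: neq; rewrite /eq_op /=.
  rewrite (ord_subz_eq0 hx) eqxx.
  by rewrite (ord_subz_eq0 hy) eqxx.
have lt_q (i j : 'I_X.+1) : (i%:Z - j%:Z) ^+ 2 < q%:Z.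
  rewrite lt_neqAle sqr_ord_diff // andbT; apply/eqP => E.
  by apply: (q_nsq `|i%:Z - j%:Z|%N); apply/eqP; rewrite -eqz_nat -E -abszX gez0_abs ?sqr_ge0.
have : (q%:Z %| x ^+ 2 + y ^+ 2)%Z.
  have -> : x ^+ 2 + y ^+ 2 = (x - r%:Z * y) * (x + r%:Z * y) + (r%:Z ^+ 2 - -1) * y ^+ 2 by ring.
  by rewrite rpredD ?dvdz_mulr.
case/dvdzP => k hk; exists x, y; rewrite hk; have := lt_q x1 x2; have := lt_q y1 y2.
rewrite -/x -/y => hy hx.
suff -> : k = 1 by rewrite mul1r.
apply: (small_multiple _ _ hx hy hk); rewrite ?sqr_ge0 // => -[/eqP + /eqP].
by rewrite !sqrf_eq0 => /eqP x0 /eqP y0; apply: nz.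
Qed.

(** * The Davenport-Cassels descent *)

Definition tform (c x y z : int) : int := x ^+ 2 + y ^+ 2 + c * y * z + z ^+ 2.

Definition tpolar (c x y z x' y' z' : int) : int :=
  2 * x * x' + 2 * y * y' + c * (y * z' + y' * z) + 2 * z * z'.

(** For c = 1, residues r2 = r3 = t/2 or r2 = r3 = - t/2 could bring the form up to t^2; using
    opposite half-open intervals for y and z excludes both ties. *)
Lemma half_open_residue (t : nat) (x : int) : (0 < t)%N ->
  (exists y r, x = t%:Z * y + r /\ (- t%:Z < 2 * r <= t%:Z)) /\
  (exists y r, x = t%:Z * y + r /\ (- t%:Z <= 2 * r < t%:Z)).
Proof.
move=> t0; have := divz_eq x t%:Z; have := modz_ge0 x (_ : t%:Z != 0).
have := @ltz_pmod x t%:Z; rewrite ltz_nat t0 eqz_nat -lt0n t0.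
move=> /(_ isT) h1 /(_ isT) h2 h3; set q := (x %/ t)%Z in h3; set m := (x %% t)%Z in h1 h2 h3.
split.
  have [h|h] := lerP (2 * m) t%:Z; first by exists q, m; split; lia.
  by exists (q + 1), (m - t%:Z); split; [rewrite h3; ring | lia].
have [h|h] := ltrP (2 * m) t%:Z; first by exists q, m; split; lia.
by exists (q + 1), (m - t%:Z); split; [rewrite h3; ring | lia].
Qed.

(* The Davenport-Cassels argument: the second intersection with the quadric of the
   line through X / t and a nearest integral point has a smaller denominator. *)
Theorem davenport_cassels (c N : int) (t : nat) (x y z : int) :
  (c == 0) || (c == 1) -> (0 < t)%N -> tform c x y z = N * t%:Z ^+ 2 ->
  exists x' y' z', tform c x' y' z' = N.
Proof.
move=> c01; elim/ltn_ind: t x y z => t IH x y z t0 hN.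
have [[x1 [r1 [xE r1P]]] _] := half_open_residue x t0.
have [[y1 [r2 [yE r2P]]] _] := half_open_residue y t0.
have [_ [z1 [r3 [zE r3P]]]] := half_open_residue z t0.
(* The new denominator: t t' is the value of the form at the residues, which is less than t^2. *)
pose t' : int := N * t%:Z - tpolar c x y z x1 y1 z1 + t%:Z * tform c x1 y1 z1.
have tt' : t%:Z * t' = tform c r1 r2 r3.
  have -> : tform c r1 r2 r3 = tform c x y z - t%:Z * tpolar c x y z x1 y1 z1
      + t%:Z ^+ 2 * tform c x1 y1 z1 by rewrite xE yE zE /tform /tpolar; ring.
  by rewrite hN /t'; ring.
have tZ : 0 < t%:Z by rewrite ltz_nat.
have form_ge0 : 0 <= tform c r1 r2 r3.
  rewrite /tform; case/orP: c01 => /eqP ->; first by nia.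
  have := sqr_ge0 r1; have := sqr_ge0 (2 * r2 + r3); have := sqr_ge0 r3; nia.
have form_lt : tform c r1 r2 r3 < t%:Z ^+ 2.
  have h1 : (2 * r1) ^+ 2 <= t%:Z ^+ 2 by nia.
  have h2 : (2 * r2) ^+ 2 <= t%:Z ^+ 2 by nia.
  have h3 : (2 * r3) ^+ 2 <= t%:Z ^+ 2 by nia.
  have h4 : (2 * r2) * (2 * r3) < t%:Z ^+ 2.
    move: r2P r3P; move: (2 * r2) (2 * r3) => u v /andP[u1 u2] /andP[v1 v2].
    have [v0|v0] := lerP 0 v; [have : 0 <= (t%:Z - u) * v by nia | have : 0 < (t%:Z + u) * (- v) by nia]; nia.
  rewrite /tform; case/orP: c01 => /eqP ->; lia.
have [form0|form_neq0] := eqVneq (tform c r1 r2 r3) 0.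
  have r0 : [/\ r1 = 0, r2 = 0 & r3 = 0].
    have s1 := sqr_ge0 r1; have s2 := sqr_ge0 r2; have s3 := sqr_ge0 r3.
    have s4 := sqr_ge0 (2 * r2 + r3); have s5 := sqr_ge0 (2 * r3 + r2).
    move: form0; rewrite /tform => form0.
    suff : [/\ r1 ^+ 2 = 0, r2 ^+ 2 = 0 & r3 ^+ 2 = 0].
      by case=> /eqP; rewrite sqrf_eq0 => /eqP -> /eqP; rewrite sqrf_eq0 => /eqP -> /eqP;
        rewrite sqrf_eq0 => /eqP ->.
    by case/orP: c01 form0 => /eqP ->; split; lia.
  exists x1, y1, z1; case: r0 xE yE zE => -> -> ->; rewrite !addr0 => xE yE zE.
  apply: (mulfI (_ : t%:Z ^+ 2 != 0)); first by rewrite expf_neq0 // gt_eqF.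
  by rewrite [RHS]mulrC -hN xE yE zE /tform; ring.
have t'0 : 0 < t'.
  by rewrite -(pmulr_rgt0 _ tZ) tt' lt_neqAle eq_sym form_neq0.
have t'E : `|t'|%:Z = t' by rewrite gtz0_abs.
(* Since a t + b = t', the vector a X + b X1 over t' lies on the line through X / t and X1; it is
   the second intersection point. *)
pose a := tform c x1 y1 z1 - N; pose b := 2 * (N * t%:Z) - tpolar c x y z x1 y1 z1.
apply: (IH `|t'|%N _ (a * x + b * x1) (a * y + b * y1) (a * z + b * z1)).
- by rewrite -ltz_nat t'E -(ltr_pM2l tZ) tt' -expr2.
- by rewrite -ltz_nat t'E.
rewrite t'E.
have -> : tform c (a * x + b * x1) (a * y + b * y1) (a * z + b * z1) =
  a ^+ 2 * tform c x y z + a * b * tpolar c x y z x1 y1 z1 + b ^+ 2 * tform c x1 y1 z1.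
  by rewrite /tform /tpolar; ring.
by rewrite hN /a /b /t'; ring.
Qed.

(** * Quaternions *)

Definition quat : Type := (int * int * int * int)%type.

Definition qmul (x y : quat) : quat :=
  let: (a1, b1, c1, d1) := x in let: (a2, b2, c2, d2) := y in
  (a1 * a2 - b1 * b2 - c1 * c2 - d1 * d2, a1 * b2 + b1 * a2 + c1 * d2 - d1 * c2,
   a1 * c2 - b1 * d2 + c1 * a2 + d1 * b2, a1 * d2 + b1 * c2 - c1 * b2 + d1 * a2).

Definition qconj (x : quat) : quat := let: (a, b, c, d) := x in (a, - b, - c, - d).

Definition qnorm (x : quat) : int :=
  let: (a, b, c, d) := x in a ^+ 2 + b ^+ 2 + c ^+ 2 + d ^+ 2.

Definition qscale (m : int) (x : quat) : quat :=
  let: (a, b, c, d) := x in (m * a, m * b, m * c, m * d).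

Definition qdvd (m : int) (x : quat) : bool :=
  let: (a, b, c, d) := x in [&& (m %| a)%Z, (m %| b)%Z, (m %| c)%Z & (m %| d)%Z].

Ltac quat_ring := repeat match goal with x : quat |- _ => case: x => [[[? ?] ?] ?] end;
  rewrite /qmul /qconj /qnorm /qscale; try (congr (_, _, _, _)); ring.

Lemma qmulA x y z : qmul x (qmul y z) = qmul (qmul x y) z.
Proof. by quat_ring. Qed.

Lemma qconjM x y : qconj (qmul x y) = qmul (qconj y) (qconj x).
Proof. by quat_ring. Qed.

Lemma qnormM x y : qnorm (qmul x y) = qnorm x * qnorm y.
Proof. by quat_ring. Qed.

Lemma qnorm_scale m x : qnorm (qscale m x) = m ^+ 2 * qnorm x.
Proof. by quat_ring. Qed.

Lemma qconj_scale m x : qconj (qscale m x) = qscale m (qconj x).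
Proof. by quat_ring. Qed.

Lemma qmul_scalel m x y : qmul (qscale m x) y = qscale m (qmul x y).
Proof. by quat_ring. Qed.

Lemma qmul_conj x : qmul x (qconj x) = (qnorm x, 0, 0, 0).
Proof. by quat_ring. Qed.

Lemma qconj_mul x : qmul (qconj x) x = (qnorm x, 0, 0, 0).
Proof. by quat_ring. Qed.

Lemma qnorm_conj x : qnorm (qconj x) = qnorm x.
Proof. by quat_ring. Qed.

Lemma qnorm_ge0 x : 0 <= qnorm x.
Proof. by case: x => [[[a b] c] d]; rewrite !addr_ge0 ?sqr_ge0. Qed.

Lemma qdvd_mull m x y : qdvd m y -> qdvd m (qmul x y).
Proof.
case: x => [[[a b] c] d]; case: y => [[[a' b'] c'] d'] /= /and4P[h1 h2 h3 h4].
by apply/and4P; split; rewrite ?(rpredB, rpredD) // dvdz_mull.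
Qed.

Lemma qdvd_mulr m x y : qdvd m x -> qdvd m (qmul x y).
Proof.
case: x => [[[a b] c] d]; case: y => [[[a' b'] c'] d'] /= /and4P[h1 h2 h3 h4].
by apply/and4P; split; rewrite ?(rpredB, rpredD) // dvdz_mulr.
Qed.

Lemma qdvd_scale m n x : coprimez m n -> qdvd m (qscale n x) = qdvd m x.
Proof. by case: x => [[[a b] c] d] /= mn; rewrite !Gauss_dvdzr. Qed.

Lemma qdvdP m x : reflect (exists y, x = qscale m y) (qdvd m x).
Proof.
case: x => [[[a b] c] d] /=; apply: (iffP and4P) => [[]|[[[[a' b'] c'] d'] [-> -> -> ->]]].
  move=> /dvdzP[a' ->] /dvdzP[b' ->] /dvdzP[c' ->] /dvdzP[d' ->].
  by exists (a', b', c', d'); rewrite /= !(mulrC m).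
by rewrite !dvdz_mulr.
Qed.

(** An even norm pairs the four coordinates by parity; the matching right factor 1 + i, 1 + j or 1 +
    k, of norm 2, makes the product divisible by 2. *)
Lemma qnorm_half (x : quat) : (2 %| qnorm x)%Z ->
  exists z y, qmul x z = qscale 2 y /\ qnorm x = 2 * qnorm y.
Proof.
case: x => [[[a b] c] d] h.
have par (u : int) : exists k e : int, u = 2 * k + e /\ (e = 0 \/ e = 1).
  exists (u %/ 2)%Z, (u %% 2)%Z; split; first by rewrite mulrC -divz_eq.
  have := modz_ge0 u (isT : (2 : int) != 0); have := ltz_pmod u (isT : 0 < (2 : int)).
  lia.
have [a' [ea [aE eaP]]] := par a; have [b' [eb [bE ebP]]] := par b.
have [c' [ec [cE ecP]]] := par c; have [d' [ed [dE edP]]] := par d.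
have hsum : (2 %| ea + eb + ec + ed)%Z.
  have sq (e : int) : e = 0 \/ e = 1 -> e ^+ 2 = e by case=> ->.
  move: h; rewrite /qnorm aE bE cE dE => h.
  have -> : ea + eb + ec + ed = (2 * a' + ea) ^+ 2 + (2 * b' + eb) ^+ 2 +
     (2 * c' + ec) ^+ 2 + (2 * d' + ed) ^+ 2 - 2 * (2 * a' ^+ 2 + 2 * a' * ea +
      2 * b' ^+ 2 + 2 * b' * eb + 2 * c' ^+ 2 + 2 * c' * ec + 2 * d' ^+ 2 + 2 * d' * ed).
    by rewrite -{1}(sq _ eaP) -{1}(sq _ ebP) -{1}(sq _ ecP) -{1}(sq _ edP); ring.
  by rewrite rpredB // dvdz_mulr.
have pairing : ea = eb /\ ec = ed \/ (ea = ec /\ eb = ed \/ ea = ed /\ eb = ec).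
  case: eaP hsum => ->; case: ebP => ->; case: ecP => ->; case: edP => -> // _;
    by [left | right; left | right; right].
rewrite aE bE cE dE; case: pairing => [[-> ->]|[[-> ->]|[-> ->]]].
- exists (1, 1, 0, 0), (a' - b', a' + b' + eb, c' + d' + ed, d' - c').
  by split; rewrite /qmul /qscale /qnorm; [congr (_, _, _, _)|]; ring.
- exists (1, 0, 1, 0), (a' - c', b' - d', a' + c' + ec, b' + d' + ed).
  by split; rewrite /qmul /qscale /qnorm; [congr (_, _, _, _)|]; ring.
exists (1, 0, 0, 1), (a' - d', b' + c' + ec, c' - b', a' + d' + ed).
by split; rewrite /qmul /qscale /qnorm; [congr (_, _, _, _)|]; ring.
Qed.

Definition qadd (x y : quat) : quat :=
  let: (a1, b1, c1, d1) := x in let: (a2, b2, c2, d2) := y in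
  (a1 + a2, b1 + b2, c1 + c2, d1 + d2).

Lemma qdvd_add m x y : qdvd m x -> qdvd m y -> qdvd m (qadd x y).
Proof.
case: x => [[[a b] c] d]; case: y => [[[a' b'] c'] d'] /= /and4P[h1 h2 h3 h4].
by move=> /and4P[h5 h6 h7 h8]; apply/and4P; split; rewrite rpredD.
Qed.

Lemma balanced_residue (m : nat) (u : int) : odd m ->
  exists r k, u = r + m%:Z * k /\ - m%:Z < 2 * r < m%:Z.
Proof.
move=> m_odd; have m0 : (0 < m)%N by case: m m_odd.
have := divz_eq u m%:Z; have := modz_ge0 u (_ : m%:Z != 0).
have := @ltz_pmod u m%:Z; rewrite ltz_nat m0 eqz_nat -lt0n m0.
move=> /(_ isT); move: (u %/ m)%Z (u %% m)%Z => k r h1 /(_ isT) h2 h3.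
have mE : m%:Z = 2 * (m./2)%:Z + 1 by rewrite -{1}(odd_double_half m) m_odd; lia.
have [h|h] := ltrP (2 * r) m%:Z; first by exists r, k; split; [rewrite h3; ring | lia].
by exists (r - m%:Z), (k + 1); split; [rewrite h3; ring | lia].
Qed.

(** Oddness of m excludes the residue m/2, so each of the four squares is strictly less than m^2 /
    4. *)
Lemma quat_balanced_residue (m : nat) (x : quat) : odd m ->
  exists r k, x = qadd r (qscale m%:Z k) /\ qnorm r < m%:Z ^+ 2.
Proof.
case: x => [[[a b] c] d] m_odd.
have [r1 [k1 [-> h1]]] := balanced_residue a m_odd.
have [r2 [k2 [-> h2]]] := balanced_residue b m_odd.
have [r3 [k3 [-> h3]]] := balanced_residue c m_odd.
have [r4 [k4 [-> h4]]] := balanced_residue d m_odd.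
exists (r1, r2, r3, r4), (k1, k2, k3, k4); split => //=.
have sq r : - m%:Z < 2 * r < m%:Z -> 4 * r ^+ 2 < m%:Z ^+ 2.
  by move=> h; nia.
by have := sq _ h1; have := sq _ h2; have := sq _ h3; have := sq _ h4; lia.
Qed.

Lemma qnorm_residue (m : int) (r k : quat) :
  (m %| qnorm (qadd r (qscale m k)))%Z = (m %| qnorm r)%Z.
Proof.
case: r k => [[[a b] c] d] [[[a' b'] c'] d'] /=.
have -> : (a + m * a') ^+ 2 + (b + m * b') ^+ 2 + (c + m * c') ^+ 2 + (d + m * d') ^+ 2 =
  (a ^+ 2 + b ^+ 2 + c ^+ 2 + d ^+ 2) +
  m * (2 * a * a' + m * a' ^+ 2 + 2 * b * b' + m * b' ^+ 2 +
       2 * c * c' + m * c' ^+ 2 + 2 * d * d' + m * d' ^+ 2) by ring.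
by rewrite dvdz_addl ?dvdz_mulr // || rewrite rpredDr ?dvdz_mulr.
Qed.

Lemma qnorm_eq0 x : qnorm x = 0 -> x = (0, 0, 0, 0).
Proof.
case: x => [[[a b] c] d] /= h.
have := sqr_ge0 a; have := sqr_ge0 b; have := sqr_ge0 c; have := sqr_ge0 d => d0 c0 b0 a0.
have /eqP : a ^+ 2 = 0 by lia.
have /eqP : b ^+ 2 = 0 by lia.
have /eqP : c ^+ 2 = 0 by lia.
have /eqP : d ^+ 2 = 0 by lia.
by rewrite !sqrf_eq0 => /eqP -> /eqP -> /eqP -> /eqP ->.
Qed.

(* Lagrange's descent for four squares, restricted to the right ideal of the
   quaternions whose conjugate maps delta into p H. *)
Section Descent.
Variables (p : nat) (delta : quat).
Hypotheses (p_pr : prime p) (p_odd : odd p).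
Hypotheses (p_norm : (p%:Z %| qnorm delta)%Z) (p_ndvd : ~~ qdvd p%:Z delta).

Let ideal (x : quat) := qdvd p%:Z (qmul (qconj x) delta).

Let ideal_mulr x z : ideal x -> ideal (qmul x z).
Proof. by move=> hx; rewrite /ideal qconjM -qmulA qdvd_mull. Qed.

Let ideal_scale m x : coprimez p%:Z m -> ideal (qscale m x) -> ideal x.
Proof. by move=> pm; rewrite /ideal qconj_scale qmul_scalel qdvd_scale. Qed.

Let represented (m : nat) := exists2 x, ideal x & qnorm x = m%:Z * p%:Z.

Let pZ : 0 < p%:Z. Proof. by rewrite ltz_nat prime_gt0. Qed.

Let represented_lt_p : exists2 m, (0 < m < p)%N & represented m.
Proof.
have [r [k [dE r_lt]]] := quat_balanced_residue delta p_odd.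
have /dvdzP[m mE] : (p%:Z %| qnorm r)%Z by rewrite -(qnorm_residue _ _ k) -dE.
have r0 : qnorm r != 0.
  apply: contra p_ndvd => /eqP/qnorm_eq0 r0.
  apply/qdvdP; exists k; rewrite dE r0; by case: (k) => [[[? ?] ?] ?] /=; rewrite !add0r.
have m_gt0 : 0 < m.
  by rewrite -(pmulr_lgt0 _ pZ) -mE lt_neqAle eq_sym r0 qnorm_ge0.
have m_lt : m < p%:Z by rewrite -(ltr_pM2r pZ) -mE -expr2.
exists `|m|%N; first by rewrite -!ltz_nat !gtz0_abs ?m_gt0.
exists r; last by rewrite gtz0_abs.
rewrite /ideal.
(* r = delta modulo p, so conj(r) delta is conj(delta) delta = [qnorm delta] modulo p. *)
have -> : qmul (qconj r) delta =
  qadd (qnorm delta, 0, 0, 0) (qscale p%:Z (qmul (qscale (-1) (qconj k)) delta)).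
  rewrite -(qconj_mul delta) {2}dE.
  case: (r) (k) (delta) => [[[? ?] ?] ?] [[[? ?] ?] ?] [[[? ?] ?] ?].
  by rewrite /qmul /qconj /qadd /qscale; congr (_, _, _, _); ring.
apply: qdvd_add; first by rewrite /= p_norm !dvdz0.
by apply/qdvdP; eexists.
Qed.

Let represented_descent m : (1 < m < p)%N -> represented m ->
  exists2 m', (0 < m' < m)%N & represented m'.
Proof.
move=> /andP[m1 mp] [x xI xN]; have m0 : (0 < m)%N by exact: ltnW.
have pm : coprime p m by rewrite prime_coprime // gtnNdvd.
have mZ : 0 < m%:Z by rewrite ltz_nat.
(* For even m, multiply by a quaternion of norm 2 and halve; the ideal is respected because p is
   odd. *)
have [m_odd|m_even] := boolP (odd m); last first.
  have mE : m = (m./2).*2 by rewrite -{1}(odd_double_half m) (negbTE m_even).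
  have [|z [y [xz xN2]]] := @qnorm_half x.
    by rewrite xN mE -mul2n PoszM -mulrA dvdz_mulr.
  exists m./2; first by apply/andP; split; lia.
  exists y; last by move: xN; rewrite xN2 {1}mE; lia.
  apply: (@ideal_scale 2); first by rewrite coprimezE /= coprimen2.
  by rewrite -xz ideal_mulr.
have [r [k [xE r_lt]]] := quat_balanced_residue x m_odd.
have /dvdzP[m' m'E] : (m%:Z %| qnorm r)%Z.
  by rewrite -(qnorm_residue _ _ k) -xE xN dvdz_mulr.
have r0 : qnorm r != 0.
  apply/eqP => /qnorm_eq0 r0.
  have xmk : x = qscale m%:Z k.
    by rewrite xE r0; case: (k) => [[[? ?] ?] ?] /=; rewrite !add0r.
  have : m%:Z * qnorm k = p%:Z.
    by apply: (mulfI (lt0r_neq0 mZ)); rewrite mulrA -expr2 -qnorm_scale -xmk.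
  move=> mk; have : (m%:Z %| p%:Z)%Z by rewrite -mk dvdz_mulr.
  rewrite dvdzE /= => mdp; have := coprime_dvdl mdp (_ : coprime p m).
  by move: pm; rewrite coprime_sym => /(coprime_dvdr mdp); rewrite /coprime gcdnn gtn_eqF.
have m'_gt0 : 0 < m'.
  by rewrite -(pmulr_lgt0 _ mZ) -m'E lt_neqAle eq_sym r0 qnorm_ge0.
have m'_lt : m' < m%:Z by rewrite -(ltr_pM2r mZ) -m'E -expr2.
(* This is x conj(r) / m: r = x - m k and x conj(x) = m p give the quotient p - x conj(k), of norm
   m' p. *)
pose g := qadd (p%:Z, 0, 0, 0) (qscale (-1) (qmul x (qconj k))).
have gE : qmul x (qconj r) = qscale m%:Z g.
  have : (qnorm x, 0, 0, 0) = qscale m%:Z (p%:Z, 0, 0, 0) by rewrite /qscale xN !mulr0.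
  rewrite -qmul_conj => h.
  have -> : qscale m%:Z g = qadd (qscale m%:Z (p%:Z, 0, 0, 0))
      (qscale m%:Z (qscale (-1) (qmul x (qconj k)))).
    rewrite /g; case: (qscale (-1) _) => [[[? ?] ?] ?].
    by rewrite /qadd /qscale; congr (_, _, _, _); ring.
  rewrite -h {3}xE; case: (r) (k) (x) => [[[? ?] ?] ?] [[[? ?] ?] ?] [[[? ?] ?] ?].
  by rewrite /qmul /qconj /qadd /qscale; congr (_, _, _, _); ring.
exists `|m'|%N; first by rewrite -!ltz_nat !gtz0_abs ?m'_gt0.
exists g.
  by apply: (@ideal_scale m%:Z); rewrite ?coprimezE // -gE ideal_mulr.
rewrite gtz0_abs //; apply: (mulfI (lt0r_neq0 (exprn_gt0 2 mZ))).
by rewrite -qnorm_scale -gE qnormM qnorm_conj xN m'E; ring.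
Qed.

Lemma quat_factor_prime : exists2 x, qdvd p%:Z (qmul (qconj x) delta) & qnorm x = p%:Z.
Proof.
have [m /andP[m0 mp] hm] := represented_lt_p.
elim/ltn_ind: m m0 mp hm => m IH m0 mp hm.
have [m1|m1] := leqP m 1; last first.
  have [|m' /andP[m'0 m'm] hm'] := represented_descent _ hm; first by rewrite m1.
  by apply: (IH m') => //; exact: ltn_trans mp.
have m_eq1 : m = 1%N by lia.
by case: hm => x xI; rewrite m_eq1 mul1r; exists x.
Qed.

End Descent.

(* Conjugating the pure quaternion w i + a j + b k by a factor of norm p of
   w i + a j + b k - r, where r^2 = - N mod p, yields an integral quaternion. *)
Theorem rotate_three_squares (p : nat) (N w a b r : int) :
  prime p -> odd p -> w ^+ 2 + a ^+ 2 + b ^+ 2 = N -> (p%:Z %| r ^+ 2 + N)%Z ->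
  ~~ (p%:Z %| N)%Z ->
  exists s t u v w' a' b',
    [/\ s ^+ 2 + t ^+ 2 + u ^+ 2 + v ^+ 2 = p%:Z, w' ^+ 2 + a' ^+ 2 + b' ^+ 2 = N &
    p%:Z * w' = (s ^+ 2 + t ^+ 2 - u ^+ 2 - v ^+ 2) * w + 2 * (t * u + s * v) * a
                + 2 * (t * v - s * u) * b].
Proof.
move=> p_pr p_odd wabN rN pN; pose d : quat := (- r, w, a, b).
have d_norm : (p%:Z %| qnorm d)%Z.
  by move: rN; congr (_ %| _)%Z; rewrite -wabN /=; ring.
have d_ndvd : ~~ qdvd p%:Z d.
  apply: contra pN => /and4P[_ h1 h2 h3]; rewrite -wabN !expr2.
  by rewrite !rpredD ?dvdz_mulr.
have [[[[s t] u] v] xI xN] := quat_factor_prime p_pr p_odd d_norm d_ndvd.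
(* The scalar - r only affects the scalar part of conj(x) d x, so its pure part is conj(x) (w i + a
   j + b k) x, and p divides it. *)
have /qdvdP[[[[g0 w'] a'] b'] gE] := qdvd_mulr (s, t, u, v) xI.
have pZ : p%:Z != 0 by rewrite eqz_nat -lt0n prime_gt0.
move: gE; rewrite /d /qconj /qmul /qscale; case=> _ hw ha hb.
exists s, t, u, v, w', a', b'; split => //; last by rewrite -hw; ring.
apply: (mulfI (expf_neq0 2 pZ)).
have -> : p%:Z ^+ 2 * (w' ^+ 2 + a' ^+ 2 + b' ^+ 2) =
  (p%:Z * w') ^+ 2 + (p%:Z * a') ^+ 2 + (p%:Z * b') ^+ 2 by ring.
by rewrite -hw -ha -hb -wabN -xN /qnorm; ring.
Qed.

(** * Rational representations by ternary forms *)

Lemma squarefree_decomposition (n : nat) : (0 < n)%N ->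
  exists s ps, [/\ (0 < s)%N, uniq ps, all prime ps & n = (s ^ 2 * \prod_(p <- ps) p)%N].
Proof.
elim/ltn_ind: n => n IH n0; have [n1|n1] := leqP n 1.
  by exists 1%N, [::]; split => //; rewrite big_nil; lia.
set p := pdiv n; have p_pr : prime p by exact: pdiv_prime.
have p1 := prime_gt1 p_pr; have pn : (p %| n)%N by exact: pdiv_dvd.
have [/dvdnP[m nE]|p2n] := boolP (p ^ 2 %| n)%N.
  have m0 : (0 < m)%N by move: n0; rewrite nE muln_gt0 => /andP[].
  have mn : (m < n)%N by rewrite nE ltn_Pmulr // -{1}(expn0 p) ltn_exp2l.
  have [s [ps [s0 ps_uniq ps_pr mE]]] := IH m mn m0.
  exists (s * p)%N, ps; split => //; first by rewrite muln_gt0 s0 ltnW.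
  by rewrite nE {1}mE expnMn; ring.
have /dvdnP[m nE] := pn.
have m0 : (0 < m)%N by move: n0; rewrite nE muln_gt0 => /andP[].
have mn : (m < n)%N by rewrite nE ltn_Pmulr.
have [s [ps [s0 ps_uniq ps_pr mE]]] := IH m mn m0.
exists s, (p :: ps); split => //=; last by rewrite big_cons nE {1}mE; ring.
  rewrite ps_uniq andbT; apply: contra p2n => pps.
  by rewrite nE -mulnn dvdn_pmul2r ?(ltnW p1) // mE dvdn_mull // (big_rem p) //= dvdn_mulr.
by rewrite p_pr.
Qed.

Lemma chi4_prod (s : seq nat) : chi4 (\prod_(p <- s) p) = \prod_(p <- s) chi4 p.
Proof. by rewrite (big_morph chi4 chi4M (erefl : chi4 1 = 1)). Qed.

Lemma chi8_prod (s : seq nat) : chi8 (\prod_(p <- s) p) = \prod_(p <- s) chi8 p.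
Proof. by rewrite (big_morph chi8 chi8M (erefl : chi8 1 = 1)). Qed.

Lemma legendreN1_chi4 p : prime p -> odd p -> legendre p (-1) = chi4 p.
Proof.
move=> p_pr p_odd; rewrite legendreN1 // /chi4.
have pE : p = ((p.-1)./2).*2.+1.
  have := prime_gt0 p_pr; case: (p) p_odd => //= n /negbTE n_even _.
  by rewrite -{1}(odd_double_half n) n_even.
move: ((p.-1)./2) pE => h ->; rewrite -(odd_double_half h) -signr_odd.
case: (odd h) => /=; rewrite ?add1n ?add0n -!muln2.
  have -> : ((1 + h./2 * 2) * 2).+1 = (h./2 * 4 + 3)%N by ring.
  by rewrite modnMDl oddM andbF.
have -> : ((h./2 * 2) * 2).+1 = (h./2 * 4 + 1)%N by ring.
by rewrite modnMDl oddM andbF.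
Qed.

Lemma legendre2_chi8 p : prime p -> odd p -> legendre p 2 = chi8 p.
Proof.
move=> p_pr p_odd; rewrite legendre2 // /chi8; case: ifP => // h; case: ifP => // h'.
have : odd (p %% 8) by rewrite odd_mod.
have := ltn_pmod p (isT : (0 < 8)%N); move: h h'.
by case: (p %% 8)%N => [|[|[|[|[|[|[|[|]]]]]]]].
Qed.

Lemma legendre_swap p q : prime p -> odd p -> prime q -> (q %% 4 = 1)%N -> p != q ->
  legendre q p%:Z = legendre p q%:Z.
Proof.
move=> p_pr p_odd q_pr q4 pq.
have q_odd : odd q by rewrite (divn_eq q 4) q4 oddD oddM andbF.
rewrite -(quadratic_reciprocity p_pr p_odd q_pr q_odd pq) legendreM //.
have : legendre q (legendre p (-1)) = 1.
  have : legendre p (-1) != 0 by rewrite legendre_eq0 //= dvdn1 gtn_eqF // prime_gt1.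
  case: (legendre_values p (-1)) => -> // _; first exact: legendre1.
  by rewrite legendreN1_chi4 // /chi4 q4.
by move=> ->; rewrite mul1r.
Qed.

Lemma legendre3 p : prime p -> odd p -> p != 3%N -> legendre p (-3) = legendre 3 p%:Z.
Proof.
move=> p_pr p_odd p3; rewrite -(@quadratic_reciprocity 3 p) // 1?eq_sym //.
Qed.

Lemma prime_mul_nsq (q m : nat) : prime q -> coprime q m -> forall k, (k ^ 2)%N <> (q * m)%N.
Proof.
move=> q_pr qm k kE.
have m0 : (0 < m)%N by case: m qm {kE} => //; rewrite /coprime gcdn0 gtn_eqF // prime_gt1.
have : logn q (k ^ 2) = 1%N.
  by rewrite kE lognM ?(prime_gt0 q_pr) // logn_prime // eqxx (@logn_coprime q m).
by rewrite lognX; lia.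
Qed.

Lemma legendre_root (p : nat) (a : int) : prime p -> odd p -> legendre p a = 1 ->
  exists x : nat, (p%:Z %| x%:Z ^+ 2 - a)%Z.
Proof.
move=> p_pr p_odd /(legendre_square p_pr p_odd)[x hx].
by exists x; rewrite dvdzE.
Qed.

Lemma legendre_sq1 p a : legendre p a = 1 \/ legendre p a = -1 ->
  legendre p a * legendre p a = 1.
Proof. by case=> ->. Qed.

Lemma legendre_unit p a : prime p -> ~~ (p %| `|a|)%N ->
  legendre p a = 1 \/ legendre p a = -1.
Proof.
by move=> p_pr; rewrite -legendre_eq0 //; case: (legendre_values p a) => ->; [|left|right].
Qed.

(** The conic is k q x^2 + y^2 = n t^2 with (q/p) = (-k/p) for p | n, which makes - k q a square
    modulo n. By reciprocity (n/q) is the product of the (-k/p), that is [chi4 n] if k = 1 and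
    [chi4 n * chi8 n] if k = 2; the congruence on n makes it 1. Finally k q = c^2 + d^2. *)
Lemma three_squares_rational (ps : seq nat) (k : nat) :
  uniq ps -> all prime ps -> all odd ps ->
  k = 1%N /\ (\prod_(p <- ps) p %% 4 = 1)%N \/ k = 2%N /\ (\prod_(p <- ps) p %% 8 = 3)%N ->
  exists x y z t : int, t != 0 /\
    x ^+ 2 + y ^+ 2 + z ^+ 2 = (\prod_(p <- ps) p)%N%:Z * t ^+ 2.
Proof.
set n := (\prod_(p <- ps) p)%N => ps_uniq ps_pr ps_odd kn.
have k12 : k = 1%N \/ k = 2%N by case: kn => [[]|[]]; [left|right].
have pk p : p \in ps -> ~~ (p %| `|- k%:Z|)%N.
  move=> pps; have p_pr := allP ps_pr _ pps; have p_odd := allP ps_odd _ pps.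
  rewrite abszN absz_nat; apply/negP => /dvdn_leq.
  by case: k12 => -> /(_ isT); move: p_pr p_odd; case: (p) => [|[|[|]]].
have [q [q_pr q8 leg_q]] : exists q, [/\ prime q, (q %% 8 = 5)%N &
    forall p, p \in ps -> legendre p q%:Z = legendre p (- k%:Z)].
  apply: prime_with_legendre => //.
    by apply/allP => p pps; rewrite (allP ps_pr) ?(allP ps_odd).
  by move=> p pps; apply: legendre_unit; [exact: (allP ps_pr) | exact: pk].
have q4 : (q %% 4 = 1)%N by rewrite -(modn_dvdm q (isT : (4 %| 8)%N)) q8.
have q_odd : odd q by rewrite (divn_eq q 4) q4 oddD oddM andbF.
have leg_sq p : p \in ps -> legendre p q%:Z * legendre p (- k%:Z) = 1.
  move=> pps; rewrite leg_q //; apply/legendre_sq1/legendre_unit; last exact: pk.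
  exact: (allP ps_pr).
have q_ps p : p \in ps -> p != q.
  move=> pps; apply/eqP => pq; have := leg_sq _ pps.
  have p_pr := allP ps_pr _ pps.
  have -> : legendre p q%:Z = 0 by apply/eqP; rewrite legendre_eq0 //= pq.
  by rewrite mul0r.
have cop_q : coprime q n.
  rewrite coprime_sym coprime_prodl; apply/allP => p pps.
  have p_pr := allP ps_pr _ pps.
  by rewrite prime_coprime // dvdn_prime2 // q_ps.
have n_odd : odd n.
  by case: kn => [[_ h]|[_ h]]; [rewrite (divn_eq n 4) | rewrite (divn_eq n 8)]; rewrite h oddD oddM andbF.
have n0 : (0 < n)%N by case: (n) n_odd.
have leg_n : legendre q n%:Z = 1.
  rewrite /n (big_morph Posz PoszM (erefl _)) legendre_prod // big_seq.
  rewrite (eq_bigr (fun p => chi4 p * (if k == 1%N then 1 else chi8 p))); last first.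
    move=> p pps; have p_pr := allP ps_pr _ pps; have p_odd := allP ps_odd _ pps.
    rewrite legendre_swap ?q_ps // leg_q //.
    case: k12 => -> /=; first by rewrite mulr1 legendreN1_chi4.
    by rewrite -[- 2%:Z]mulN1r legendreM // legendreN1_chi4 // legendre2_chi8.
  rewrite -big_seq big_split /= -chi4_prod -/n.
  case: kn => [[-> h]|[-> h]] /=; first by rewrite big1 // mulr1 /chi4 h.
  rewrite -chi8_prod -/n /chi8 /chi4 h.
  by rewrite -(modn_dvdm n (isT : (4 %| 8)%N)) h.
have [x [y [t [t0 conic]]]] : exists x y t : int,
    t != 0 /\ (k * q)%:Z * x ^+ 2 + 1%:Z * y ^+ 2 = n%:Z * t ^+ 2.
  have kq0 : (0 < k * q)%N by rewrite muln_gt0 (prime_gt0 q_pr) andbT; case: k12 => ->.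
  have [r hr] : exists r : nat, ((k * q)%:Z %| r%:Z ^+ 2 - n%:Z)%Z.
    have [r hr] := legendre_root q_pr q_odd leg_n.
    case: k12 => ->; first by exists r; rewrite mul1n.
    have [|||r' hr'] := @sqrt_mod_squarefree [:: 2; q] n%:Z.
    - by rewrite /= inE andbT; case: (q) q_odd => [|[|[|]]].
    - by rewrite /= q_pr.
    - move=> p; rewrite !inE => /orP[] /eqP ->; last by exists r.
      (* Modulo 2, n is its own square. *)
      by exists n; rewrite expr2 -[X in _ - X]mulr1 -mulrBr dvdzE abszM /= Euclid_dvdM //; lia.
    by exists r'; move: hr'; rewrite !big_cons big_nil muln1.
  have [t ht] : exists t : nat, (n%:Z %| t%:Z ^+ 2 - - (k * q)%:Z)%Z.
    apply: sqrt_mod_squarefree => // p pps.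
    apply: legendre_root; [exact: (allP ps_pr) | exact: (allP ps_odd) |].
    by rewrite PoszM -mulNr mulrC legendreM ?leg_sq //; [exact: (allP ps_pr) | exact: (allP ps_odd)].
  have cop2 : coprime 2 n by rewrite coprime2n.
  have copk : coprime (k * q) n by rewrite coprimeMl cop_q andbT; case: k12 => ->; [exact: coprime1n | exact: cop2].
  have nsq m : coprime q m -> coprime q k -> forall j, (j ^ 2)%N <> (k * q * m)%N.
    by move=> qm qk j; rewrite [(k * q)%N]mulnC -mulnA; apply: prime_mul_nsq; rewrite // coprimeMr qk.
  have qk : coprime q k by case: k12 => ->; rewrite ?coprimen1 // coprimen2.
  apply: (legendre_conic (r := r%:Z) (s := 0) (t := t%:Z)) => //.
  - exact: coprimen1.
  - exact: coprime1n.
  - by rewrite mul1r.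
  - by rewrite mulr1 -[X in _ + X]opprK.
  - by move=> j; apply: nsq; rewrite ?coprimen1.
  by move=> j; apply: nsq.
have [a [b ab]] := two_squares q_pr q4.
have [c [d cd]] : exists c d : int, c ^+ 2 + d ^+ 2 = (k * q)%:Z.
  case: k12 => ->; first by exists a, b; rewrite mul1n.
  by exists (a + b), (a - b); rewrite PoszM -ab; ring.
exists (c * x), (d * x), y, t; split => //.
by rewrite -conic -cd; ring.
Qed.

(** * Integral representations *)

Lemma odd_sqr_mod8 s : odd s -> (s ^ 2 %% 8 = 1)%N.
Proof.
move=> s_odd; rewrite -modnXm.
have : odd (s %% 8) by rewrite odd_mod.
have := ltn_pmod s (isT : (0 < 8)%N).
by case: (s %% 8)%N => [|[|[|[|[|[|[|[|]]]]]]]].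
Qed.

Lemma all_odd_prod (ps : seq nat) : odd (\prod_(p <- ps) p) -> all odd ps.
Proof.
by elim: ps => [|p ps IH] //=; rewrite big_cons oddM => /andP[-> /IH].
Qed.

Theorem three_squares (n : nat) : (n %% 8 = 1)%N \/ (n %% 8 = 3)%N ->
  exists x y z : int, x ^+ 2 + y ^+ 2 + z ^+ 2 = n%:Z.
Proof.
move=> n8; have n_odd : odd n by rewrite (divn_eq n 8); case: n8 => ->; rewrite oddD oddM andbF.
have n0 : (0 < n)%N by case: (n) n_odd.
have [s [ps [s0 ps_uniq ps_pr nE]]] := squarefree_decomposition n0.
have /andP[s_odd m_odd] : odd s && odd (\prod_(p <- ps) p).
  by move: n_odd; rewrite nE oddM oddX.
have m8 : (\prod_(p <- ps) p %% 8 = n %% 8)%N.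
  by rewrite nE -modnMml odd_sqr_mod8 // mul1n.
have [k hk] : exists k, k = 1%N /\ (\prod_(p <- ps) p %% 4 = 1)%N \/
    k = 2%N /\ (\prod_(p <- ps) p %% 8 = 3)%N.
  case: n8 => h; [exists 1%N; left | exists 2%N; right]; rewrite ?m8 //.
  by rewrite -(modn_dvdm _ (isT : (4 %| 8)%N)) m8 h.
have [x [y [z [t [t0 xyz]]]]] :=
  three_squares_rational ps_uniq ps_pr (all_odd_prod m_odd) hk.
have [||x' [y' [z' h]]] := @davenport_cassels 0 n%:Z `|t|%N (s%:Z * x) (s%:Z * y) (s%:Z * z) isT.
- by rewrite absz_gt0.
- rewrite abszE real_normK ?num_real // /tform.
  transitivity (s%:Z ^+ 2 * (x ^+ 2 + y ^+ 2 + z ^+ 2)); first by ring.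
  by rewrite xyz {1}nE !PoszM; ring.
by exists x', y', z'; rewrite -h /tform; ring.
Qed.

Lemma legendre_neq (q p : nat) : prime p -> legendre p q%:Z != 0 -> p != q.
Proof. by move=> p_pr; rewrite legendre_eq0 //=; apply: contra => /eqP ->. Qed.

(* Both conics q x^2 + 3 y^2 = n t^2 and 3 q x^2 + y^2 = n t^2 impose on q the symbols
   (q/p) = (-3/p) for p | n; then (n/q) = (n/3) by reciprocity, including p = 2. *)
Lemma form113_prime (ps : seq nat) (e : int) :
  uniq ps -> all prime ps -> 3%N \notin ps -> e = 1 \/ e = -1 ->
  exists q, [/\ prime q, (q %% 8 = 5)%N, coprime q (3 * \prod_(p <- ps) p),
    legendre 3 q%:Z = e /\
    (exists t : nat, ((\prod_(p <- ps) p)%:Z %| t%:Z ^+ 2 - - (q%:Z * 3))%Z) &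
    legendre q (\prod_(p <- ps) p)%N%:Z = legendre 3 (\prod_(p <- ps) p)%N%:Z].
Proof.
move=> ps_uniq ps_pr ps3 eP.
pose l := [seq p <- ps | odd p].
have lP p : p \in l -> [/\ p \in ps, odd p, prime p & p != 3%N].
  rewrite mem_filter => /andP[p_odd pps]; split => //; first exact: (allP ps_pr).
  by apply: contraNneq ps3 => <-.
have unit3 p : p \in l -> legendre p (-3) = 1 \/ legendre p (-3) = -1.
  move=> /lP[_ p_odd p_pr p3]; apply: legendre_unit => //.
  by rewrite abszN /= dvdn_prime2.
have [q [q_pr q8 leg_q]] : exists q, [/\ prime q, (q %% 8 = 5)%N &
    forall p, p \in 3%N :: l -> legendre p q%:Z = if p == 3%N then e else legendre p (-3)].
  apply: prime_with_legendre => //.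
  - by rewrite /= filter_uniq // mem_filter (negbTE ps3).
  - by apply/allP => p; rewrite inE => /orP[/eqP -> //|/lP[_ -> ->]].
  move=> p; rewrite inE => /orP[/eqP -> //|pl].
  by have [_ _ _ /negbTE ->] := lP p pl; exact: unit3.
have q4 : (q %% 4 = 1)%N by rewrite -(modn_dvdm q (isT : (4 %| 8)%N)) q8.
have q_odd : odd q by rewrite (divn_eq q 4) q4 oddD oddM andbF.
have leg3 : legendre 3 q%:Z = e by rewrite leg_q ?mem_head.
have legl p : p \in l -> legendre p q%:Z = legendre p (-3).
  by move=> pl; have [_ _ _ /negbTE p3] := lP p pl; rewrite leg_q ?inE ?pl ?orbT // p3.
have q3 : q != 3%N by rewrite eq_sym; apply: legendre_neq => //; rewrite leg3; case: eP => ->.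
have ql p : p \in l -> p != q.
  move=> pl; have [_ _ p_pr _] := lP p pl; apply: legendre_neq => //.
  by rewrite legl //; case: (unit3 _ pl) => ->.
have ps_cases p : p \in ps -> p = 2%N \/ p \in l.
  move=> pps; have [po|pe] := boolP (odd p); first by right; rewrite mem_filter po.
  by left; case: (even_prime (allP ps_pr _ pps)) => // h; rewrite h in pe.
exists q; split => //.
- rewrite coprime_sym coprimeMl prime_coprime // dvdn_prime2 // eq_sym q3 /=.
  rewrite coprime_prodl; apply/allP => p pps.
  case: (ps_cases _ pps) => [->|pl]; first by rewrite coprime2n.
  by have [_ _ p_pr _] := lP p pl; rewrite prime_coprime // dvdn_prime2 // ql.
- split => //; apply: sqrt_mod_squarefree => // p /ps_cases[->|pl].
    exists 1%N; rewrite opprK dvdzE (_ : _ + _ = (1 + q * 3)%N%:Z); last by rewrite PoszD PoszM.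
    by rewrite dvdn2 oddD oddM q_odd.
  have [_ p_odd p_pr _] := lP p pl; apply: legendre_root => //.
  by rewrite -mulrN legendreM // legl //; apply: legendre_sq1; exact: unit3.
rewrite !(big_morph Posz PoszM (erefl _)) !legendre_prod // big_seq [RHS]big_seq.
(* At p = 2 both symbols are -1: this is why q is taken 5 modulo 8. *)
apply: eq_bigr => p /ps_cases[->|pl]; first by rewrite !legendre2_chi8 // /chi8 q8.
have [_ p_odd p_pr p3] := lP p pl.
by rewrite legendre_swap ?ql // legl // legendre3.
Qed.

(** For c = 1 take q x^2 + 3 y^2 = n t^2: the choice (q/3) = (n/3) makes q n a square modulo 3, and
    3 n one modulo q. For c = 3 take 3 q x^2 + y^2 = n t^2, where n = 1 mod 3 is a square modulo 3
    q, and multiply by 3. *)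
Lemma form113_rational (ps : seq nat) (c : nat) :
  uniq ps -> all prime ps -> 3%N \notin ps ->
  c = 1%N \/ c = 3%N /\ (\prod_(p <- ps) p %% 3 = 1)%N ->
  exists x y z t : int, t != 0 /\
    x ^+ 2 + y ^+ 2 + 3 * z ^+ 2 = (c * \prod_(p <- ps) p)%N%:Z * t ^+ 2.
Proof.
move=> ps_uniq ps_pr ps3 hc; set n := (\prod_(p <- ps) p)%N in hc *.
have n3 : ~~ (3 %| n)%N.
  rewrite -prime_coprime // coprime_sym coprime_prodl; apply/allP => p pps.
  rewrite prime_coprime ?(allP ps_pr _ pps) // dvdn_prime2 ?(allP ps_pr _ pps) //.
  by apply: contraNneq ps3 => <-.
have n0 : (0 < n)%N by case: (n) n3.
have [q [q_pr q8 q_cop [leg3 [t ht]] leg_n]] :=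
  form113_prime ps_uniq ps_pr ps3 (legendre_unit (a := n%:Z) (isT : prime 3) n3).
rewrite -/n in q_cop leg3 ht leg_n.
have q4 : (q %% 4 = 1)%N by rewrite -(modn_dvdm q (isT : (4 %| 8)%N)) q8.
have q_odd : odd q by rewrite (divn_eq q 4) q4 oddD oddM andbF.
have [q3 qn] : coprime q 3 /\ coprime q n by move: q_cop; rewrite coprimeMr => /andP[].
have n_unit : legendre 3 n%:Z = 1 \/ legendre 3 n%:Z = -1 by exact: legendre_unit.
have leg_q3 : legendre q 3 = legendre 3 n%:Z.
  have q_neq3 : 3%N != q by apply: contraTneq q3 => <-.
  by rewrite (legendre_swap (p := 3)).
have cop3n : coprime 3 n by rewrite prime_coprime.
have [a [b ab]] := two_squares q_pr q4.
have q_gt0 := prime_gt0 q_pr.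
case: hc => [->|[-> n31]].
  have [r hr] : exists r : nat, (q%:Z %| r%:Z ^+ 2 - 3%N%:Z * n%:Z)%Z.
    by apply: legendre_root => //; rewrite legendreM // leg_q3 leg_n; exact: legendre_sq1.
  have [s hs] : exists s : nat, (3%N%:Z %| s%:Z ^+ 2 - q%:Z * n%:Z)%Z.
    by apply: legendre_root => //; rewrite legendreM // leg3; exact: legendre_sq1.
  have [|||x [y [z [z0 xyz]]]] := @legendre_conic q 3 n r s t q_gt0 isT n0 q3 qn cop3n hr hs.
  - by rewrite -[X in _ + X]opprK.
  - exact: prime_mul_nsq.
  - exact: prime_mul_nsq.
  exists (a * x), (b * x), y, z; split => //.
  by rewrite mul1n -xyz -ab; ring.
have leg_n1 : legendre 3 n%:Z = 1.
  rewrite (@legendre_modn 3 n 1) ?n31 //; exact: legendre1.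
have [|||r hr] := @sqrt_mod_squarefree [:: 3; q] n%:Z.
- by rewrite /= inE andbT; apply: contraTneq q3 => <-; rewrite /coprime gcdnn.
- by rewrite /= q_pr.
- by move=> p; rewrite !inE => /orP[] /eqP ->; apply: legendre_root => //; rewrite leg_n.
rewrite !big_cons big_nil muln1 in hr.
have q31 : coprime q (3 * 1) by rewrite muln1.
have q3n : coprime q (3 * n) by rewrite coprimeMr q3.
have q3_gt0 : (0 < 3 * q)%N by rewrite muln_gt0.
have cop3qn : coprime (3 * q) n by rewrite coprimeMl cop3n.
have [|||||x [y [z [z0 xyz]]]] :=
  @legendre_conic (3 * q) 1 n r 0 t q3_gt0 isT n0 (coprimen1 _) cop3qn (coprime1n _).
- by rewrite mul1r.
- by rewrite dvd1z.
- by move: ht; rewrite opprK mulr1 PoszM mulrC.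
- by move=> k; rewrite [(3 * q)%N]mulnC -mulnA; apply: prime_mul_nsq.
- by move=> k; rewrite [(3 * q)%N]mulnC -mulnA; apply: prime_mul_nsq.
exists (3 * a * x), (3 * b * x), y, z; split => //.
transitivity (3 * ((3 * q)%:Z * x ^+ 2 + 1%:Z * y ^+ 2)).
  by rewrite PoszM -ab; ring.
by rewrite xyz PoszM; ring.
Qed.

(** One of u, v, u + v is even: every Eisenstein integer has a unit multiple in Z[sqrt(-3)]. *)
Lemma hexagonal_form (u v : int) : exists y z : int, u ^+ 2 + u * v + v ^+ 2 = y ^+ 2 + 3 * z ^+ 2.
Proof.
have par (x : int) : exists k : int, x = 2 * k \/ x = 2 * k + 1.
  exists (x %/ 2)%Z; have := divz_eq x 2; have := modz_ge0 x (isT : (2 : int) != 0).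
  have := ltz_pmod x (isT : 0 < (2 : int)); lia.
have [k [->|uE]] := par u; first by exists (v + k), k; ring.
have [m [->|->]] := par v; first by exists (u + m), m; ring.
by exists (k - m), (k + m + 1); rewrite uE; ring.
Qed.

Theorem form113 (n : nat) : (n %% 3 != 0)%N \/ (n %% 9 = 3)%N ->
  exists x y z : int, x ^+ 2 + y ^+ 2 + 3 * z ^+ 2 = n%:Z.
Proof.
move=> hn.
have [c [m [nE m3 hc]]] : exists c m, [/\ n = (c * m)%N, ~~ (3 %| m)%N &
    c = 1%N \/ c = 3%N /\ (m %% 3 = 1)%N].
  case: hn => h; first by exists 1%N, n; rewrite mul1n; split => //; left.
  exists 3%N, (n %/ 9 * 3 + 1)%N; split.
  - by rewrite {1}(divn_eq n 9) h; ring.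
  - by rewrite /dvdn modnMDl.
  by right; rewrite modnMDl.
have m0 : (0 < m)%N by case: (m) m3.
have [s [ps [s0 ps_uniq ps_pr mE]]] := squarefree_decomposition m0.
have ps3 : 3%N \notin ps.
  by apply: contra m3 => p3; rewrite mE dvdn_mull // (big_rem 3%N) //= dvdn_mulr.
have s3 : ~~ (3 %| s)%N by apply: contra m3 => s3; rewrite mE dvdn_mulr // dvdn_mulr.
have [|x [y [z [t [t0 xyz]]]]] := @form113_rational ps c ps_uniq ps_pr ps3.
  case: hc => [|[-> h]]; [by left | right; split => //].
  move: h; rewrite mE -modnMml.
  suff -> : (s ^ 2 %% 3 = 1)%N by rewrite mul1n.
  move: s3; rewrite -modnXm /dvdn; have := ltn_pmod s (isT : (0 < 3)%N).
  by case: (s %% 3)%N => [|[|[|]]].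
(* In the larger lattice y^2 + 3 z^2 is u^2 + u v + v^2 with u = y - z and v = 2 z. *)
have [||x' [u [v h]]] := @davenport_cassels 1 n%:Z `|t|%N (s%:Z * x)
    (s%:Z * (y - z)) (s%:Z * (2 * z)) isT.
- by rewrite absz_gt0.
- rewrite abszE real_normK ?num_real // /tform.
  transitivity (s%:Z ^+ 2 * (x ^+ 2 + y ^+ 2 + 3 * z ^+ 2)); first by ring.
  by rewrite xyz {1}nE {1}mE !PoszM; ring.
have [y' [z' h']] := hexagonal_form u v.
by exists x', y', z'; rewrite -h /tform -addrA -h'; ring.
Qed.

(** * The form x^2 + 16 y^2 + 16 z^2 *)

Lemma sqr_mod8 (x : int) :
  [\/ exists k j, x = 2 * k + 1 /\ x ^+ 2 = 8 * j + 1,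
      exists k, x = 4 * k | exists k, x = 4 * k + 2].
Proof.
have := divz_eq x 4; have := modz_ge0 x (isT : (4 : int) != 0).
have := ltz_pmod x (isT : 0 < (4 : int)); move: (x %/ 4)%Z (x %% 4)%Z => q r r4 r0 xE.
have : [\/ r = 0, r = 1, r = 2 | r = 3].
  by case: r r4 r0 {xE} => [[|[|[|[|r]]]]|r] // _ _; [constructor 1|constructor 2|constructor 3|constructor 4].
case=> rE; rewrite rE in xE.
- by constructor 2; exists q; lia.
- by constructor 1; exists (2 * q), (2 * q ^+ 2 + q); split; rewrite xE; ring.
- by constructor 3; exists q; lia.
by constructor 1; exists (2 * q + 1), (2 * q ^+ 2 + 3 * q + 1); split; rewrite xE; ring.
Qed.

(** Units are normalised to -1 to match the completed squares (3 x - 1)^2 and (6 x - 1)^2 of p_8 and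
    p_5. *)
Lemma sqr_mod3 (x : int) :
  (exists k, x = 3 * k) \/ (exists k, x = 3 * k - 1 \/ - x = 3 * k - 1).
Proof.
have := divz_eq x 3; have := modz_ge0 x (isT : (3 : int) != 0).
have := ltz_pmod x (isT : 0 < (3 : int)); move: (x %/ 3)%Z (x %% 3)%Z => q r r3 r0 xE.
case: r r3 r0 xE => [[|[|[|r]]]|r] // _ _ xE.
- by left; exists q; lia.
- by right; exists (- q); right; lia.
by right; exists (q + 1); left; lia.
Qed.

Lemma sqr_mod5 (x : int) :
  [\/ exists k, x = 5 * k, exists k, x = 5 * k + 1 \/ - x = 5 * k + 1
    | exists k, x = 5 * k + 2 \/ - x = 5 * k + 2].
Proof.
have := divz_eq x 5; have := modz_ge0 x (isT : (5 : int) != 0).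
have := ltz_pmod x (isT : 0 < (5 : int)); move: (x %/ 5)%Z (x %% 5)%Z => q r r5 r0 xE.
case: r r5 r0 xE => [[|[|[|[|[|r]]]]]|r] // _ _ xE.
- by constructor 1; exists q; lia.
- by constructor 2; exists q; left; lia.
- by constructor 3; exists q; left; lia.
- by constructor 3; exists (- q - 1); right; lia.
by constructor 2; exists (- q - 1); right; lia.
Qed.

Lemma sqr_sign (x y : int) : x = y \/ - x = y -> x ^+ 2 = y ^+ 2.
Proof. by case=> <-; rewrite ?sqrrN. Qed.

(** Since (-1/p) = -1, it suffices that (n/p) = -1. With n = s^2 m and m = 1 mod 8, the signs from
    reciprocity multiply to [chi4 m] = 1, so (m/p) is the product of the prescribed (p/l); a single
    prime l0, present because n is not a square, is given the sign -1. *)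
Lemma prime_3mod4_splitting (n : nat) : (n %% 8 = 1)%N -> (forall k, (k ^ 2)%N <> n) ->
  exists (p : nat) (r : int), [/\ prime p, (p %% 8 = 3)%N, ~~ (p %| n)%N & (p%:Z %| r ^+ 2 + n%:Z)%Z].
Proof.
move=> n8 n_nsq; have n_odd : odd n by rewrite (divn_eq n 8) n8 oddD oddM andbF.
have n0 : (0 < n)%N by case: (n) n_odd.
have [s [ps [s0 ps_uniq ps_pr nE]]] := squarefree_decomposition n0.
have /andP[s_odd m_odd] : odd s && odd (\prod_(p <- ps) p).
  by move: n_odd; rewrite nE oddM oddX.
have m8 : (\prod_(p <- ps) p %% 8 = 1)%N.
  by move: n8; rewrite nE -modnMml odd_sqr_mod8 // mul1n.
have ps_odd := all_odd_prod m_odd.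
have [l0 [ps' psE]] : exists l0 ps', ps = l0 :: ps'.
  case: ps nE {ps_uniq ps_pr m_odd m8 ps_odd} => [|l0 ps'] nE; last by exists l0, ps'.
  by case: (n_nsq s); rewrite nE big_nil muln1.
pose e l : int := if l == l0 then -1 else 1.
(* The primes of s are listed to keep p from dividing s. *)
have [p [p_pr p8 leg_p]] : exists p, [/\ prime p, (p %% 8 = 3)%N &
    forall l, l \in undup (ps ++ primes s) -> legendre l p%:Z = e l].
  apply: prime_with_legendre; rewrite ?undup_uniq //.
    apply/allP => l; rewrite mem_undup mem_cat => /orP[lps|].
      by rewrite (allP ps_pr) ?(allP ps_odd).
    rewrite mem_primes => /and3P[-> _ /dvdnP[k sE]] /=.
    by move: s_odd; rewrite sE oddM => /andP[].
  by move=> l _; rewrite /e; case: eqP; [right | left].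
have p_odd : odd p by rewrite (divn_eq p 8) p8 oddD oddM andbF.
have pN l : l \in undup (ps ++ primes s) -> prime l -> l != p.
  by move=> ls l_pr; apply: legendre_neq => //; rewrite leg_p // /e; case: ifP.
have leg_ps l : l \in ps -> legendre p l%:Z = chi4 l * e l.
  move=> lps; have l_pr := allP ps_pr _ lps; have l_odd := allP ps_odd _ lps.
  have ls : l \in undup (ps ++ primes s) by rewrite mem_undup mem_cat lps.
  have := quadratic_reciprocity l_pr l_odd p_pr p_odd (pN l ls l_pr).
  rewrite leg_p // legendreM // legendreN1_chi4 // => <-.
  rewrite mulrA; suff -> : chi4 l * legendre p (chi4 l) = 1 by rewrite mul1r.
  have : odd (l %% 4) by rewrite odd_mod.
  have := ltn_pmod l (isT : (0 < 4)%N); rewrite /chi4.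
  case: (l %% 4)%N => [|[|[|[|]]]] // _ _; rewrite ?legendre1 //=.
  rewrite legendreN1_chi4 // /chi4 -(modn_dvdm p (isT : (4 %| 8)%N)) p8 //.
have leg_s : legendre p (s%:Z ^+ 2) = 1.
  rewrite legendre_sqr //=; suff -> : ~~ (p %| s)%N by [].
  apply/negP => ps_; have := pN p; rewrite mem_undup mem_cat mem_primes p_pr s0 ps_ orbT.
  by move=> /(_ isT isT); rewrite eqxx.
have leg_n : legendre p n%:Z = -1.
  have -> : n%:Z = s%:Z ^+ 2 * (\prod_(l <- ps) l)%N%:Z by rewrite {1}nE !PoszM; ring.
  rewrite legendreM // leg_s mul1r (big_morph Posz PoszM (erefl _)) legendre_prod //.
  rewrite big_seq (eq_bigr _ leg_ps) -big_seq big_split /= -chi4_prod.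
  have -> : chi4 (\prod_(l <- ps) l) = 1.
    by rewrite /chi4 -(modn_dvdm _ (isT : (4 %| 8)%N)) m8.
  rewrite mul1r psE big_cons /e eqxx big_seq big1 ?mulr1 // => l lps'.
  case: eqP => // ll0; move: ps_uniq; rewrite psE /= -ll0 lps'; done.
have [r hr] : exists r : nat, (p%:Z %| r%:Z ^+ 2 - - n%:Z)%Z.
  apply: legendre_root => //; rewrite -mulN1r legendreM // leg_n.
  by rewrite legendreN1_chi4 // /chi4 -(modn_dvdm p (isT : (4 %| 8)%N)) p8.
exists p, r; split => //; last by move: hr; rewrite opprK.
by rewrite -[X in (_ %| X)%N]absz_nat -legendre_eq0 // leg_n.
Qed.

(* Conjugation by a quaternion of norm p = 3 mod 8 multiplies w by +-3 modulo 8
   when a / 2 and b / 2 are odd. *)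
Lemma rotated_coordinate (P A B w w' s t u v : int) :
  s ^+ 2 + t ^+ 2 + u ^+ 2 + v ^+ 2 = 8 * P + 3 ->
  (8 * P + 3) * w' = (s ^+ 2 + t ^+ 2 - u ^+ 2 - v ^+ 2) * w +
    2 * (t * u + s * v) * (4 * A + 2) + 2 * (t * v - s * u) * (4 * B + 2) ->
  exists K : int, 3 * w' = w + 8 * K \/ 3 * w' = - w + 8 * K.
Proof.
move=> hp hw.
(* The four squares sum to 3 modulo 8, so three of s, t, u, v are odd and the square of the fourth
   is 0 modulo 8; this gives the sign. One of the pairs (s, t), (u, v) is then entirely odd, which
   makes the sum of the two products even. *)
suff [h [d [hE dE]]] : exists h d : int, (t * u + s * v) + (t * v - s * u) = 2 * h /\
   (s ^+ 2 + t ^+ 2 - u ^+ 2 - v ^+ 2 = 8 * d + 1 \/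
    s ^+ 2 + t ^+ 2 - u ^+ 2 - v ^+ 2 = 8 * d - 1).
  exists (d * w + (t * u + s * v) * A + (t * v - s * u) * B + h - P * w').
  have hw' : 3 * w' = (s ^+ 2 + t ^+ 2 - u ^+ 2 - v ^+ 2) * w - 8 * P * w' +
     8 * (t * u + s * v) * A + 8 * (t * v - s * u) * B +
     4 * ((t * u + s * v) + (t * v - s * u)).
    transitivity ((8 * P + 3) * w' - 8 * P * w'); first by ring.
    by rewrite hw; ring.
  by rewrite hw' hE; case: dE => ->; [left | right]; ring.
have split_even (x : int) : (exists k j : int, x = 2 * k + 1 /\ x ^+ 2 = 8 * j + 1) \/
    (exists k, x ^+ 2 = 8 * k) \/ (exists k, x ^+ 2 = 8 * k + 4).
  case: (sqr_mod8 x) => [h|[k ->]|[k ->]]; [by left | right; left | right; right].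
    by exists (2 * k ^+ 2); ring.
  by exists (2 * k ^+ 2 + 2 * k); ring.
case: (split_even s) => [[s1 [s2 [sE s2E]]]|[[s2 s2E]|[s2 s2E]]];
case: (split_even t) => [[t1 [t2 [tE t2E]]]|[[t2 t2E]|[t2 t2E]]];
case: (split_even u) => [[u1 [u2 [uE u2E]]]|[[u2 u2E]|[u2 u2E]]];
case: (split_even v) => [[v1 [v2 [vE v2E]]]|[[v2 v2E]|[v2 v2E]]];
rewrite s2E t2E u2E v2E in hp *; try (exfalso; lia).
- exists (v * (s1 + t1 + 1) + u * (t1 - s1)), (s2 + t2 - u2 - v2).
  by split; [rewrite sE tE; ring | left; ring].
- exists (v * (s1 + t1 + 1) + u * (t1 - s1)), (s2 + t2 - u2 - v2).
  by split; [rewrite sE tE; ring | left; ring].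
- exists (t * (u1 + v1 + 1) + s * (v1 - u1)), (s2 + t2 - u2 - v2).
  by split; [rewrite uE vE; ring | right; ring].
exists (t * (u1 + v1 + 1) + s * (v1 - u1)), (s2 + t2 - u2 - v2).
by split; [rewrite uE vE; ring | right; ring].
Qed.

(** Here w^2 = 9 modulo 16, so 16 divides a^2 + b^2, which forces a and b to be multiples of 4. *)
Lemma mod8_pm3 (N w a b k : int) : N = 16 * k + 9 -> w ^+ 2 + a ^+ 2 + b ^+ 2 = N ->
  (exists j : int, w = 8 * j - 3 \/ - w = 8 * j - 3) ->
  exists x y z : int, N = 16 * x ^+ 2 + 16 * y ^+ 2 + (8 * z - 3) ^+ 2.
Proof.
move=> NE wab [j /sqr_sign wE].
case: (sqr_mod8 a) => [[a1 [a2 [_ aE]]]|[a1 aE]|[a1 aE]];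
case: (sqr_mod8 b) => [[b1 [b2 [_ bE]]]|[b1 bE]|[b1 bE]];
  try (exfalso; rewrite ?aE ?bE wE NE in wab; lia).
by exists a1, b1, j; rewrite -wab wE aE bE; ring.
Qed.

Lemma odd_mod8 (w : int) (k : int) : w = 2 * k + 1 ->
  exists j : int, [\/ w = 8 * j - 3, - w = 8 * j - 3, w = 8 * j + 1 | - w = 8 * j + 1].
Proof.
move=> wE; have := divz_eq k 4; have := modz_ge0 k (isT : (4 : int) != 0).
have := ltz_pmod k (isT : 0 < (4 : int)); move: (k %/ 4)%Z (k %% 4)%Z => q r r4 r0 kE.
case: r r4 r0 kE => [[|[|[|[|r]]]]|r] // _ _ kE.
- by exists q; constructor 3; lia.
- by exists (- q); constructor 2; lia.
- by exists (q + 1); constructor 1; lia.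
by exists (- q - 1); constructor 4; lia.
Qed.

Lemma mod8_of_multiples4 (n w k a b : int) : w = 2 * k + 1 ->
  w ^+ 2 + (4 * a) ^+ 2 + (4 * b) ^+ 2 = 16 * n + 9 ->
  exists j : int, w = 8 * j - 3 \/ - w = 8 * j - 3.
Proof.
move=> /odd_mod8[j hj] wab; exists j.
case: hj => [|| hj | /eqP]; [by left | by right | exfalso; rewrite hj in wab; lia |].
by rewrite eqr_oppLR => /eqP hj; exfalso; rewrite hj in wab; lia.
Qed.

Lemma mod8_of_odd_doubles (n w k a b : int) : w = 2 * k + 1 ->
  w ^+ 2 + (4 * a + 2) ^+ 2 + (4 * b + 2) ^+ 2 = 16 * n + 9 ->
  exists j : int, w = 8 * j + 1 \/ - w = 8 * j + 1.
Proof.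
move=> /odd_mod8[j hj] wab; exists j.
case: hj => [hj | /eqP | |]; [exfalso; rewrite hj in wab; lia | | by left | by right].
by rewrite eqr_oppLR => /eqP hj; exfalso; rewrite hj in wab; lia.
Qed.

Lemma mod8_third (w w' j K : int) : w = 8 * j + 1 \/ - w = 8 * j + 1 ->
  3 * w' = w + 8 * K \/ 3 * w' = - w + 8 * K ->
  exists i : int, w' = 8 * i - 3 \/ - w' = 8 * i - 3.
Proof.
have e1 M : 3 * w' = 1 + 8 * M -> exists i : int, w' = 8 * i - 3 \/ - w' = 8 * i - 3.
  by move=> h; exists (w' - 3 * M); right; lia.
have eN1 M : 3 * w' = - 1 + 8 * M -> exists i : int, w' = 8 * i - 3 \/ - w' = 8 * i - 3.
  by move=> h; exists (3 * M - w'); left; lia.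
case=> hj; case=> hK.
- by apply: (e1 (j + K)); lia.
- by apply: (eN1 (K - j)); lia.
- by apply: (eN1 (K - j)); lia.
by apply: (e1 (j + K)); lia.
Qed.

Theorem form_1_16_16 (n : nat) : exists x y z : int,
  (16 * n + 9)%N%:Z = 16 * x ^+ 2 + 16 * y ^+ 2 + (8 * z - 3) ^+ 2.
Proof.
set N := (16 * n + 9)%N; have NE : N%:Z = 16 * n%:Z + 9 by [].
have finish w k (w_odd : w = 2 * k + 1) a b : w ^+ 2 + a ^+ 2 + b ^+ 2 = N%:Z ->
    (exists a1 b1, a = 4 * a1 /\ b = 4 * b1) ->
    exists x y z : int, N%:Z = 16 * x ^+ 2 + 16 * y ^+ 2 + (8 * z - 3) ^+ 2.
  move=> wab [a1 [b1 [aE bE]]]; apply: (mod8_pm3 NE wab).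
  by move: wab; rewrite aE bE NE; exact: (mod8_of_multiples4 w_odd).
(* For square N no prime p = 3 mod 8 outside N has -N as a square, but m^2 + 0^2 + 0^2 is already of
   the wanted kind. *)
have [/existsP[m /eqP mN]|N_nsq] := boolP [exists m : 'I_N.+1, (m ^ 2)%N == N].
  have mN' : m%:Z ^+ 2 + 0 ^+ 2 + 0 ^+ 2 = N%:Z.
    by rewrite -[in RHS]mN -mulnn PoszM; ring.
  case: (sqr_mod8 m%:Z) => [[k [j [mE _]]]|[k mE]|[k mE]].
  - by apply: (finish _ k mE 0 0 mN'); exists 0, 0; rewrite !mulr0.
  - by exfalso; move: mN'; rewrite mE NE; lia.
  by exfalso; move: mN'; rewrite mE NE; lia.
have {}N_nsq k : (k ^ 2)%N <> N.
  move=> kN; move/negP: N_nsq; apply; apply/existsP.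
  have kN1 : (k < N.+1)%N by rewrite ltnS -kN; case: (k) => // k'; rewrite -mulnn leq_pmulr.
  by exists (Ordinal kN1); rewrite /= kN.
have N8 : (N %% 8 = 1)%N by rewrite /N; lia.
have bad w k (w_odd : w = 2 * k + 1) a b : w ^+ 2 + a ^+ 2 + b ^+ 2 = N%:Z ->
    (exists a1 b1, a = 4 * a1 + 2 /\ b = 4 * b1 + 2) ->
    exists x y z : int, N%:Z = 16 * x ^+ 2 + 16 * y ^+ 2 + (8 * z - 3) ^+ 2.
  move=> wab [a1 [b1 [aE bE]]].
  have [p [r [p_pr p8 pN hr]]] := prime_3mod4_splitting N8 N_nsq.
  have p_odd : odd p by rewrite (divn_eq p 8) p8 oddD oddM andbF.
  have [|s [t [u [v [w' [a' [b' [hp wab' hw]]]]]]]] :=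
    rotate_three_squares p_pr p_odd wab hr; first by rewrite dvdzE.
  have pE : p%:Z = 8 * (p %/ 8)%N%:Z + 3 by rewrite {1}(divn_eq p 8) p8 PoszD PoszM mulrC.
  rewrite pE aE bE in hp hw.
  have [K hK] := rotated_coordinate hp hw.
  have [j hj] : exists j : int, w = 8 * j + 1 \/ - w = 8 * j + 1.
    by move: wab; rewrite aE bE NE; exact: (mod8_of_odd_doubles w_odd).
  by apply: (mod8_pm3 NE wab'); exact: mod8_third hj hK.
have [x [y [z xyz]]] := three_squares (or_introl N8).
have perm1 : y ^+ 2 + x ^+ 2 + z ^+ 2 = N%:Z by rewrite -xyz; ring.
have perm2 : z ^+ 2 + x ^+ 2 + y ^+ 2 = N%:Z by rewrite -xyz; ring.
case: (sqr_mod8 x) => [[x1 [x2 [xE x2E]]]|[x1 xE]|[x1 xE]];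
case: (sqr_mod8 y) => [[y1 [y2 [yE y2E]]]|[y1 yE]|[y1 yE]];
case: (sqr_mod8 z) => [[z1 [z2 [zE z2E]]]|[z1 zE]|[z1 zE]];
  try (by apply: (finish _ _ xE _ _ xyz); eexists; eexists; eauto);
  try (by apply: (finish _ _ yE _ _ perm1); eexists; eexists; eauto);
  try (by apply: (finish _ _ zE _ _ perm2); eexists; eexists; eauto);
  try (by apply: (bad _ _ xE _ _ xyz); eexists; eexists; eauto);
  try (by apply: (bad _ _ yE _ _ perm1); eexists; eexists; eauto);
  try (by apply: (bad _ _ zE _ _ perm2); eexists; eexists; eauto);
  exfalso; move: xyz; rewrite NE ?x2E ?y2E ?z2E ?xE ?yE ?zE; lia.
Qed.

(** * Polygonal numbers *)

(** For m >= 3, [polygonal_nat_ge] shows that the arguments 0, ..., n reach every value at most n,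
    so omission of n is a finite check. *)
Definition polygonal_values (m n : nat) : seq int :=
  [seq v <- [seq polygonal m x%:Z | x <- iota 0 n.+1] | v <= n%:Z].

Lemma polygonal_nat_ge (m x : nat) : (3 <= m)%N -> x%:Z <= polygonal m x%:Z.
Proof.
move=> m3; rewrite -(@ler_pM2r _ 2) // polygonal_double.
have [->|x0] := posnP x; first by rewrite expr0n /= !mulr0 subr0 mul0r.
have xx : x%:Z <= x%:Z ^+ 2 by nia.
have : 0 <= (m%:Z - 3) * (x%:Z ^+ 2 - x%:Z) by apply: mulr_ge0; lia.
lia.
Qed.

Lemma not_universal_N (i j k n : nat) : (3 <= i)%N -> (3 <= j)%N -> (3 <= k)%N ->
  all (fun a => all (fun b => all (fun c => a + b + c != n%:Z)
    (polygonal_values k n)) (polygonal_values j n)) (polygonal_values i n) ->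
  ~ universal_N i j k.
Proof.
move=> i3 j3 k3 h /(_ n)[x [y [z xyz]]].
have hx := polygonal_nat_ge x i3; have hy := polygonal_nat_ge y j3.
have hz := polygonal_nat_ge z k3.
have mem m w : w%:Z <= polygonal m w%:Z -> polygonal m w%:Z <= n%:Z ->
    polygonal m w%:Z \in polygonal_values m n.
  move=> h1 h2; rewrite mem_filter h2 andTb.
  apply: (map_f (fun x : nat => polygonal m x%:Z)).
  by rewrite mem_iota add0n leq0n /= ltnS -lez_nat (le_trans h1).
have := allP h _ (mem i x hx _) => /(_ ltac:(lia)).
move=> /allP/(_ _ (mem j y hy _)) => /(_ ltac:(lia)).
by move=> /allP/(_ _ (mem k z hz _)) => /(_ ltac:(lia)); rewrite xyz eqxx.
Qed.

(** * Completing the square *)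

Lemma polygonal_square (m : nat) (x : int) :
  (2 * (m%:Z - 2) * x - (m%:Z - 4)) ^+ 2 =
  8 * (m%:Z - 2) * polygonal m x + (m%:Z - 4) ^+ 2.
Proof.
have -> : 8 * (m%:Z - 2) * polygonal m x = 4 * (m%:Z - 2) * (polygonal m x * 2) by ring.
by rewrite polygonal_double; ring.
Qed.

Lemma triangular_square (x : int) : (2 * x + 1) ^+ 2 = 8 * polygonal 3 x + 1.
Proof. exact: (polygonal_square 3 x). Qed.

Lemma polygonal4 (x : int) : polygonal 4 x = x ^+ 2.
Proof.
apply: (@mulIf _ 2) => //; rewrite polygonal_double.
by rewrite (_ : 4%:Z - 2 = 2) // (_ : 4%:Z - 4 = 0) //; ring.
Qed.

Lemma pentagonal_square (x : int) : (6 * x - 1) ^+ 2 = 24 * polygonal 5 x + 1.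
Proof. exact: (polygonal_square 5 x). Qed.

Lemma heptagonal_square (x : int) : (10 * x - 3) ^+ 2 = 40 * polygonal 7 x + 9.
Proof. exact: (polygonal_square 7 x). Qed.

Lemma octagonal_square (x : int) : (3 * x - 1) ^+ 2 = 3 * polygonal 8 x + 1.
Proof.
have := polygonal_square 8 x; rewrite (_ : 8%:Z - 2 = 6) // (_ : 8%:Z - 4 = 4) //.
move=> h; apply: (@mulfI _ 16) => //.
by transitivity ((2 * 6 * x - 4) ^+ 2); [ring | rewrite h; ring].
Qed.

Lemma decagonal_square (x : int) : (8 * x - 3) ^+ 2 = 16 * polygonal 10 x + 9.
Proof.
have := polygonal_square 10 x; rewrite (_ : 10%:Z - 2 = 8) // (_ : 10%:Z - 4 = 6) //.
move=> h; apply: (@mulfI _ 4) => //.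
by transitivity ((2 * 8 * x - 6) ^+ 2); [ring | rewrite h; ring].
Qed.

(** Up to signs, a + b i is divisible by a Gaussian prime of norm 5: ((2 a + b) / 5)^2 + ((a - 2 b)
    / 5)^2 = (a^2 + b^2) / 5. *)
Lemma form115_of_residues (N a b c : int) :
  a ^+ 2 + b ^+ 2 + c ^+ 2 = 5 * N -> (exists k, c = 5 * k) ->
  (exists k, a = 5 * k + 2 \/ - a = 5 * k + 2) ->
  (exists k, b = 5 * k + 1 \/ - b = 5 * k + 1) ->
  exists u v w : int, 5 * u ^+ 2 + v ^+ 2 + w ^+ 2 = N.
Proof.
move=> abc [k1 cE] [k2 /sqr_sign aE] [k3 /sqr_sign bE].
exists k1, (2 * k2 + k3 + 1), (k2 - 2 * k3).
by apply: (@mulfI _ 5) => //; rewrite -abc aE bE cE; ring.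
Qed.

Lemma form115 (n : nat) : exists u v w : int,
  5 * u ^+ 2 + v ^+ 2 + w ^+ 2 = (40 * n + 23)%N%:Z.
Proof.
(* 5 (40 n + 23) is 3 modulo 8, and divisible by 5 but not by 25, so the three squares are 0, 1 and
   4 modulo 5 in some order. *)
have h8 : ((5 * (40 * n + 23)) %% 8 = 3)%N by lia.
have [a [b [c]]] := three_squares (or_intror h8).
rewrite PoszM => abc; have NE : (40 * n + 23)%N%:Z = 40 * n%:Z + 23 by [].
have sq5 (x : int) : [\/ exists k, x = 5 * k,
    (exists k, x = 5 * k + 1 \/ - x = 5 * k + 1) /\ (exists k, x ^+ 2 = 5 * k + 1) |
    (exists k, x = 5 * k + 2 \/ - x = 5 * k + 2) /\ (exists k, x ^+ 2 = 5 * k + 4)].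
  case: (sqr_mod5 x) => [h|[k h]|[k h]]; first by constructor 1.
    constructor 2; split; first by exists k.
    by exists (5 * k ^+ 2 + 2 * k); rewrite (sqr_sign h); ring.
  constructor 3; split; first by exists k.
  by exists (5 * k ^+ 2 + 4 * k); rewrite (sqr_sign h); ring.
case: (sq5 a) => [[a1 aE]|[ha [a1 aE]]|[ha [a1 aE]]];
case: (sq5 b) => [[b1 bE]|[hb [b1 bE]]|[hb [b1 bE]]];
case: (sq5 c) => [[c1 cE]|[hc [c1 cE]]|[hc [c1 cE]]];
  try (by exfalso; rewrite NE ?aE ?bE ?cE in abc; lia).
- by apply: (form115_of_residues (a := c) (b := b) (c := a)); rewrite -?abc //; [ring | exists a1].
- by apply: (form115_of_residues (a := b) (b := c) (c := a)); rewrite -?abc //; [ring | exists a1].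
- by apply: (form115_of_residues (a := c) (b := a) (c := b)); rewrite -?abc //; [ring | exists b1].
- by apply: (form115_of_residues (a := b) (b := a) (c := c)); rewrite -?abc //; [ring | exists c1].
- by apply: (form115_of_residues (a := a) (b := c) (c := b)); rewrite -?abc //; [ring | exists b1].
by apply: (form115_of_residues (a := a) (b := b) (c := c)) => //; exists c1.
Qed.

Lemma residue10 (v k : int) : v = 2 * k + 1 ->
  (exists j, v = 5 * j + 2 \/ - v = 5 * j + 2) ->
  exists y, v ^+ 2 = (10 * y - 3) ^+ 2.
Proof.
move=> vE [j hj]; have := divz_eq j 2; have := modz_ge0 j (isT : (2 : int) != 0).
have := ltz_pmod j (isT : 0 < (2 : int)); move: (j %/ 2)%Z (j %% 2)%Z => q r r2 r0 jE.
exists (q + 1); apply: sqr_sign; case: hj => hj; [left | right]; lia.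
Qed.

(** The target is 40 n + 23 = 5 (2 x + 1)^2 + (10 y - 3)^2 + (10 z - 3)^2: u, v, w are forced to be
    odd, and v, w to be +-2 modulo 5. *)
Theorem universal_3_7_7 : universal_Z 3 7 7.
Proof.
move=> n; have [u [v [w uvw]]] := form115 n.
have NE : (40 * n + 23)%N%:Z = 40 * n%:Z + 23 by [].
rewrite NE in uvw.
have [u1 uE] : exists k, u = 2 * k + 1.
  case: (sqr_mod8 u) => [[k [j [-> _]]]|[k uE]|[k uE]]; first by exists k.
  - case: (sqr_mod8 v) => [[k2 [j2 [_ vE]]]|[k2 vE]|[k2 vE]];
    case: (sqr_mod8 w) => [[k3 [j3 [_ wE]]]|[k3 wE]|[k3 wE]];
    by exfalso; rewrite uE ?vE ?wE in uvw; lia.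
  case: (sqr_mod8 v) => [[k2 [j2 [_ vE]]]|[k2 vE]|[k2 vE]];
  case: (sqr_mod8 w) => [[k3 [j3 [_ wE]]]|[k3 wE]|[k3 wE]];
  by exfalso; rewrite uE ?vE ?wE in uvw; lia.
have [j uu] : exists j, u ^+ 2 = 8 * j + 1.
  case: (sqr_mod8 u) => [[k [j [_ h]]]|[k h]|[k h]]; [by exists j | lia | lia].
have [[v1 vE] [w1 wE]] : (exists k, v = 2 * k + 1) /\ (exists k, w = 2 * k + 1).
  case: (sqr_mod8 v) => [[k2 [j2 [h2 vE]]]|[k2 vE]|[k2 vE]];
  case: (sqr_mod8 w) => [[k3 [j3 [h3 wE]]]|[k3 wE]|[k3 wE]];
  try (by exfalso; rewrite uu ?vE ?wE in uvw; lia).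
  by split; [exists k2 | exists k3].
have [hv hw] : (exists k, v = 5 * k + 2 \/ - v = 5 * k + 2) /\
    (exists k, w = 5 * k + 2 \/ - w = 5 * k + 2).
  case: (sqr_mod5 v) => [[k2 h2]|[k2 h2]|[k2 h2]];
  case: (sqr_mod5 w) => [[k3 h3]|[k3 h3]|[k3 h3]];
  try (by exfalso; move: uvw; rewrite ?(sqr_sign h2) ?(sqr_sign h3) ?h2 ?h3; lia).
  by split; [exists k2 | exists k3].
have [y hy] := residue10 vE hv; have [z hz] := residue10 wE hw.
exists u1, y, z; move: uvw; rewrite hy hz uE triangular_square !heptagonal_square.
by clear; lia.
Qed.

Lemma residue6 (v k : int) : v = 2 * k + 1 ->
  (exists j, v = 3 * j - 1 \/ - v = 3 * j - 1) ->
  exists y, v ^+ 2 = (6 * y - 1) ^+ 2.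
Proof.
move=> vE [j hj]; have := divz_eq j 2; have := modz_ge0 j (isT : (2 : int) != 0).
have := ltz_pmod j (isT : 0 < (2 : int)); move: (j %/ 2)%Z (j %% 2)%Z => q r r2 r0 jE.
exists q; apply: sqr_sign; case: hj => hj; [left | right]; lia.
Qed.

Lemma sqr_unit_mod3 (x y m : int) : x ^+ 2 + y ^+ 2 = 3 * m + 2 ->
  (exists j, x = 3 * j - 1 \/ - x = 3 * j - 1) /\
  (exists j, y = 3 * j - 1 \/ - y = 3 * j - 1).
Proof.
move=> xy; case: (sqr_mod3 x) => [[k h]|[k h]]; case: (sqr_mod3 y) => [[l h']|[l h']];
  try (by exfalso; move: xy; rewrite ?(sqr_sign h) ?(sqr_sign h') ?h ?h'; lia).
by split; [exists k | exists l].
Qed.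

(** The target is 24 n + 2 = 24 x^2 + (6 y - 1)^2 + (6 z - 1)^2, reached from 12 n + 1 = a^2 + b^2 +
    12 x^2 by passing to a + b and a - b. *)
Theorem universal_4_5_5 : universal_Z 4 5 5.
Proof.
move=> n; have n3 : ((12 * n + 1) %% 3 != 0)%N by lia.
have [a [b [w]]] := form113 (or_introl n3).
have -> : (12 * n + 1)%N%:Z = 12 * n%:Z + 1 by [].
move=> abw.
have [a' [b' [x [k [abx odd_ab]]]]] : exists a' b' x k : int,
    a' ^+ 2 + b' ^+ 2 + 12 * x ^+ 2 = 12 * n%:Z + 1 /\ a' + b' = 2 * k + 1.
  have oddsum (p q m : int) : p ^+ 2 + q ^+ 2 = 4 * m + 1 -> exists k, p + q = 2 * k + 1.
    move=> pq; case: (sqr_mod8 p) => [[k1 [j1 [h1 h1']]]|[k1 h1]|[k1 h1]];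
    case: (sqr_mod8 q) => [[k2 [j2 [h2 h2']]]|[k2 h2]|[k2 h2]];
    try (by exfalso; move: pq; rewrite ?h1' ?h2' ?h1 ?h2; lia).
    - by exists (k1 + 2 * k2); lia.
    - by exists (k1 + 2 * k2 + 1); lia.
    - by exists (2 * k1 + k2); lia.
    by exists (2 * k1 + k2 + 1); lia.
  case: (sqr_mod8 w) => [[w1 [w2 [wE w2E]]]|[w1 wE]|[w1 wE]]; last first.
  - have [|k hk] := oddsum a b (3 * n%:Z - 3 * (2 * w1 + 1) ^+ 2).
      by move: abw; rewrite wE; lia.
    by exists a, b, (2 * w1 + 1), k; split => //; move: abw; rewrite wE; lia.
  - have [|k hk] := oddsum a b (3 * n%:Z - 3 * (2 * w1) ^+ 2).
      by move: abw; rewrite wE; lia.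
    by exists a, b, (2 * w1), k; split => //; move: abw; rewrite wE; lia.
  have [a1 aE] : exists a1, a = 2 * a1 + 1.
    case: (sqr_mod8 a) => [[k1 [j1 [h1 h1']]]|[k1 h1]|[k1 h1]]; first by exists k1.
    - case: (sqr_mod8 b) => [[k2 [j2 [h2 h2']]]|[k2 h2]|[k2 h2]];
      by exfalso; rewrite w2E h1 ?h2' ?h2 in abw; lia.
    case: (sqr_mod8 b) => [[k2 [j2 [h2 h2']]]|[k2 h2]|[k2 h2]];
    by exfalso; rewrite w2E h1 ?h2' ?h2 in abw; lia.
  (* If w is odd, so is a, and c = w or - w satisfies a = c + 4 d. Then a^2 + 3 c^2 = (2 c + 2 d)^2
     + 12 d^2 supplies the coefficient 12. *)
  have [c [d [cE abc]]] : exists c d : int, a - c = 4 * d /\ a ^+ 2 + b ^+ 2 + 3 * c ^+ 2 = 12 * n%:Z + 1.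
    have := divz_eq (a1 - w1) 2; have := modz_ge0 (a1 - w1) (isT : (2 : int) != 0).
    have := ltz_pmod (a1 - w1) (isT : 0 < (2 : int)).
    move: ((a1 - w1) %/ 2)%Z ((a1 - w1) %% 2)%Z => q r r2 r0 qE.
    case: r r2 r0 qE => [[|[|r]]|r] // _ _ qE; first by exists w, q; split => //; lia.
    by exists (- w), (q + w1 + 1); split; [lia | rewrite sqrrN].
  have e1 : (2 * c + 2 * d) ^+ 2 + b ^+ 2 + 12 * d ^+ 2 = 12 * n%:Z + 1.
    have aE' : a = c + 4 * d by lia.
    by rewrite -abc aE'; ring.
  have [|k hk] := oddsum (2 * c + 2 * d) b (3 * n%:Z - 3 * d ^+ 2); first by lia.
  by exists (2 * c + 2 * d), b, d, k.
have uv : (a' + b') ^+ 2 + (a' - b') ^+ 2 + 24 * x ^+ 2 = 24 * n%:Z + 2.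
  transitivity (2 * (a' ^+ 2 + b' ^+ 2 + 12 * x ^+ 2)); first by ring.
  by rewrite abx; ring.
have [hu hv] : (exists j, a' + b' = 3 * j - 1 \/ - (a' + b') = 3 * j - 1) /\
    (exists j, a' - b' = 3 * j - 1 \/ - (a' - b') = 3 * j - 1).
  apply: (@sqr_unit_mod3 _ _ (8 * n%:Z - 8 * x ^+ 2)); apply: (@addIr _ (24 * x ^+ 2)).
  by rewrite uv; ring.
have odd_sub : a' - b' = 2 * (k - b') + 1.
  by transitivity (a' + b' - 2 * b'); [ring | rewrite odd_ab; ring].
have [y hy] := residue6 odd_ab hu; have [z hz] := residue6 odd_sub hv.
exists x, y, z; move: uv; rewrite hy hz !pentagonal_square polygonal4.
by clear; lia.
Qed.

(** The target 9 n + 3 = (3 x)^2 + (3 y)^2 + 3 (3 z - 1)^2 is forced, up to signs, by congruences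
    modulo 3 and 9. *)
Theorem universal_4_4_8 : universal_Z 4 4 8.
Proof.
move=> n; have n9 : ((9 * n + 3) %% 9 = 3)%N by lia.
have [a [b [w]]] := form113 (or_intror n9).
have -> : (9 * n + 3)%N%:Z = 9 * n%:Z + 3 by [].
move=> abw.
case: (sqr_mod3 a) => [[x aE]|[x /sqr_sign aE]];
case: (sqr_mod3 b) => [[y bE]|[y /sqr_sign bE]];
  try (by exfalso; rewrite aE bE in abw; lia).
case: (sqr_mod3 w) => [[z wE]|[z /sqr_sign wE]];
  first by exfalso; rewrite aE bE wE in abw; lia.
exists x, y, z; move: abw; rewrite aE bE wE octagonal_square !polygonal4.
by clear; lia.
Qed.

Theorem universal_4_8_8 : universal_Z 4 8 8.
Proof.
move=> n; have n3 : ((3 * n + 2) %% 3 != 0)%N by lia.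
have [a [b [x]]] := form113 (or_introl n3).
have -> : (3 * n + 2)%N%:Z = 3 * n%:Z + 2 by [].
move=> abx.
have [[y /sqr_sign aE] [z /sqr_sign bE]] : (exists j, a = 3 * j - 1 \/ - a = 3 * j - 1) /\
    (exists j, b = 3 * j - 1 \/ - b = 3 * j - 1).
  by apply: (@sqr_unit_mod3 _ _ (n%:Z - x ^+ 2)); lia.
exists x, y, z; move: abx; rewrite aE bE !octagonal_square polygonal4.
by clear; lia.
Qed.

Theorem universal_4_4_10 : universal_Z 4 4 10.
Proof.
move=> n; have [x [y [z]]] := form_1_16_16 n.
have -> : (16 * n + 9)%N%:Z = 16 * n%:Z + 9 by [].
by rewrite decagonal_square -!polygonal4 => h; exists x, y, z; lia.
Qed.

(** a^2 + b^2 is twice the sum of the squares of (a + b) / 2 and (a - b) / 2; these are odd, and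
    their squares sum to 2 modulo 3, so neither is divisible by 3. *)
Lemma sqr_sum_halves (a b k m : int) : a = 4 * k + 2 -> b = 4 * m ->
  (exists j, a ^+ 2 + b ^+ 2 = 3 * j + 1) ->
  exists y z, a ^+ 2 + b ^+ 2 = 2 * (6 * y - 1) ^+ 2 + 2 * (6 * z - 1) ^+ 2.
Proof.
move=> aE bE [j hj].
have [hu hv] : (exists j, 2 * k + 1 + 2 * m = 3 * j - 1 \/ - (2 * k + 1 + 2 * m) = 3 * j - 1) /\
    (exists j, 2 * k + 1 - 2 * m = 3 * j - 1 \/ - (2 * k + 1 - 2 * m) = 3 * j - 1).
  apply: (@sqr_unit_mod3 _ _ (2 * j - (8 * k ^+ 2 + 8 * k + 2 + 8 * m ^+ 2))).
  by rewrite aE bE in hj; lia.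
have [|y hy] := @residue6 _ (k + m) _ hu; first by ring.
have [|z hz] := @residue6 _ (k - m) _ hv; first by ring.
by exists y, z; rewrite -hy -hz aE bE; ring.
Qed.

(** The target is 48 n + 31 = 2 (6 y - 1)^2 + 2 (6 z - 1)^2 + 3 (8 j - 3)^2. As w is odd, one of a,
    b is 2 and the other 0 modulo 4; so a^2 + b^2 = 4 modulo 16, which forces w = +-3 modulo 8. *)
Theorem universal_5_5_10 : universal_Z 5 5 10.
Proof.
move=> n; have n3 : ((48 * n + 31) %% 3 != 0)%N by lia.
have [a [b [w]]] := form113 (or_introl n3).
have -> : (48 * n + 31)%N%:Z = 48 * n%:Z + 31 by [].
move=> abw.
have [k wE] : exists k, w = 2 * k + 1.
  case: (sqr_mod8 w) => [[k [j [-> _]]]|[k wE]|[k wE]]; first by exists k.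
  - case: (sqr_mod8 a) => [[k2 [j2 [_ aE]]]|[k2 aE]|[k2 aE]];
    case: (sqr_mod8 b) => [[k3 [j3 [_ bE]]]|[k3 bE]|[k3 bE]];
    by exfalso; rewrite wE ?aE ?bE in abw; lia.
  case: (sqr_mod8 a) => [[k2 [j2 [_ aE]]]|[k2 aE]|[k2 aE]];
  case: (sqr_mod8 b) => [[k3 [j3 [_ bE]]]|[k3 bE]|[k3 bE]];
  by exfalso; rewrite wE ?aE ?bE in abw; lia.
have [j hj] := odd_mod8 wE.
have [[y [z hyz]] [M abM]] : (exists y z,
    a ^+ 2 + b ^+ 2 = 2 * (6 * y - 1) ^+ 2 + 2 * (6 * z - 1) ^+ 2) /\
    (exists M, a ^+ 2 + b ^+ 2 = 16 * M + 4).
  have h3 : exists j, a ^+ 2 + b ^+ 2 = 3 * j + 1.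
    by exists (16 * n%:Z + 10 - w ^+ 2); lia.
  have [i wi] : exists i, w ^+ 2 = 8 * i + 1.
    case: (sqr_mod8 w) => [[? [i [_ h]]]|[i h]|[i h]]; [by exists i | lia | lia].
  case: (sqr_mod8 a) => [[k2 [j2 [_ aE]]]|[k2 aE]|[k2 aE]];
  case: (sqr_mod8 b) => [[k3 [j3 [_ bE]]]|[k3 bE]|[k3 bE]];
    try (by exfalso; rewrite wi ?aE ?bE in abw; lia).
  - split; last by exists (k2 ^+ 2 + k3 ^+ 2 + k3); rewrite aE bE; ring.
    by rewrite addrC; apply: sqr_sum_halves bE aE _; rewrite addrC.
  split; first exact: sqr_sum_halves aE bE h3.
  by exists (k2 ^+ 2 + k2 + k3 ^+ 2); rewrite aE bE; ring.
have wi : w ^+ 2 = (8 * j - 3) ^+ 2.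
  apply: sqr_sign; case: hj => hj; [by left | by right | exfalso | exfalso].
    by rewrite hj in abw; lia.
  have : (- w) ^+ 2 = (8 * j + 1) ^+ 2 by rewrite hj.
  by rewrite sqrrN => wE2; rewrite wE2 in abw; lia.
exists y, z, j; move: abw; rewrite hyz wi !pentagonal_square decagonal_square.
by clear; lia.
Qed.

Theorem theorem1p20 :
  (universal_Z 3 7 7 /\ ~ universal_N 3 7 7) /\
  (universal_Z 4 5 5 /\ ~ universal_N 4 5 5) /\
  (universal_Z 4 4 8 /\ ~ universal_N 4 4 8) /\
  (universal_Z 4 8 8 /\ ~ universal_N 4 8 8) /\
  (universal_Z 4 4 10 /\ ~ universal_N 4 4 10) /\
  (universal_Z 5 5 10 /\ ~ universal_N 5 5 10).
Proof.
(* Each numeral is an integer missed at natural arguments; for example 4 at the end, because up to 4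
   both p_5 and p_10 take only the values 0 and 1 there. *)
split; first by split; [exact: universal_3_7_7 | apply: (@not_universal_N _ _ _ 27); vm_compute].
split; first by split; [exact: universal_4_5_5 | apply: (@not_universal_N _ _ _ 8); vm_compute].
split; first by split; [exact: universal_4_4_8 | apply: (@not_universal_N _ _ _ 7); vm_compute].
split; first by split; [exact: universal_4_8_8 | apply: (@not_universal_N _ _ _ 7); vm_compute].
split; first by split; [exact: universal_4_4_10 | apply: (@not_universal_N _ _ _ 7); vm_compute].
by split; [exact: universal_5_5_10 | apply: (@not_universal_N _ _ _ 4); vm_compute].
Qed.
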